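(* \textsc{Coordinated Sliding-Motion Planning} (CSMP) is fixed-parameter tractable parameterized by the number $k$ of robots: there is an algorithm that, given an instance $I=(G,\mathcal R=(\mathcal M,\mathcal F),k,\ell)$, decides whether $I$ is a YES-instance in time $f(k)\cdot |I|^{O(1)}$ for some computable function $f$.
   Context: CSMP (Coordinated Sliding-Motion Planning). An instance is $I=(G,\mathcal R=(\mathcal M,\mathcal F),k,\ell)$ where $G$ is an undirected graph, $\ell\in\mathbb N$, and $\mathcal R=\{R_1,\dots,R_k\}$ is a set of $k$ robots partitioned into $\mathcal M$ and $\mathcal F$. Each robot $R_i$ has a starting vertex $s_i\in V(G)$, the $s_i$ being pairwise distinct; each $R_i\in\mathcal M$ additionally has a destination vertex $t_i\in V(G)$, the $t_i$ being pairwise distinct. The terminals are the vertices in $\{s_i: i\in[k]\}\cup\{t_i: R_i\in\mathcal M\}$. A schedule with time steps $1,\dots,q$ starts with each $R_i$ on $s_i$ at time $0$; in each time step exactly one robot moves along a simple path of $G$ from its current vertex to another vertex such that no other robot is located on any vertex of that path (a sliding move), while all other robots stay where they are; in particular robots always occupy pairwise distinct vertices. The schedule is feasible if at the end every $R_i\in\mathcal M$ is on $t_i$. The number of moves (makespan) of a schedule is the number of time steps in which some robot changes position. $I$ is a YES-instance iff it has a feasible schedule with at most $\ell$ moves. *)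

(* Defs.v *)
From mathcomp Require Import all_boot.
Set Implicit Arguments. Unset Strict Implicit. Unset Printing Implicit Defensive.

(* An instance: vertices are 0..n-1; the undirected graph G has edge list
   [edges] (an edge (u,v) joins u and v in both directions); robot i
   (i < k := size robots) has start [(nth _ robots i).1] and, if it is in
   M, destination [Some t]; robots in F have [None]. [ell] is the budget. *)
Record csmp_instance := CSMP {
  inst_n : nat;
  inst_edges : seq (nat * nat);
  inst_robots : seq (nat * option nat);
  inst_ell : nat }.

Definition inst_k (I : csmp_instance) : nat := size (inst_robots I).

Definition starts (I : csmp_instance) : seq nat := map fst (inst_robots I).
Definition targets (I : csmp_instance) : seq nat := pmap snd (inst_robots I).

Definition valid_instance (I : csmp_instance) : bool :=
  [&& all (fun e => (e.1 < inst_n I) && (e.2 < inst_n I)) (inst_edges I),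
      all (fun x => x < inst_n I) (starts I),
      all (fun x => x < inst_n I) (targets I),
      uniq (starts I) & uniq (targets I)].

Definition adj (I : csmp_instance) (u v : nat) : bool :=
  ((u, v) \in inst_edges I) || ((v, u) \in inst_edges I).

(* A configuration: position of robot i is [nth 0 pos i]. *)
Definition config := seq nat.

Definition sliding_move (I : csmp_instance) (pos : config) (i : nat)
    (q : seq nat) (pos' : config) : Prop :=
  [/\ i < size pos,
      q != [::] &
      path (adj I) (nth 0 pos i) q] /\
  [/\ uniq (nth 0 pos i :: q),

      (forall j, j < size pos -> j != i ->
          nth 0 pos j \notin (nth 0 pos i :: q)) &
      pos' = set_nth 0 pos i (last (nth 0 pos i) q)].

Inductive reach (I : csmp_instance) : nat -> config -> config -> Prop :=
  | reach0 pos : reach I 0 pos pos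
  | reachS m pos pos1 pos' i q :
      sliding_move I pos i q pos1 -> reach I m pos1 pos' -> reach I m.+1 pos pos'.

Definition initial_config (I : csmp_instance) : config := starts I.

Definition goal_reached (I : csmp_instance) (pos : config) : Prop :=
  forall i t, i < inst_k I -> (nth (0, None) (inst_robots I) i).2 = Some t ->
    nth 0 pos i = t.

Definition csmp_yes (I : csmp_instance) : Prop :=
  exists m pos, m <= inst_ell I /\ reach I m (initial_config I) pos /\
                goal_reached I pos.

(* Part 2: a machine model (unit-cost RAM with addition, truncated         *)
(* subtraction, indirect addressing and conditional jumps; no             *)
(* multiplication, so polynomially equivalent to Turing machines).        *)

Inductive instr :=
  | IConst (r c : nat)
  | IAdd (r a b : nat)
  | ISub (r a b : nat)
  | ILoad (r a : nat)
  | IStore (a b : nat)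
  | IJz (r l : nat).

Definition program := seq instr.
Definition memory := nat -> nat.
Definition mstate := (nat * memory)%type.

Definition upd (m : memory) (a v : nat) : memory :=
  fun x => if x == a then v else m x.

Definition exec_instr (ins : instr) (pc : nat) (m : memory) : mstate :=
  match ins with
  | IConst r c => (pc.+1, upd m r c)
  | IAdd r a b => (pc.+1, upd m r (m a + m b))
  | ISub r a b => (pc.+1, upd m r (m a - m b))
  | ILoad r a => (pc.+1, upd m r (m (m a)))
  | IStore a b => (pc.+1, upd m (m a) (m b))
  | IJz r l => (if m r == 0 then l else pc.+1, m)
  end.

Definition halted (P : program) (s : mstate) : bool := size P <= s.1.

Inductive msteps (P : program) : nat -> mstate -> mstate -> Prop :=
  | msteps0 s : msteps P 0 s s
  | mstepsS t pc m ins s' :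
      pc < size P -> nth ins P pc = ins ->
      msteps P t (exec_instr ins pc m) s' -> msteps P t.+1 (pc, m) s'.

(* Input convention: cell 0 holds the length of the input word, cells
   1..len hold its entries, every other cell is 0.  Output: cell 0. *)
Definition init_state (input : seq nat) : mstate :=
  (0, fun x => if x == 0 then size input else nth 0 input x.-1).

Definition runs_within (P : program) (input : seq nat) (t out : nat) : Prop :=
  exists t' s, t' <= t /\ msteps P t' (init_state input) s /\
               halted P s /\ s.2 0 = out.

Definition computes_on (P : program) (input : seq nat) (out : nat) : Prop :=
  exists t, runs_within P input t out.

Definition computable (f : nat -> nat) : Prop :=
  exists P : program, forall x, computes_on P [:: x] (f x).

Definition enc_robot (r : nat * option nat) : seq nat :=
  match r.2 with
  | Some t => [:: r.1; 1; t]
  | None => [:: r.1; 0; 0]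
  end.

Definition encode (I : csmp_instance) : seq nat :=
  [:: inst_n I; size (inst_edges I)]
  ++ flatten (map (fun e => [:: e.1; e.2]) (inst_edges I))
  ++ [:: inst_k I]
  ++ flatten (map enc_robot (inst_robots I))
  ++ [:: inst_ell I].

Definition bitlen (x : nat) : nat := (trunc_log 2 x).+1.

Definition inst_size (I : csmp_instance) : nat := sumn (map bitlen (encode I)).

Definition csmp_fpt_in_k : Prop :=
  exists (A : program) (f : nat -> nat) (c : nat),
    computable f /\
    forall I : csmp_instance, valid_instance I ->
      exists out, runs_within A (encode I) (f (inst_k I) * inst_size I ^ c) out
                  /\ (out = 1 <-> csmp_yes I).

(* Main.v *)
Require Import Defs.
From mathcomp Require Import all_boot.
From mathcomp Require Import zify.
Set Implicit Arguments. Unset Strict Implicit. Unset Printing Implicit Defensive.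

(* Let T be the set of terminals and k the number of robots. The proof restricts the
   parking positions of the robots to a set whose size depends on k only, and then searches
   the configurations on this set; single moves are still tested in the whole graph.

   Let D be a component of G - T, S its neighbourhood in T and C a minimal connected subset
   of D that dominates D and S.
   - If more than k components have the same neighbourhood S, robots need to park only at one
     vertex in each of k of them: a further component connects S.
   - If D has at least k vertices outside C, robots need to park only at k of these: C
     connects them and S.
   - Otherwise C has O(k) non-cut vertices, so that removing few vertices from D leaves a
     bounded number of paths of vertices that have degree two in C. Two configurations that
     differ only by a shift along these paths are at most k moves apart, so shortest schedules
     have bounded length and use a bounded number of positions. On each path the used
     positions are moved, in order, to a bounded set: the next position is taken as early as
     possible, subject to having the same neighbours off the path and to the passed part of
     the path offering the same neighbours.

   The bounds are towers of exponentials in k. On the machine, functions are computed by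
   structured programs on immutable binary trees. *)

(** * Structured programs on immutable trees, and their compilation *)

(** The budget [ell] is part of the question, so no normalisation of a schedule may add moves:
    parking on slots replaces a move by at most one move, a shortened schedule is taken only where
    it is shorter, and the replacement on a path maps each move to one move. Robots on terminals
    stay there, which preserves the targets. Shortening has to precede the replacement on the paths,
    because the number of greedy positions is bounded by the number of positions that the schedule
    uses. These depend on the schedule, whereas the set to be searched must not; it therefore
    contains the outcomes of all sequences of greedy choices up to that number.

    On the machine, trees are immutable so that no write affects a value still in use; but shared
    subtrees let a tree grow exponentially in the time spent, and sizes are therefore bounded
    separately from times. A number has size one whatever its value, so the loops of the solver run
    over lists and never up to a number. The values of [ell] and of the number of vertices may be
    exponential in the size of the instance, and the algorithm must not count up to them. *)

Inductive val := Num of nat | Pr of val & val.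

Fixpoint vsz (v : val) : nat :=
  match v with Num _ => 1 | Pr a b => (vsz a + vsz b).+1 end.

(* Cells 0..7 hold the tree registers, 8 the heap pointer, 9 and 10 the
   constants 1 and 0, 11 is scratch; the heap starts at or above 16. *)
Definition hp := 8.
Definition cOne := 9.
Definition cZero := 10.
Definition cTmp := 11.
Definition heap0 := 16.

Ltac mlia := unfold heap0, hp, cOne, cZero, cTmp in *; lia.

(** Numbers are stored unboxed and pairs as pointers to two adjacent cells below the heap pointer. A
    word does not show which of the two it is; the shape is known from the type of the value. *)
Fixpoint rep (m : memory) (w : nat) (v : val) : Prop :=
  match v with
  | Num n => w = n
  | Pr a b => [/\ heap0 <= w, w.+1 < m hp, rep m (m w) a & rep m (m w.+1) b]
  end.

(** Allocated cells are never overwritten, so a represented value survives every write outside the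
    allocated heap and every advance of the heap pointer. *)
Lemma rep_ext m m' w v :
  (forall a, heap0 <= a < m hp -> m' a = m a) -> m hp <= m' hp ->
  rep m w v -> rep m' w v.
Proof.
move=> Hm Hh; elim: v w => [//|a IHa b IHb] w /= [H1 H2 H3 H4].
split=> //; first by lia.
- by rewrite Hm; [apply: IHa | lia].
- by rewrite Hm; [apply: IHb | lia].
Qed.

Definition regs := nat -> val.

Definition abs (m : memory) (s : regs) : Prop :=
  [/\ m cOne = 1, m cZero = 0, heap0 <= m hp & forall r, r < 8 -> rep m (m r) (s r)].

Definition supd (s : regs) (d : nat) (v : val) : regs :=
  fun r => if r == d then v else s r.

(** * Register operations, structured code and their machine code *)

Inductive mop :=
  | MConst of nat & nat
  | MAdd of nat & nat & nat
  | MSub of nat & nat & nat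
  | MMov of nat & nat
  | MCons of nat & nat & nat
  | MCar of nat & nat
  | MCdr of nat & nat.

Definition mop_ok (o : mop) : bool :=
  match o with
  | MConst d _ => d < 8
  | MAdd d a b | MSub d a b | MCons d a b => [&& d < 8, a < 8 & b < 8]
  | MMov d a | MCar d a | MCdr d a => (d < 8) && (a < 8)
  end.

Definition mexec (o : mop) (s : regs) : option regs :=
  match o with
  | MConst d n => Some (supd s d (Num n))
  | MAdd d a b => if (s a, s b) is (Num x, Num y) then Some (supd s d (Num (x + y))) else None
  | MSub d a b => if (s a, s b) is (Num x, Num y) then Some (supd s d (Num (x - y))) else None
  | MMov d a => Some (supd s d (s a))
  | MCons d a b => Some (supd s d (Pr (s a) (s b)))
  | MCar d a => if s a is Pr x _ then Some (supd s d x) else None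
  | MCdr d a => if s a is Pr _ y then Some (supd s d y) else None
  end.

Definition mcode (o : mop) : seq instr :=
  match o with
  | MConst d n => [:: IConst d n]
  | MAdd d a b => [:: IAdd d a b]
  | MSub d a b => [:: ISub d a b]
  | MMov d a => [:: IAdd d a cZero]
  | MCons d a b => [:: IAdd cTmp hp cZero; IStore hp a; IAdd hp hp cOne; IStore hp b;
                       IAdd hp hp cOne; IAdd d cTmp cZero]
  | MCar d a => [:: ILoad d a]
  | MCdr d a => [:: IAdd cTmp a cOne; ILoad d cTmp]
  end.

Fixpoint mexecs (os : seq mop) (s : regs) : option regs :=
  if os is o :: os' then obind (mexecs os') (mexec o s) else Some s.

Definition mcodes (os : seq mop) := flatten (map mcode os).

Inductive code :=
  | COps of seq mop
  | CSeq of code & code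
  | CIf of nat & code & code
  | CWhile of nat & code.

Fixpoint clen (c : code) : nat :=
  match c with
  | COps os => size (mcodes os)
  | CSeq c1 c2 => clen c1 + clen c2
  | CIf _ c1 c2 => (clen c1 + clen c2).+2
  | CWhile _ c => (clen c).+2
  end.

(** Jump targets of the machine are absolute, hence the start address [b]. An unconditional jump is
    a jump on the cell that always holds zero. *)
Fixpoint cgen (c : code) (b : nat) : seq instr :=
  match c with
  | COps os => mcodes os
  | CSeq c1 c2 => cgen c1 b ++ cgen c2 (b + clen c1)
  | CIf r c1 c2 => IJz r (b + clen c1 + 2) :: cgen c1 b.+1 ++
                   IJz cZero (b + clen c1 + 2 + clen c2) :: cgen c2 (b + clen c1 + 2)
  | CWhile r c => IJz r (b + clen c + 2) :: cgen c b.+1 ++ [:: IJz cZero b]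
  end.

Fixpoint code_ok (c : code) : bool :=
  match c with
  | COps os => all mop_ok os
  | CSeq c1 c2 => code_ok c1 && code_ok c2
  | CIf r c1 c2 => [&& r < 8, code_ok c1 & code_ok c2]
  | CWhile r c => (r < 8) && code_ok c
  end.

Lemma size_cgen c b : size (cgen c b) = clen c.
Proof.
elim: c b => [os|c1 IH1 c2 IH2|r c1 IH1 c2 IH2|r c IH] b //=;
  rewrite ?size_cat /= ?IH1 ?IH2 ?IH /=; lia.
Qed.

(** The number is the exact count of machine steps of the generated code. It includes the
    conditional jump, and the second jump that ends a first branch or a loop body. *)
Inductive cexec : code -> regs -> nat -> regs -> Prop :=
  | XOps os s s' : mexecs os s = Some s' -> cexec (COps os) s (size (mcodes os)) s'
  | XSeq c1 c2 s1 s2 s3 n1 n2 :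
      cexec c1 s1 n1 s2 -> cexec c2 s2 n2 s3 -> cexec (CSeq c1 c2) s1 (n1 + n2) s3
  | XIfT r c1 c2 s s' n :
      s r <> Num 0 -> cexec c1 s n s' -> cexec (CIf r c1 c2) s n.+2 s'
  | XIfF r c1 c2 s s' n :
      s r = Num 0 -> cexec c2 s n s' -> cexec (CIf r c1 c2) s n.+1 s'
  | XWhile0 r c s : s r = Num 0 -> cexec (CWhile r c) s 1 s
  | XWhileS r c s s1 s' n1 n2 :
      s r <> Num 0 -> cexec c s n1 s1 -> cexec (CWhile r c) s1 n2 s' ->
      cexec (CWhile r c) s (n1.+2 + n2) s'.

Definition fits (P : program) (b : nat) (c : seq instr) : Prop :=
  exists pre post, P = pre ++ c ++ post /\ size pre = b.

Lemma fits_cat P b c1 c2 : fits P b (c1 ++ c2) -> fits P b c1 /\ fits P (b + size c1) c2.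
Proof.
move=> [pre [post [-> <-]]]; split.
- by exists pre, (c2 ++ post); rewrite -!catA.
- by exists (pre ++ c1), post; rewrite -!catA size_cat.
Qed.

Lemma fits_cons P b i c : fits P b (i :: c) -> fits P b [:: i] /\ fits P b.+1 c.
Proof. by rewrite -cat1s => /fits_cat; rewrite addn1. Qed.

Lemma msteps_trans P n1 n2 s1 s2 s3 :
  msteps P n1 s1 s2 -> msteps P n2 s2 s3 -> msteps P (n1 + n2) s1 s3.
Proof.
elim=> [//|t pc m ins s' Hpc Hn _ IH] /IH H.
by rewrite addSn; apply: mstepsS Hn _.
Qed.

Lemma msteps_instr P b i m n s :
  fits P b [:: i] -> msteps P n (exec_instr i b m) s -> msteps P n.+1 (b, m) s.
Proof.
move=> [pre [post [-> <-]]]; apply: (@mstepsS _ _ (size pre) m).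
- by rewrite !size_cat /=; lia.
- by rewrite nth_cat ltnn subnn.
Qed.

Lemma updE m a v x : upd m a v x = if x == a then v else m x.
Proof. by []. Qed.

Lemma neq_lt (x y : nat) : x < y -> (x == y) = false.
Proof. by move=> H; lia. Qed.

Lemma neq_gt (x y : nat) : y < x -> (x == y) = false.
Proof. by move=> H; lia. Qed.

Lemma abs_upd m s d w v :
  abs m s -> d < 8 -> rep m w v -> abs (upd m d w) (supd s d v).
Proof.
move=> [H1 H2 H3 H4] Hd Hw.
have Hr u x : rep m u x -> rep (upd m d w) u x.
  apply: rep_ext => [a|]; rewrite updE /heap0 /hp; last by rewrite neq_gt; lia.
  by move=> ?; rewrite neq_gt //; lia.
split.
- by rewrite updE neq_gt // /cOne; lia.
- by rewrite updE neq_gt // /cZero; lia.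
- by rewrite updE neq_gt // /hp; lia.
- move=> r Hr8; rewrite /supd updE; case: eqP => // _; first exact: Hr.
  exact/Hr/H4.
Qed.

Lemma abs_tmp m s w : abs m s -> abs (upd m cTmp w) s.
Proof.
move=> [H1 H2 H3 H4]; split=> // r Hr.
rewrite updE neq_lt; last by rewrite /cTmp; lia.
apply: rep_ext (H4 r Hr) => // a; rewrite updE /heap0 /cTmp => ?.
by rewrite neq_gt //; lia.
Qed.

(** The new heap pointer and the list of changed cells are stated for the input loader, which
    allocates while part of the raw input is still to be read. *)
Lemma abs_cons m s a b d :
  abs m s -> d < 8 -> a < 8 -> b < 8 ->
  exists m', [/\ forall P pc, fits P pc (mcode (MCons d a b)) -> msteps P 6 (pc, m) (pc + 6, m'),
    abs m' (supd s d (Pr (s a) (s b))), m' hp = (m hp).+2 &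
    forall x, x \notin [:: d; hp; cTmp; m hp; (m hp).+1] -> m' x = m x].
Proof.
move=> Hs Hd Ha Hb.
pose m1 := upd m cTmp (m hp + m cZero).
have Hs1 : abs m1 s by apply: abs_tmp.
pose m2 := upd m1 (m1 hp) (m1 a).
pose m3 := upd m2 hp (m2 hp + m2 cOne).
pose m4 := upd m3 (m3 hp) (m3 b).
pose m5 := upd m4 hp (m4 hp + m4 cOne).
pose m6 := upd m5 d (m5 cTmp + m5 cZero).
exists m6.
have X0 P pc : fits P pc (mcode (MCons d a b)) -> msteps P 6 (pc, m) (pc + 6, m6).
  move=> H.
  move: H => /fits_cons [Fi /fits_cons [Fi2 /fits_cons [Fi3 /fits_cons [Fi4 /fits_cons [Fi5 F]]]]].
  do 5! (apply: msteps_instr; first eassumption; rewrite [exec_instr _ _ _]/=).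
  apply: msteps_instr; first exact: F.
  rewrite [exec_instr _ _ _]/= !addnS addn0; exact: msteps0.
move: Hs => [H1 H2 H3 H4].
have E1 x : x < heap0 -> x != cTmp -> m1 x = m x.
  by move=> Hx /negbTE; rewrite /m1 updE => ->.
have Hh1 : m1 hp = m hp by apply: E1.
have E2 x : x < heap0 -> m2 x = m1 x.
  by move=> Hx; rewrite /m2 updE neq_lt // Hh1; mlia.
have Hh3 : m3 hp = (m hp).+1.
  by rewrite /m3 updE eqxx !E2 // E1 // E1 // H1 addn1.
have E3 x : x < heap0 -> x != hp -> m3 x = m1 x.
  by move=> Hx /negbTE Hn; rewrite /m3 updE Hn E2.
have E4 x : x < heap0 -> m4 x = m3 x.
  by move=> Hx; rewrite /m4 updE neq_lt // Hh3; mlia.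
have Hh5 : m5 hp = (m hp).+2.
  by rewrite /m5 updE eqxx !E4 // Hh3 E3 // E1 // H1 addn1.
have E5 x : x < heap0 -> x != hp -> m5 x = m1 x.
  by move=> Hx Hn; rewrite /m5 updE (negbTE Hn) E4 // E3.
have Hc : forall x, heap0 <= x -> x != m hp -> x != (m hp).+1 -> m5 x = m x.
  move=> x Hx /negbTE N1 /negbTE N2.
  have Nhp : (x == hp) = false by rewrite neq_gt //; mlia.
  have Ntp : (x == cTmp) = false by rewrite neq_gt //; mlia.
  by rewrite /m5 updE Nhp /m4 updE Hh3 N2 /m3 updE Nhp /m2 updE Hh1 N1 /m1 updE Ntp.
have Hhd : m5 (m hp) = m a.
  have N : (m hp == hp) = false by rewrite neq_gt //; mlia.
  rewrite /m5 updE N /m4 updE Hh3 neq_lt // /m3 updE N /m2 updE Hh1 eqxx E1 //.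
    by rewrite /heap0; mlia.
  by rewrite /cTmp; mlia.
have Htl : m5 (m hp).+1 = m b.
  have N : ((m hp).+1 == hp) = false by rewrite neq_gt //; mlia.
  rewrite /m5 updE N /m4 updE Hh3 eqxx E3 ?E1 //; mlia.
have R5 w v : rep m w v -> rep m5 w v.
  apply: rep_ext; last by rewrite Hh5; mlia.
  by move=> x Hx; apply: Hc; mlia.
have A5 : abs m5 s.
  split.
  - by rewrite E5 // E1.
  - by rewrite E5 // E1.
  - by rewrite Hh5; mlia.
  - move=> r Hr; rewrite E5 ?E1 //; try (mlia).
    exact/R5/H4.
have Ehp : m5 cTmp + m5 cZero = m hp.
  by rewrite !E5 // (E1 cZero) // H2 addn0 /m1 updE eqxx H2 addn0.
split=> //; first last.
- move=> x; rewrite !inE !negb_or => /and5P[/negbTE N1 /negbTE N2 /negbTE N3 /negbTE N4 /negbTE N5].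
  by rewrite /m6 updE N1 /m5 updE N2 /m4 updE Hh3 N5 /m3 updE N2 /m2 updE Hh1 N4 /m1 updE N3.
- by rewrite /m6 updE neq_gt ?Hh5 //; mlia.
apply: abs_upd => //; rewrite Ehp.
split=> //; first by rewrite Hh5.
- by rewrite Hhd; apply/R5/H4.
- by rewrite Htl; apply/R5/H4.
Qed.

Lemma run_mop o s s' P b m :
  mop_ok o -> fits P b (mcode o) -> abs m s -> mexec o s = Some s' ->
  exists m', msteps P (size (mcode o)) (b, m) (b + size (mcode o), m') /\ abs m' s'.
Proof.
move=> Ho F Hs E.
have Hs0 := Hs; case: Hs0 => H1 H2 H3 H4.
case: o Ho F E => [d n|d a a'|d a a'|d a|d a a'|d a|d a] /= Ho F.
- case=> <-; exists (upd m d n); split; last exact: abs_upd.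
  by apply: (msteps_instr F); rewrite addn1; apply: msteps0.
- case/and3P: Ho => Hd Ha Hb.
  have := H4 _ Ha; have := H4 _ Hb; case: (s a) => // x; case: (s a') => // y /= Ey Ex [<-].
  exists (upd m d (m a + m a')); split; last by apply: abs_upd => //=; rewrite Ex Ey.
  by apply: (msteps_instr F); rewrite addn1; apply: msteps0.
- case/and3P: Ho => Hd Ha Hb.
  have := H4 _ Ha; have := H4 _ Hb; case: (s a) => // x; case: (s a') => // y /= Ey Ex [<-].
  exists (upd m d (m a - m a')); split; last by apply: abs_upd => //=; rewrite Ex Ey.
  by apply: (msteps_instr F); rewrite addn1; apply: msteps0.
- case/andP: Ho => Hd Ha [<-].
  exists (upd m d (m a + m cZero)); split; last by apply: abs_upd => //; rewrite H2 addn0; apply: H4.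
  by apply: (msteps_instr F); rewrite addn1; apply: msteps0.
- case/and3P: Ho => Hd Ha Hb [<-].
  have [m' [X1 X2 _ _]] := abs_cons Hs Hd Ha Hb.
  by exists m'; split=> //; apply: X1.
- case/andP: Ho => Hd Ha.
  have := H4 _ Ha; case: (s a) => // x y /= [W1 W2 W3 W4] [<-].
  exists (upd m d (m (m a))); split; last exact: abs_upd.
  by apply: (msteps_instr F); rewrite addn1; apply: msteps0.
- case/andP: Ho => Hd Ha.
  have := H4 _ Ha; case E: (s a) => [//|x y] /= [W1 W2 W3 W4] [<-].
  case/fits_cons: F => F1 F2.
  pose m1 := upd m cTmp (m a + m cOne).
  exists (upd m1 d (m1 (m1 cTmp))); split.
    apply: (msteps_instr F1) => /=; apply: (msteps_instr F2) => /=.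
    by rewrite addn2; apply: msteps0.
  apply: abs_upd => //; first exact: abs_tmp.
  have -> : m1 cTmp = (m a).+1 by rewrite /m1 updE eqxx H1 addn1.
  have -> : m1 (m a).+1 = m (m a).+1.
    by rewrite /m1 updE neq_gt //; move: W1; rewrite /heap0 /cTmp; lia.
  apply: rep_ext W4 => // z; rewrite /heap0 => Hz.
  by rewrite /m1 updE neq_gt // /cTmp; lia.
Qed.

Lemma run_mops os s s' P b m :
  all mop_ok os -> fits P b (mcodes os) -> abs m s -> mexecs os s = Some s' ->
  exists m', msteps P (size (mcodes os)) (b, m) (b + size (mcodes os), m') /\ abs m' s'.
Proof.
elim: os s b m => [|o os IH] s b m /=.
  by move=> _ _ Hs [<-]; exists m; rewrite addn0; split=> //; apply: msteps0.
case/andP=> Ho Hos /fits_cat [F1 F2] Hs; case E: (mexec o s) => [s1|//] /= E2.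
have [m1 [X1 A1]] := run_mop Ho F1 Hs E.
have [m2 [X2 A2]] := IH _ _ _ Hos F2 A1 E2.
exists m2; split=> //.
by rewrite /mcodes /= size_cat addnA; apply: msteps_trans X1 X2.
Qed.

(** Pointers are at least [heap0], hence non-zero. The zero test of the machine thus separates
    [Num 0], which encodes false and the empty list, from every pair. *)
Lemma abs_zero m s r : abs m s -> r < 8 -> (m r == 0) <-> s r = Num 0.
Proof.
move=> [_ _ _ H] /H; case: (s r) => [n|x y] /=.
  by move=> ->; split=> [/eqP-> //|[->]].
by rewrite /heap0 => -[W1 _ _ _]; split=> //; lia.
Qed.

Lemma run_code c s n s' P b m :
  code_ok c -> cexec c s n s' -> fits P b (cgen c b) -> abs m s ->
  exists m', msteps P n (b, m) (b + clen c, m') /\ abs m' s'.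
Proof.
move=> Hok X; elim: X b m Hok => {c s n s'}.
- by move=> os s s' E b m Hok F A; apply: run_mops E.
- move=> c1 c2 s1 s2 s3 n1 n2 _ IH1 _ IH2 b m /= /andP[O1 O2] /fits_cat [F1 F2] A.
  rewrite size_cgen in F2.
  have [m1 [X1 A1]] := IH1 _ _ O1 F1 A.
  have [m2 [X2 A2]] := IH2 _ _ O2 F2 A1.
  by exists m2; rewrite addnA; split=> //; apply: msteps_trans X1 X2.
- move=> r c1 c2 s s' n Hr _ IH b m /= /and3P[Or O1 O2] /fits_cons [F0 /fits_cat [F1 /fits_cons [F2 _]]] A.
  have [m1 [X1 A1]] := IH _ _ O1 F1 A.
  exists m1; split=> //.
  apply: (msteps_instr F0) => /=.
  have -> : (m r == 0) = false by apply/negP=> /(abs_zero A Or).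
  rewrite -[n.+1]addn1; apply: msteps_trans X1 _.
  rewrite size_cgen in F2.
  apply: (msteps_instr F2) => /=; case: A1 => _ -> _ _ /=.
  rewrite (_ : b + clen c1 + 2 + clen c2 = b + (clen c1 + clen c2).+2); last by lia.
  exact: msteps0.
- move=> r c1 c2 s s' n Hr _ IH b m /= /and3P[Or O1 O2] /fits_cons [F0 /fits_cat [_ /fits_cons [_ F2]]] A.
  rewrite size_cgen (_ : (b.+1 + clen c1).+1 = b + clen c1 + 2) in F2; last by lia.
  have [m1 [X1 A1]] := IH _ _ O2 F2 A.
  exists m1; split=> //.
  apply: (msteps_instr F0) => /=.
  have -> : (m r == 0) by apply/(abs_zero A Or).
  by rewrite (_ : b + (clen c1 + clen c2).+2 = b + clen c1 + 2 + clen c2); last lia.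
- move=> r c s Hr b m /= /andP[Or O1] /fits_cons [F0 _] A.
  exists m; split=> //; apply: (msteps_instr F0) => /=.
  have -> : (m r == 0) by apply/(abs_zero A Or).
  by rewrite (_ : b + (clen c).+2 = b + clen c + 2); [apply: msteps0 | lia].
- move=> r c s s1 s' n1 n2 Hr _ IH1 _ IH2 b m /= /andP[Or O1] F A.
  have [F0 F1] := fits_cons F; have [F2 F3] := fits_cat F1.
  have [m1 [X1 A1]] := IH1 _ _ O1 F2 A.
  have [m2 [X2 A2]] : exists m', msteps P n2 (b, m1) (b + clen (CWhile r c), m') /\ abs m' s'.
    by apply: IH2 => //=; rewrite Or.
  exists m2; split=> //.
  rewrite addSn; apply: (msteps_instr F0) => /=.
  have -> : (m r == 0) = false by apply/negP=> /(abs_zero A Or).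
  rewrite (_ : n1.+1 + n2 = n1 + n2.+1); last by lia.
  apply: msteps_trans X1 _.
  rewrite size_cgen in F3.
  by apply: (msteps_instr F3) => /=; case: A1 => _ -> _ _.
Qed.

(** * Functions computed by structured programs *)

Structure encType := EncType { esort :> Type; enc : esort -> val }.

Canonical enc_nat := EncType Num.
Canonical enc_bool := EncType (fun b : bool => Num b).
Canonical enc_pair (A B : encType) := EncType (fun x : A * B => Pr (enc x.1) (enc x.2)).
Canonical enc_seq (A : encType) := EncType (foldr (fun (x : A) v => Pr (enc x) v) (Num 0)).

Definition sz (A : encType) (x : A) : nat := vsz (enc x).

(* Register 0 holds the argument and then the result, register 1 a stack
   that every fragment leaves as it found it. *)
Definition computes (A B : encType) (c : code) (f : A -> B) (t : A -> nat) :=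
  code_ok c /\ forall x s, s 0 = enc x ->
  exists n s', [/\ n <= t x, cexec c s n s', s' 0 = enc (f x) & s' 1 = s 1].

Lemma xops os s s' n : mexecs os s = Some s' -> size (mcodes os) = n -> cexec (COps os) s n s'.
Proof. by move=> E <-; apply: XOps. Qed.

Ltac xstep := apply: xops; [rewrite /= | by []].

Section Combinators.
Variables (A B C D : encType).

Lemma computes_weaken c (f g : A -> B) t t' :
  computes c f t -> (forall x, f x = g x) -> (forall x, t x <= t' x) -> computes c g t'.
Proof.
move=> [Ok X] E L; split=> // x s /X [n [s' [H1 H2 H3 H4]]].
by exists n, s'; split=> //; [apply: leq_trans H1 _ | rewrite -E].
Qed.

Lemma computes_id : computes (COps [::]) (fun x : A => x) (fun _ => 0).
Proof. by split=> // x s E; exists 0, s; split=> //; apply: xops. Qed.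

Lemma computes_comp c1 c2 (f : A -> B) (g : B -> C) t1 t2 :
  computes c1 f t1 -> computes c2 g t2 ->
  computes (CSeq c1 c2) (fun x => g (f x)) (fun x => t1 x + t2 (f x)).
Proof.
move=> [O1 X1] [O2 X2]; split; first by rewrite /= O1.
move=> x s /X1 [n1 [s1 [L1 E1 R1 S1]]].
have [n2 [s2 [L2 E2 R2 S2]]] := X2 _ _ R1.
exists (n1 + n2), s2; split=> //; [exact: leq_add | exact: XSeq E1 E2 | by rewrite S2].
Qed.

(** A fragment may destroy every register except the stack, so the argument waits on the stack while
    [c1] runs, and the result of [c1] while [c2] runs. *)
Definition pair_code c1 c2 :=
  CSeq (COps [:: MCons 1 0 1]) (CSeq c1
  (CSeq (COps [:: MCdr 2 1; MCar 3 1; MCons 1 0 2; MMov 0 3]) (CSeq c2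
  (COps [:: MCar 2 1; MCdr 1 1; MCons 0 2 0])))).

Lemma computes_pair c1 c2 (f : A -> B) (g : A -> C) t1 t2 :
  computes c1 f t1 -> computes c2 g t2 ->
  computes (pair_code c1 c2) (fun x => (f x, g x)) (fun x => t1 x + t2 x + 25).
Proof.
move=> [O1 X1] [O2 X2]; split; first by rewrite /= O1 O2.
move=> x s E.
pose s1 := supd s 1 (Pr (s 0) (s 1)).
have [n1 [s2 [L1 E1 R1 S1]]] := X1 x s1 E.
pose s3 := supd (supd (supd (supd s2 2 (s 1)) 3 (s 0)) 1 (Pr (s2 0) (s 1))) 0 (s 0).
have [n2 [s4 [L2 E2 R2 S2]]] := X2 x s3 E.
exists (6 + (n1 + (10 + (n2 + 9)))), (supd (supd (supd s4 2 (s2 0)) 1 (s 1)) 0 (Pr (s2 0) (s4 0))).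
split=> //; first by lia.
- apply: XSeq; first by xstep.
  apply: XSeq E1 _; apply: XSeq; first by xstep; rewrite S1 /= /supd /= S1 /=.
  apply: XSeq E2 _; xstep.
  by rewrite S2 /= /supd /= S2.
- by rewrite /= /supd /= R1 R2.
Qed.

Lemma computes_const n : computes (COps [:: MConst 0 n]) (fun _ : A => n) (fun _ => 1).
Proof. by split=> // x s E; exists 1, (supd s 0 (Num n)); split=> //; xstep. Qed.

Lemma computes_fst : computes (COps [:: MCar 0 0]) (fun x : A * B => x.1) (fun _ => 1).
Proof.
split=> // x s E; exists 1, (supd s 0 (enc x.1)); split=> //.
by xstep; rewrite E.
Qed.

Lemma computes_snd : computes (COps [:: MCdr 0 0]) (fun x : A * B => x.2) (fun _ => 2).
Proof.
split=> // x s E; exists 2, (supd s 0 (enc x.2)); split=> //.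
by xstep; rewrite E.
Qed.

Definition if_code c c1 c2 :=
  CSeq (COps [:: MCons 1 0 1]) (CSeq c
  (CSeq (COps [:: MMov 2 0; MCar 0 1; MCdr 1 1]) (CIf 2 c1 c2))).

Lemma computes_if c c1 c2 (b : A -> bool) (f g : A -> B) t t1 t2 :
  computes c b t -> computes c1 f t1 -> computes c2 g t2 ->
  computes (if_code c c1 c2) (fun x => if b x then f x else g x) (fun x => t x + t1 x + t2 x + 12).
Proof.
move=> [O X] [O1 X1] [O2 X2]; split; first by rewrite /= O O1 O2.
move=> x s E.
pose s1 := supd s 1 (Pr (s 0) (s 1)).
have [n [s2 [L E' R S]]] := X x s1 E.
pose s3 := supd (supd (supd s2 2 (s2 0)) 0 (s 0)) 1 (s 1).
have M : mexecs [:: MMov 2 0; MCar 0 1; MCdr 1 1] s2 = Some s3.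
  by rewrite /= /supd /= S /= S.
have E3 : s3 0 = enc x by [].
have R3 : s3 2 = enc (b x) by rewrite -R.
case Eb : (b x) in R3 *.
- have [n1 [s4 [L1 E1 R1 S1]]] := X1 x s3 E3.
  exists (6 + (n + (4 + n1.+2))), s4; split=> //; first by lia.
  apply: XSeq; first by xstep.
  apply: XSeq E' _; apply: XSeq; first by apply: xops M _.
  by apply: XIfT => //; rewrite R3.
- have [n1 [s4 [L1 E1 R1 S1]]] := X2 x s3 E3.
  exists (6 + (n + (4 + n1.+1))), s4; split=> //; first by lia.
  apply: XSeq; first by xstep.
  apply: XSeq E' _; apply: XSeq; first by apply: xops M _.
  by apply: XIfF.
Qed.

(** Between rounds the top of the stack is the pair of the fixed argument and the remaining list;
    register 3, on which the loop tests, is reloaded from it after the body has run. *)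
Definition fold_code c :=
  CSeq (COps [:: MCar 2 0; MCdr 3 0; MCar 0 3; MCdr 3 3; MCons 4 2 3; MCons 1 4 1])
 (CSeq (CWhile 3 (CSeq (COps [:: MCar 4 1; MCar 2 4; MCdr 3 4; MCar 5 3; MCdr 3 3;
                                 MCons 5 0 5; MCons 0 2 5; MCdr 6 1; MCons 4 2 3; MCons 1 4 6])
                 (CSeq c (COps [:: MCar 4 1; MCdr 3 4]))))
       (COps [:: MCdr 1 1])).

Fixpoint fold_time (f : A -> B -> C -> B) (t : A * (B * C) -> nat) (a : A) (b : B) (l : seq C) : nat :=
  if l is h :: l' then t (a, (b, h)) + 50 + fold_time f t a (f a b h) l' else 0.

Lemma computes_fold c (f : A -> B -> C -> B) t :
  computes c (fun x : A * (B * C) => f x.1 x.2.1 x.2.2) t ->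
  computes (fold_code c) (fun x : A * (B * seq C) => foldl (f x.1) x.2.1 x.2.2)
    (fun x => fold_time f t x.1 x.2.1 x.2.2 + 50).
Proof.
move=> [O X]; split; first by rewrite /= O.
move=> [a [b l]] s E.
have Loop : forall l b s, s 0 = enc b -> s 3 = enc l -> (exists st, s 1 = Pr (Pr (enc a) (enc l)) st) ->
  exists n s', [/\ n <= fold_time f t a b l + 1,
    cexec (CWhile 3 (CSeq (COps [:: MCar 4 1; MCar 2 4; MCdr 3 4; MCar 5 3; MCdr 3 3;
                                 MCons 5 0 5; MCons 0 2 5; MCdr 6 1; MCons 4 2 3; MCons 1 4 6])
                 (CSeq c (COps [:: MCar 4 1; MCdr 3 4])))) s n s',
    s' 0 = enc (foldl (f a) b l) & exists v, s' 1 = Pr v (if s 1 is Pr _ st then st else s 1)].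
  elim=> [|h l' IH] b' s0 E0 E3 [st E1].
    by exists 1, s0; split=> //; [apply: XWhile0 | exists (Pr (enc a) (Num 0)); rewrite E1].
  pose ea := enc a; pose eb := enc b'; pose eh := enc h; pose el := enc l'.
  pose s1 := supd (supd (supd (supd (supd (supd (supd (supd (supd (supd s0
     4 (Pr ea (Pr eh el))) 2 ea) 3 (Pr eh el)) 5 eh) 3 el)
     5 (Pr eb eh)) 0 (Pr ea (Pr eb eh))) 6 st) 4 (Pr ea el)) 1 (Pr (Pr ea el) st).
  have [n1 [s2 [L2 X2 R2 S2]]] := X (a, (b', h)) s1 erefl.
  pose s3 := supd (supd s2 4 (Pr ea el)) 3 el.
  have [|||n3 [s4 [L3 X3 R3 [v S3]]]] := IH (f a b' h) s3.
  - by rewrite /s3 /supd /= R2.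
  - by [].
  - by exists st; rewrite /s3 /supd /= S2.
  exists ((33 + (n1 + 3)).+2 + n3), s4; split=> //.
  - by move: L2 L3; rewrite [fold_time _ _ _ _ (_ :: _)]/=; lia.
  - apply: XWhileS X3; first by rewrite E3.
    apply: XSeq; first by xstep; rewrite !E1 /= /supd /= E1 E0.
    by apply: XSeq X2 _; xstep; rewrite !S2 /= /supd /= ?S2.
  - by exists v; rewrite S3 /s3 /supd /= S2 /= E1.
pose ea := enc a; pose eb := enc b; pose el := enc l.
pose s1 := supd (supd (supd (supd (supd (supd s 2 ea) 3 (Pr eb el)) 0 eb) 3 el) 4 (Pr ea el))
  1 (Pr (Pr ea el) (s 1)).
have [|||n [s2 [L2 X2 R2 [v S2]]]] := Loop l b s1; rewrite //.
  by exists (s 1).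
exists (18 + (n + 2)), (supd s2 1 (s 1)); split=> //; first by rewrite [_.1]/= [_.2.1]/= [_.2.2]/=; lia.
apply: XSeq; first by xstep; rewrite !E /= /supd /= ?E.
by apply: XSeq X2 _; xstep; rewrite S2.
Qed.

End Combinators.

Lemma computes_cons (A : encType) :
  computes (COps [::]) (fun x : A * seq A => x.1 :: x.2) (fun _ => 0).
Proof. by split=> // x s E; exists 0, s; split=> //; apply: xops. Qed.

Lemma computes_nil (A B : encType) :
  computes (COps [:: MConst 0 0]) (fun _ : A => [::] : seq B) (fun _ => 1).
Proof. by split=> // x s E; exists 1, (supd s 0 (Num 0)); split=> //; xstep. Qed.

Lemma computes_bool (A : encType) (b : bool) :
  computes (COps [:: MConst 0 b]) (fun _ : A => b) (fun _ => 1).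
Proof. by split=> // x s E; exists 1, (supd s 0 (Num b)); split=> //; xstep. Qed.

Lemma computes_add : computes (COps [:: MCar 2 0; MCdr 3 0; MAdd 0 2 3])
  (fun x : nat * nat => x.1 + x.2) (fun _ => 4).
Proof.
split=> // x s E; exists 4, (supd (supd (supd s 2 (Num x.1)) 3 (Num x.2)) 0 (Num (x.1 + x.2))).
by split=> //; xstep; rewrite !E /= /supd /= ?E.
Qed.

Lemma computes_sub : computes (COps [:: MCar 2 0; MCdr 3 0; MSub 0 2 3])
  (fun x : nat * nat => x.1 - x.2) (fun _ => 4).
Proof.
split=> // x s E; exists 4, (supd (supd (supd s 2 (Num x.1)) 3 (Num x.2)) 0 (Num (x.1 - x.2))).
by split=> //; xstep; rewrite !E /= /supd /= ?E.
Qed.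

Lemma computes_eq0 : computes (CIf 0 (COps [:: MConst 0 0]) (COps [:: MConst 0 1]))
  (fun x : nat => x == 0) (fun _ => 3).
Proof.
split=> // x s E; case: x E => [|x] E.
- exists 2, (supd s 0 (Num 1)); split=> //; apply: XIfF => //.
  by xstep.
- exists 3, (supd s 0 (Num 0)); split=> //; apply: XIfT; first by rewrite E.
  by xstep.
Qed.

(** The time is linear in the value of the argument, which is not polynomial in its size. This code
    serves only to show that towers are computable. *)
Definition pow2_code :=
  CSeq (COps [:: MConst 2 1; MConst 3 1])
 (CSeq (CWhile 0 (COps [:: MAdd 2 2 2; MSub 0 0 3])) (COps [:: MMov 0 2])).

Lemma computes_pow2 : computes pow2_code (fun x : nat => 2 ^ x) (fun x => 4 * x + 4).
Proof.
split=> // x s E.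
have Loop : forall x y s, s 0 = Num x -> s 2 = Num y -> s 3 = Num 1 ->
  exists s', [/\ cexec (CWhile 0 (COps [:: MAdd 2 2 2; MSub 0 0 3])) s (4 * x + 1) s',
   s' 2 = Num (y * 2 ^ x) & s' 1 = s 1].
  elim=> [|x' IH] y s0 E0 E2 E3.
    by exists s0; split=> //; [apply: XWhile0 | rewrite muln1].
  have [||| s1 [X1 R1 S1]] := IH (y + y) (supd (supd s0 2 (Num (y + y))) 0 (Num x')) => //.
  exists s1; split=> //; last by rewrite R1 addnn -mul2n -mulnA expnS mulnCA.
  rewrite (_ : 4 * x'.+1 + 1 = 2.+2 + (4 * x' + 1)); last by lia.
  apply: XWhileS X1; first by rewrite E0.
  by xstep; rewrite E2 /= /supd /= E0 E3 subn1.
have [||| s1 [X1 R1 S1]] := Loop x 1 (supd (supd s 2 (Num 1)) 3 (Num 1)) => //.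
exists (2 + ((4 * x + 1) + 1)), (supd s1 0 (s1 2)); split=> //.
- by rewrite /=; lia.
- by apply: XSeq; [xstep | apply: XSeq X1 _; xstep].
- by rewrite /= /supd /= R1 mul1n.
Qed.

(** * Polynomial time *)

(** With a base of at least two, a larger exponent absorbs constants and sums, so that one exponent
    describes a polynomial bound. *)
Definition polyb (p : nat -> nat) := exists d, forall n, p n <= n.+2 ^ d.

Lemma polyb_le p q : polyb q -> (forall n, p n <= q n) -> polyb p.
Proof. by move=> [d H] L; exists d => n; apply: leq_trans (L n) (H n). Qed.

Lemma pow_ge1 n d : 0 < n.+2 ^ d.
Proof. by rewrite expn_gt0. Qed.

Lemma polyb_pow d : polyb (fun n => n.+2 ^ d).
Proof. by exists d. Qed.

Lemma polyb_id : polyb (fun n => n).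
Proof. by exists 1 => n; rewrite expn1; lia. Qed.

Lemma polyb_const c : polyb (fun _ => c).
Proof.
exists c => n; apply: leq_trans (_ : 2 ^ c <= _); first exact/ltnW/ltn_expl.
by case: c => // c; rewrite leq_exp2r.
Qed.

Lemma polyb_add p q : polyb p -> polyb q -> polyb (fun n => p n + q n).
Proof.
move=> [d H] [e L]; exists (d + e).+1 => n.
have := H n; have := L n; rewrite expnS expnD.
have := pow_ge1 n d; have := pow_ge1 n e.
move: (n.+2 ^ d) (n.+2 ^ e) => a b; nia.
Qed.

Lemma polyb_mul p q : polyb p -> polyb q -> polyb (fun n => p n * q n).
Proof. by move=> [d H] [e L]; exists (d + e) => n; rewrite expnD leq_mul. Qed.

Lemma polyb_exp p d : polyb p -> polyb (fun n => p n ^ d).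
Proof.
elim: d => [|d IH] Hp; first exact: (polyb_const 1).
by apply: polyb_le (polyb_mul Hp (IH Hp)) _ => n; rewrite expnS.
Qed.

Lemma polyb_S p : polyb p -> polyb (fun n => (p n).+1).
Proof. by move=> H; apply: polyb_le (polyb_add H (polyb_const 1)) _ => n; rewrite addn1. Qed.

Lemma polyb_comp p q : polyb p -> polyb q -> polyb (fun n => p (q n)).
Proof.
move=> [d H] Hq; apply: polyb_le (polyb_exp d (polyb_S (polyb_S Hq))) _ => n; exact: H.
Qed.

Ltac polyb := repeat first
  [ exact: polyb_const | exact: polyb_id | exact: polyb_pow | apply: polyb_S | apply: polyb_add
  | apply: polyb_mul | apply: polyb_exp ].

(** The bound on the size of the result does not follow from the time bound: with shared subtrees, n
    steps can build a tree of size exponential in n. *)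
Definition FP (A B : encType) (f : A -> B) : Prop :=
  exists c d, computes c f (fun x => (sz x).+2 ^ d) /\ forall x, sz (f x) <= (sz x).+2 ^ d.

Lemma vsz_gt0 v : 0 < vsz v.
Proof. by case: v. Qed.

Lemma sz_gt0 (A : encType) (x : A) : 0 < sz x.
Proof. exact: vsz_gt0. Qed.

Lemma sz_nat (n : nat) : sz n = 1. Proof. by []. Qed.
Lemma sz_pair (A B : encType) (x : A * B) :
  sz x = (sz x.1 + sz x.2).+1.
Proof. by []. Qed.

Lemma sz_cons (A : encType) (x : A) l : sz (x :: l) = (sz x + sz l).+1.
Proof. by []. Qed.

Lemma sz_cat (A : encType) (l1 l2 : seq A) : (sz (l1 ++ l2)).+1 = sz l1 + sz l2.
Proof. by elim: l1 => [|x l IH] //; rewrite cat_cons !sz_cons; lia. Qed.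

Lemma sz_rev (A : encType) (l : seq A) : sz (rev l) = sz l.
Proof.
elim: l => [//|x l IH]; have := sz_cat (rev l) [:: x].
by rewrite rev_cons -cats1 IH !sz_cons; change (sz [::]) with 1; lia.
Qed.

Lemma size_sz (A : encType) (l : seq A) : size l < sz l.
Proof. by elim: l => [//|x l IH]; rewrite sz_cons /=; have := sz_gt0 x; lia. Qed.

Lemma sz_natseq (l : seq nat) : sz l = (size l).*2.+1.
Proof. by elim: l => [//|x l IH]; rewrite sz_cons IH sz_nat /= doubleS; lia. Qed.

Section FPintro.
Variables (A B : encType).

Lemma FP_intro c (f : A -> B) t p :
  computes c f t -> polyb p -> (forall x, t x <= p (sz x)) -> (forall x, sz (f x) <= p (sz x)) -> FP f.
Proof.
move=> X [d Hp] Ht Hs; exists c, d; split; last by move=> x; apply: leq_trans (Hs x) (Hp _).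
by apply: computes_weaken X _ _ => // x; apply: leq_trans (Ht x) (Hp _).
Qed.

Lemma FP_ext (f g : A -> B) : FP f -> (forall x, f x = g x) -> FP g.
Proof.
move=> [c [d [X S]]] E; exists c, d; split; first exact: computes_weaken X E _.
by move=> x; rewrite -E.
Qed.

End FPintro.

Section FPlemmas.
Variables (A B C D : encType).

Lemma FP_id : FP (fun x : A => x).
Proof. by apply: (FP_intro (@computes_id A) polyb_id). Qed.

Lemma FP_const (n : nat) : FP (fun _ : A => n).
Proof. exact: (FP_intro (@computes_const A n) (polyb_const 1)). Qed.

Lemma FP_bool (b : bool) : FP (fun _ : A => b).
Proof. exact: (FP_intro (@computes_bool A b) (polyb_const 1)). Qed.

Lemma FP_nil : FP (fun _ : A => [::] : seq B).
Proof. exact: (FP_intro (@computes_nil A B) (polyb_const 1)). Qed.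

Lemma FP_comp (g : B -> C) (f : A -> B) : FP g -> FP f -> FP (fun x => g (f x)).
Proof.
move=> [c2 [d2 [X2 S2]]] [c1 [d1 [X1 S1]]].
pose p n := n.+2 ^ d1 + (n.+2 ^ d1).+2 ^ d2.
have Hp : polyb p by rewrite /p; polyb.
have L x : (sz (f x)).+2 ^ d2 <= ((sz x).+2 ^ d1).+2 ^ d2.
  by case: (d2) => // e; rewrite leq_exp2r // !ltnS S1.
apply: (FP_intro (computes_comp X1 X2) Hp) => x; rewrite /p.
- by rewrite leq_add2l.
- by apply: leq_trans (S2 _) _; apply: leq_trans (L x) _; apply: leq_addl.
Qed.

Lemma FP_pair (f : A -> B) (g : A -> C) : FP f -> FP g -> FP (fun x => (f x, g x)).
Proof.
move=> [c1 [d1 [X1 S1]]] [c2 [d2 [X2 S2]]].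
pose p n := n.+2 ^ d1 + n.+2 ^ d2 + 25.
have Hp : polyb p by rewrite /p; polyb.
apply: (FP_intro (computes_pair X1 X2) Hp) => x; rewrite /p ?sz_pair //=.
by have := S1 x; have := S2 x; lia.
Qed.

Lemma FP_if (b : A -> bool) (f g : A -> B) : FP b -> FP f -> FP g -> FP (fun x => if b x then f x else g x).
Proof.
move=> [c0 [d0 [X0 S0]]] [c1 [d1 [X1 S1]]] [c2 [d2 [X2 S2]]].
pose p n := n.+2 ^ d0 + n.+2 ^ d1 + n.+2 ^ d2 + 12.
have Hp : polyb p by rewrite /p; polyb.
apply: (FP_intro (computes_if X0 X1 X2) Hp) => x; rewrite /p //.
by have := S1 x; have := S2 x; case: (b x); lia.
Qed.

(** Polynomial steps do not make a polynomial fold, as repeated doubling shows; the accumulator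
    after every prefix has to obey one polynomial bound in the input. *)
Lemma FP_foldl (f : A -> B -> C -> B) (b0 : A -> B) (l : A -> seq C) :
  FP (fun x : A * (B * C) => f x.1 x.2.1 x.2.2) -> FP b0 -> FP l ->
  (exists2 p, polyb p & forall x l1 l2, l x = l1 ++ l2 -> sz (foldl (f x) (b0 x) l1) <= p (sz x)) ->
  FP (fun x => foldl (f x) (b0 x) (l x)).
Proof.
move=> [cf [df [Xf Sf]]] [c1 [d1 [X1 S1]]] [c2 [d2 [X2 S2]]] [p Hp Sp].
pose q n := (n + p n + n.+2 ^ d2).+4 ^ df + 50.
pose r n := n.+2 ^ d1 + n.+2 ^ d2 + 200 + n.+2 ^ d2 * q n + p n.
have Hr : polyb r by rewrite /r /q; polyb.
have Xp := computes_pair (@computes_id A) (computes_pair X1 X2).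
have X := computes_comp Xp (computes_fold Xf).
apply: (FP_intro X Hr) => x; rewrite /r; last first.
  by have := Sp x (l x) [::]; rewrite cats0 => /(_ erefl) /=; lia.
rewrite /=; set t := fold_time _ _ _ _ _.
suff : t <= (sz x).+2 ^ d2 * q (sz x).
  by move: ((sz x).+2 ^ d2 * q (sz x)) ((sz x).+2 ^ d1) ((sz x).+2 ^ d2) => u v w; lia.
rewrite {}/t; set T := fun y : A * (B * C) => (sz y).+2 ^ df.
suff H : forall l1 l2, l x = l1 ++ l2 ->
    fold_time f T x (foldl (f x) (b0 x) l1) l2 <= size l2 * q (sz x).
  apply: leq_trans (H [::] (l x) erefl) _; rewrite leq_mul2r; apply/orP; right.
  by have := S2 x; have := size_sz (l x); lia.
move=> l1 l2; elim: l2 l1 => [|h l2 IH] l1 E //=.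
have := IH (rcons l1 h); rewrite cat_rcons foldl_rcons => /(_ E) => H.
have /= Sacc := Sp x _ _ E.
have Sh : sz h <= (sz x).+2 ^ d2.
  apply: leq_trans (S2 x); rewrite E; have := sz_cat l1 (h :: l2); rewrite sz_cons.
  by have := sz_gt0 l1; have := sz_gt0 l2; lia.
rewrite mulSn; apply: leq_add H; rewrite /q leq_add2r /T.
case: (df) => // e; rewrite leq_exp2r // !sz_pair /=; lia.
Qed.

End FPlemmas.

Lemma FP_snd (A B C : encType) (f : A -> B * C) :
  FP f -> FP (fun x => (f x).2).
Proof.
apply: (FP_comp (g := fun y : B * C => y.2)).
apply: (FP_intro (@computes_snd B C) (polyb_S (polyb_S polyb_id))) => x //.
by rewrite sz_pair; lia.
Qed.

Lemma FP_fst (A B C : encType) (f : A -> B * C) :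
  FP f -> FP (fun x => (f x).1).
Proof.
apply: (FP_comp (g := fun y : B * C => y.1)).
apply: (FP_intro (@computes_fst B C) (polyb_S polyb_id)) => x //.
by rewrite sz_pair; lia.
Qed.

Lemma FP_sz (A B : encType) (f : A -> B) : FP f ->
  exists p, [/\ polyb p, {homo p : m n / m <= n} & forall x, sz (f x) <= p (sz x)].
Proof.
move=> [c [d [_ S]]]; exists (fun n => n.+2 ^ d); split=> //; first exact: polyb_pow.
by move=> m n H; case: d {S} => // d; rewrite leq_exp2r.
Qed.

Lemma sz_mem (A : encType) (h : A) l1 l2 : sz h <= sz (l1 ++ h :: l2).
Proof. by elim: l1 => [|x l IH]; rewrite ?cat_cons sz_cons; lia. Qed.

Lemma sz_catrev (A : encType) (l1 l2 : seq A) : (sz (catrev l1 l2)).+1 = sz l1 + sz l2.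
Proof. by rewrite catrevE sz_cat sz_rev. Qed.

(** * Arithmetic and Boolean functions in polynomial time *)

Section Basic.
Variable A : encType.
Implicit Types f g : A -> nat.
Implicit Types b c : A -> bool.

Lemma FP_add f g : FP f -> FP g -> FP (fun x => f x + g x).
Proof.
move=> Hf Hg; apply: (FP_comp (g := fun y : nat * nat => y.1 + y.2) (f := fun x => (f x, g x))); last exact: FP_pair.
exact: (FP_intro computes_add (polyb_const 4)).
Qed.

Lemma FP_sub f g : FP f -> FP g -> FP (fun x => f x - g x).
Proof.
move=> Hf Hg; apply: (FP_comp (g := fun y : nat * nat => y.1 - y.2) (f := fun x => (f x, g x))); last exact: FP_pair.
exact: (FP_intro computes_sub (polyb_const 4)).
Qed.

Lemma FP_S f : FP f -> FP (fun x => (f x).+1).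
Proof.
by move=> Hf; apply: FP_ext (FP_add Hf (FP_const _ 1)) _ => x; rewrite addn1.
Qed.

Lemma FP_eq0 f : FP f -> FP (fun x => f x == 0).
Proof.
apply: (FP_comp (g := fun y : nat => y == 0)).
exact: (FP_intro computes_eq0 (polyb_const 3)).
Qed.

Lemma FP_leq f g : FP f -> FP g -> FP (fun x => f x <= g x).
Proof. by move=> Hf Hg; apply: FP_eq0; apply: FP_sub. Qed.

Lemma FP_negb b : FP b -> FP (fun x => ~~ b x).
Proof. by move=> H; apply: FP_ext (FP_if H (FP_bool _ false) (FP_bool _ true)) _ => x; case: (b x). Qed.

Lemma FP_andb b c : FP b -> FP c -> FP (fun x => b x && c x).
Proof. by move=> H K; apply: FP_ext (FP_if H K (FP_bool _ false)) _ => x; case: (b x). Qed.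

Lemma FP_orb b c : FP b -> FP c -> FP (fun x => b x || c x).
Proof. by move=> H K; apply: FP_ext (FP_if H (FP_bool _ true) K) _ => x; case: (b x). Qed.

Lemma FP_implb b c : FP b -> FP c -> FP (fun x => b x ==> c x).
Proof. by move=> H K; apply: FP_ext (FP_if H K (FP_bool _ true)) _ => x; case: (b x). Qed.

Lemma FP_eqn f g : FP f -> FP g -> FP (fun x => f x == g x).
Proof.
move=> Hf Hg; apply: FP_ext (FP_andb (FP_leq Hf Hg) (FP_leq Hg Hf)) _ => x.
by rewrite -eqn_leq.
Qed.

End Basic.

(** * List functions in polynomial time *)

Section Lists.
Variables X B C : encType.

Lemma FP_cons (f : X -> B) (l : X -> seq B) : FP f -> FP l -> FP (fun x => f x :: l x).
Proof.
move=> Hf Hl; apply: (FP_comp (g := fun y : B * seq B => y.1 :: y.2) (f := fun x => (f x, l x))); last exact: FP_pair.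
exact: (FP_intro (computes_cons B) polyb_id).
Qed.

Lemma FP_foldl_flat (b : nat) (f : X -> B -> C -> B) (b0 : X -> B) (l : X -> seq C) :
  (forall y : B, sz y <= b) ->
  FP (fun x : X * (B * C) => f x.1 x.2.1 x.2.2) -> FP b0 -> FP l -> FP (fun x => foldl (f x) (b0 x) (l x)).
Proof.
move=> Hb Hf H0 Hl; apply: FP_foldl => //.
by exists (fun _ => b); [exact: polyb_const | move=> *; exact: Hb].
Qed.

End Lists.

Lemma FP_catrev (X B : encType) (l1 l2 : X -> seq B) : FP l1 -> FP l2 -> FP (fun x => catrev (l1 x) (l2 x)).
Proof.
move=> H1 H2.
have E (a b : seq B) : foldl (fun acc h => h :: acc) b a = catrev a b by elim: a b => //=.
apply: FP_ext (_ : FP (fun x => foldl (fun acc h => h :: acc) (l2 x) (l1 x))) _ => //.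
apply: FP_foldl => //.
  by apply: FP_cons; [apply: FP_snd; apply: FP_snd; exact: FP_id | apply: FP_fst; apply: FP_snd; exact: FP_id].
have [p [Hp _ Lp]] := FP_sz H1; have [q [Hq _ Lq]] := FP_sz H2.
exists (fun n => p n + q n); first exact: polyb_add.
move=> x a b E'; rewrite E; have := sz_catrev a (l2 x); have := sz_cat a b; rewrite -E'.
by have := Lp x; have := Lq x; have := sz_gt0 b; lia.
Qed.

Lemma FP_rev (X B : encType) (l : X -> seq B) : FP l -> FP (fun x => rev (l x)).
Proof. by move=> H; apply: FP_catrev => //; apply: FP_nil. Qed.

Lemma FP_cat (X B : encType) (l1 l2 : X -> seq B) : FP l1 -> FP l2 -> FP (fun x => l1 x ++ l2 x).
Proof.
move=> H1 H2; apply: FP_ext (FP_catrev (FP_rev H1) H2) _ => x.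
by rewrite catrevE revK.
Qed.

Lemma FP_proj1 (X Y : encType) : FP (fun x : X * Y => x.1).
Proof. by apply: FP_fst; apply: FP_id. Qed.

Lemma FP_proj2 (X Y : encType) : FP (fun x : X * Y => x.2).
Proof. by apply: FP_snd; apply: FP_id. Qed.

Lemma FP_lift1 (X Y Z : encType) (f : X -> Z) : FP f -> FP (fun x : X * Y => f x.1).
Proof. by move=> H; apply: (FP_comp (g := f)) => //; apply: FP_proj1. Qed.

Lemma FP_flatmap (X B C : encType) (g : X -> C -> seq B) (l : X -> seq C) :
  FP (fun x : X * C => g x.1 x.2) -> FP l -> FP (fun x => flatten [seq g x y | y <- l x]).
Proof.
move=> Hg Hl.
have E x (a : seq C) b : foldl (fun acc h => catrev (g x h) acc) b a = catrev (flatten [seq g x y | y <- a]) b.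
  by elim: a b => //= h a IH b; rewrite IH !catrevE rev_cat catA.
apply: FP_ext (_ : FP (fun x => rev (foldl (fun acc h => catrev (g x h) acc) [::] (l x)))) _; last first.
  by move=> x; rewrite E catrevE cats0 revK.
apply: FP_rev; apply: FP_foldl => //; [| exact: FP_nil |].
  apply: FP_catrev; last by apply: FP_fst; apply: FP_snd; exact: FP_id.
  apply: (FP_comp (g := fun y : X * C => g y.1 y.2) (f := fun z : X * (seq B * C) => (z.1, z.2.2))) => //.
  by apply: FP_pair; [exact: FP_proj1 | apply: FP_snd; exact: FP_proj2].
have [p [Hp Mp Lp]] := FP_sz Hg; have [q [Hq Mq Lq]] := FP_sz Hl.
exists (fun n => q n * p (n + q n).+1 + 1).
  apply: polyb_add (polyb_const 1); apply: polyb_mul => //; apply: polyb_comp => //.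
  by apply: polyb_S; apply: polyb_add => //; exact: polyb_id.
move=> x a b E'; rewrite E catrevE cats0 sz_rev.
suff: sz (flatten [seq g x y | y <- a]) <= size a * p (sz x + q (sz x)).+1 + 1.
  move/leq_trans; apply; rewrite leq_add2r leq_mul2r; apply/orP; right.
  by have := Lq x; have := size_sz (l x); rewrite E' size_cat; lia.
have : forall h a1 a2, a = a1 ++ h :: a2 -> sz (g x h) <= p (sz x + q (sz x)).+1.
  move=> h a1 a2 Ea; apply: leq_trans (Lp (x, h)) _; apply: Mp.
  rewrite sz_pair ltnS leq_add2l; apply: leq_trans (Lq x).
  by rewrite E' Ea -catA; apply: sz_mem.
elim: a {E'} => [//|h a IH] H /=.
have {}IH := IH (fun k a1 a2 e => H k (h :: a1) a2 (congr1 (cons h) e)).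
have := H h [::] a erefl; have := sz_cat (g x h) (flatten [seq g x y | y <- a]).
by rewrite mulSn; lia.
Qed.

Lemma FP_map (X B C : encType) (g : X -> C -> B) (l : X -> seq C) :
  FP (fun x : X * C => g x.1 x.2) -> FP l -> FP (fun x => [seq g x y | y <- l x]).
Proof.
move=> Hg Hl; apply: FP_ext (_ : FP (fun x => flatten [seq [:: g x y] | y <- l x])) _.
  by apply: FP_flatmap => //; apply: FP_cons => //; apply: FP_nil.
by move=> x; elim: (l x) => //= y s ->.
Qed.

Lemma FP_flatten (X B : encType) (l : X -> seq (seq B)) : FP l -> FP (fun x => flatten (l x)).
Proof.
move=> Hl; apply: FP_ext (_ : FP (fun x => flatten [seq y | y <- l x])) _.
  by apply: FP_flatmap => //; apply: FP_proj2.
by move=> x; rewrite map_id.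
Qed.

Lemma FP_filter (X C : encType) (p : X -> C -> bool) (l : X -> seq C) :
  FP (fun x : X * C => p x.1 x.2) -> FP l -> FP (fun x => [seq y <- l x | p x y]).
Proof.
move=> Hp Hl; apply: FP_ext (_ : FP (fun x => flatten [seq if p x y then [:: y] else [::] | y <- l x])) _.
  apply: FP_flatmap => //; apply: FP_if => //; last exact: FP_nil.
  by apply: FP_cons; [apply: FP_proj2 | apply: FP_nil].
by move=> x; elim: (l x) => //= y s ->; case: (p x y).
Qed.

Lemma FP_has (X C : encType) (p : X -> C -> bool) (l : X -> seq C) :
  FP (fun x : X * C => p x.1 x.2) -> FP l -> FP (fun x => has (p x) (l x)).
Proof.
move=> Hp Hl; apply: FP_ext (_ : FP (fun x => foldl (fun b h => b || p x h) false (l x))) _; last first.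
  have E x b s : foldl (fun b h => b || p x h) b s = b || has (p x) s.
    by elim: s b => [|h s IH] b /=; rewrite ?orbF // IH orbA.
  by move=> x; rewrite E.
apply: (@FP_foldl_flat _ _ _ 1) => //; last exact: FP_bool.
apply: FP_orb; first by apply: FP_fst; apply: FP_proj2.
apply: (FP_comp (g := fun y : X * C => p y.1 y.2) (f := fun z : X * (bool * C) => (z.1, z.2.2))) => //.
by apply: FP_pair; [exact: FP_proj1 | apply: FP_snd; exact: FP_proj2].
Qed.

Lemma FP_all (X C : encType) (p : X -> C -> bool) (l : X -> seq C) :
  FP (fun x : X * C => p x.1 x.2) -> FP l -> FP (fun x => all (p x) (l x)).
Proof.
move=> Hp Hl; apply: FP_ext (_ : FP (fun x => ~~ has (fun y => ~~ p x y) (l x))) _.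
  by apply: FP_negb; apply: FP_has => //; apply: FP_negb.
by move=> x; rewrite -all_predC; apply: eq_all => y /=; rewrite negbK.
Qed.

Lemma FP_size (X C : encType) (l : X -> seq C) : FP l -> FP (fun x => size (l x)).
Proof.
move=> Hl; apply: FP_ext (_ : FP (fun x => foldl (fun n _ => n.+1) 0 (l x))) _; last first.
  have E n (s : seq C) : foldl (fun n _ => n.+1) n s = n + size s.
    by elim: s n => [|h s IH] n /=; rewrite ?addn0 // IH addnS.
  by move=> x; rewrite E.
apply: (@FP_foldl_flat _ _ _ 1) => //; last exact: FP_const.
by apply: FP_S; apply: FP_fst; apply: FP_proj2.
Qed.

Lemma FP_count (X C : encType) (p : X -> C -> bool) (l : X -> seq C) :
  FP (fun x : X * C => p x.1 x.2) -> FP l -> FP (fun x => count (p x) (l x)).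
Proof.
move=> Hp Hl; apply: FP_ext (_ : FP (fun x => size [seq y <- l x | p x y])) _.
  by apply: FP_size; apply: FP_filter.
by move=> x; rewrite size_filter.
Qed.

Lemma FP_mem (X : encType) (y : X -> nat) (l : X -> seq nat) : FP y -> FP l -> FP (fun x => y x \in l x).
Proof.
move=> Hy Hl; apply: FP_ext (_ : FP (fun x => has (fun z => z == y x) (l x))) _.
  by apply: FP_has => //; apply: FP_eqn; [exact: FP_proj2 | apply: FP_lift1].
by move=> x; rewrite has_pred1.
Qed.

Lemma FP_foldr (X B C : encType) (f : X -> C -> B -> B) (b0 : X -> B) (l : X -> seq C) :
  FP (fun x : X * (B * C) => f x.1 x.2.2 x.2.1) -> FP b0 -> FP l ->
  (exists2 p, polyb p & forall x l1 l2, l x = l1 ++ l2 -> sz (foldr (f x) (b0 x) l2) <= p (sz x)) ->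
  FP (fun x => foldr (f x) (b0 x) (l x)).
Proof.
move=> Hf H0 Hl [p Hp Lp].
apply: FP_ext (_ : FP (fun x => foldl (fun z y => f x y z) (b0 x) (rev (l x)))) _; last first.
  by move=> x; rewrite foldl_rev.
apply: FP_foldl => //; first exact: FP_rev.
exists p => // x l1 l2 E; rewrite -[l1]revK foldl_rev; apply: (Lp _ (rev l2)).
by rewrite -[l x]revK E rev_cat.
Qed.

(** A range up to the value of a number is not polynomial, because that number has size one. Ranges
    therefore end at the length of a list. *)
Lemma FP_iota (X C : encType) (l : X -> seq C) : FP l -> FP (fun x => iota 0 (size (l x))).
Proof.
move=> Hl; apply: FP_ext (_ : FP (fun x => foldl (fun s _ => s ++ [:: size s]) [::] (l x))) _; last first.
  have E n (s : seq C) : foldl (fun s _ => s ++ [:: size s]) (iota 0 n) s = iota 0 (n + size s).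
    elim: s n => [|h s IH] n /=; rewrite ?addn0 // size_iota -[[:: n]]/(iota (0 + n) 1) -iotaD IH.
    by rewrite addn1 addSnnS.
  by move=> x; exact: (E 0).
apply: FP_foldl => //; [| exact: FP_nil |].
  apply: FP_cat; first by apply: FP_fst; apply: FP_proj2.
  by apply: FP_cons; [apply: FP_size; apply: FP_fst; apply: FP_proj2 | apply: FP_nil].
have [q [Hq Mq Lq]] := FP_sz Hl.
exists (fun n => q n + q n + 1).
  by apply: polyb_add (polyb_const 1); apply: polyb_add.
move=> x a b E; rewrite sz_natseq.
have E2 (c : seq C) s : size (foldl (fun s _ => s ++ [:: size s]) s c) = size s + size c.
  by elim: c s => [|h c IH] s /=; rewrite ?addn0 // IH size_cat /= addn1 addSnnS.
rewrite E2 add0n.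
by have := Lq x; have := size_sz (l x); rewrite E size_cat; lia.
Qed.

Lemma FP_zipn (X C : encType) (l : X -> seq C) : FP l -> FP (fun x => zip (iota 0 (size (l x))) (l x)).
Proof.
move=> Hl.
pose step (s : seq (nat * C)) h := s ++ [:: (size s, h)].
have E n (s : seq C) s0 : size s0 = n -> foldl step s0 s = s0 ++ zip (iota n (size s)) s.
  elim: s n s0 => [|h s IH] n s0 Hs /=; first by rewrite cats0.
  by rewrite (IH n.+1) /step ?Hs -?catA // size_cat addn1 Hs.
apply: FP_ext (_ : FP (fun x => foldl step [::] (l x))) _; last by move=> x; rewrite (E 0).
apply: FP_foldl => //; [| exact: FP_nil |].
  apply: FP_cat; first by apply: FP_fst; apply: FP_proj2.
  apply: FP_cons; last exact: FP_nil.
  apply: FP_pair; last by apply: FP_snd; apply: FP_proj2.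
  by apply: FP_size; apply: FP_fst; apply: FP_proj2.
have [q [Hq Mq Lq]] := FP_sz Hl.
exists (fun n => q n + q n + q n + 1).
  by apply: polyb_add (polyb_const 1); apply: polyb_add => //; apply: polyb_add.
move=> x a b E'; rewrite (E 0) //=.
have : sz (zip (iota 0 (size a)) a) <= sz a + (size a).*2.
  elim: a 0 {E'} => [//|h a IH] n /=; rewrite !sz_cons sz_pair sz_nat /=.
  by have := IH n.+1; lia.
have := sz_cat a b; rewrite -E'; have := sz_gt0 b.
have : size a <= size (l x) by rewrite E' size_cat leq_addr.
by have := Lq x; have := size_sz (l x); lia.
Qed.

Lemma FP_take (X C : encType) (n : X -> nat) (l : X -> seq C) : FP n -> FP l -> FP (fun x => take (n x) (l x)).
Proof.
move=> Hn Hl.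
apply: FP_ext (_ : FP (fun x => [seq y.2 | y <- [seq y <- zip (iota 0 (size (l x))) (l x) | y.1 < n x]])) _.
  apply: FP_map; first by apply: FP_snd; apply: FP_proj2.
  apply: FP_filter; last exact: FP_zipn.
  by apply: FP_leq; [apply: FP_S; apply: FP_fst; apply: FP_proj2 | apply: FP_lift1].
have E0 (s : seq C) j i : i <= j -> [seq y <- zip (iota j (size s)) s | y.1 < i] = [::].
  elim: s j => [//|h s IH] j /= Hi; rewrite ltnNge Hi /=; apply: IH; exact: leqW.
have E : forall (s : seq C) j k, [seq y.2 | y <- zip (iota j (size s)) s & y.1 < j + k] = take k s.
  elim=> [|h s IH] j [|k] //=; last by rewrite addnS ltnS leq_addr /= -addSn IH.
  by rewrite addn0 ltnn E0.
by move=> x; rewrite -(E (l x) 0).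
Qed.

Lemma FP_drop (X C : encType) (n : X -> nat) (l : X -> seq C) : FP n -> FP l -> FP (fun x => drop (n x) (l x)).
Proof.
move=> Hn Hl.
apply: FP_ext (_ : FP (fun x => [seq y.2 | y <- [seq y <- zip (iota 0 (size (l x))) (l x) | n x <= y.1]])) _.
  apply: FP_map; first by apply: FP_snd; apply: FP_proj2.
  apply: FP_filter; last exact: FP_zipn.
  by apply: FP_leq; [apply: FP_lift1 | apply: FP_fst; apply: FP_proj2].
have E0 (s : seq C) j i : i <= j -> [seq y.2 | y <- zip (iota j (size s)) s & i <= y.1] = s.
  by elim: s j => [//|h s IH] j /= Hi; rewrite Hi /= IH // leqW.
have E : forall (s : seq C) j k, [seq y.2 | y <- zip (iota j (size s)) s & j + k <= y.1] = drop k s.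
  elim=> [//|h s IH] j [|k]; first by rewrite addn0 drop0 E0.
  by rewrite /= leqNgt addnS ltnS leq_addr /= -addSn IH.
by move=> x; rewrite -(E (l x) 0).
Qed.

Lemma FP_head (X C : encType) (d : X -> C) (l : X -> seq C) : FP d -> FP l -> FP (fun x => head (d x) (l x)).
Proof.
move=> Hd Hl.
apply: FP_ext (_ : FP (fun x => foldr (fun h _ => h) (d x) (l x))) _; last by move=> x; case: (l x).
apply: FP_foldr => //; first by apply: FP_snd; apply: FP_proj2.
have [p [Hp _ Lp]] := FP_sz Hd; have [q [Hq _ Lq]] := FP_sz Hl.
exists (fun n => p n + q n); first exact: polyb_add.
move=> x l1 [|h l2] E /=; first by apply: leq_trans (Lp x) _; apply: leq_addr.
by apply: leq_trans (leq_trans (Lq x) _); [rewrite E sz_mem | apply: leq_addl].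
Qed.

Lemma FP_nth (X C : encType) (d : X -> C) (l : X -> seq C) (i : X -> nat) :
  FP d -> FP l -> FP i -> FP (fun x => nth (d x) (l x) (i x)).
Proof.
move=> Hd Hl Hi; apply: FP_ext (FP_head Hd (FP_drop Hi Hl)) _ => x.
by rewrite -nth0 nth_drop addn0.
Qed.

Lemma FP_mem2 (X : encType) (u v : X -> nat) (l : X -> seq (nat * nat)) :
  FP u -> FP v -> FP l -> FP (fun x => (u x, v x) \in l x).
Proof.
move=> Hu Hv Hl; apply: FP_ext (_ : FP (fun x => has (fun p => (p.1 == u x) && (p.2 == v x)) (l x))) _.
  apply: FP_has => //; apply: FP_andb; apply: FP_eqn; try exact: FP_lift1.
    by apply: FP_fst; apply: FP_proj2.
  by apply: FP_snd; apply: FP_proj2.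
by move=> x; elim: (l x) => //= -[a b] s ->; rewrite inE xpair_eqE (eq_sym a) (eq_sym b).
Qed.

Lemma FP_undup (X : encType) (l : X -> seq nat) : FP l -> FP (fun x => undup (l x)).
Proof.
move=> Hl.
have E s : foldr (fun h r => if h \in r then r else h :: r) [::] s = undup s.
  by elim: s => //= h s ->; rewrite mem_undup.
apply: FP_ext (_ : FP (fun x => foldr (fun h r => if h \in r then r else h :: r) [::] (l x))) _; last by move=> x; rewrite E.
apply: FP_foldr => //; [|exact: FP_nil|].
  apply: FP_if.
  - by apply: FP_mem; [apply: FP_snd | apply: FP_fst]; apply: FP_proj2.
  - by apply: FP_fst; apply: FP_proj2.
  - by apply: FP_cons; [apply: FP_snd | apply: FP_fst]; apply: FP_proj2.
have [q [Hq _ Lq]] := FP_sz Hl.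
exists q => // x l1 l2 E'; rewrite E; apply: leq_trans (Lq x).
rewrite !sz_natseq ltnS leq_double E' size_cat; apply: leq_trans (size_undup _) _; exact: leq_addl.
Qed.

Lemma FP_eqseq (X : encType) (l1 l2 : X -> seq nat) : FP l1 -> FP l2 -> FP (fun x => l1 x == l2 x).
Proof.
move=> H1 H2.
apply: FP_ext (_ : FP (fun x => (size (l1 x) == size (l2 x)) &&
    all (fun i => nth 0 (l1 x) i == nth 0 (l2 x) i) (iota 0 (size (l1 x))))) _.
  apply: FP_andb; first by apply: FP_eqn; apply: FP_size.
  apply: FP_all; last exact: FP_iota.
  by apply: FP_eqn; apply: FP_nth; try exact: FP_const; try exact: FP_lift1; apply: FP_proj2.
move=> x; apply/andP/eqP => [[/eqP Es /allP H]|->].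
  apply: (@eq_from_nth _ 0) => // i Hi; apply/eqP/H; by rewrite mem_iota.
by split=> //; apply/allP.
Qed.

Ltac fp_defs := fail.

Ltac fp1 :=
  first
  [ assumption
  | match goal with H : FP ?g |- FP (fun x => ?g (@?h x)) => apply: (FP_comp (g := g) (f := h) H) end
  | match goal with |- FP (fun x => x) => exact: FP_id | |- FP fst => exact: FP_proj1 | |- FP snd => exact: FP_proj2 end
  | match goal with |- FP (fun _ => ?n) => first [exact: FP_const | exact: FP_bool | exact: FP_nil] end
  | fp_defs
  | match goal with
    | |- FP (fun x => (_, _)) => apply: FP_pair
    | |- FP (fun x => fst _) => apply: FP_fst
    | |- FP (fun x => snd _) => apply: FP_snd
    | |- FP (fun x => _ :: _) => apply: FP_cons
    | |- FP (fun x => if _ then _ else _) => apply: FP_if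
    | |- FP (fun x => _ ++ _) => apply: FP_cat
    | |- FP (fun x => rev _) => apply: FP_rev
    | |- FP (fun x => flatten (map _ _)) => apply: FP_flatmap
    | |- FP (fun x => flatten _) => apply: FP_flatten
    | |- FP (fun x => map _ _) => apply: FP_map
    | |- FP (fun x => filter _ _) => apply: FP_filter
    | |- FP (fun x => has _ _) => apply: FP_has
    | |- FP (fun x => all _ _) => apply: FP_all
    | |- FP (fun x => count _ _) => apply: FP_count
    | |- FP (fun x => iota 0 (size _)) => apply: FP_iota
    | |- FP (fun x => size _) => apply: FP_size
    | |- FP (fun x => take _ _) => apply: FP_take
    | |- FP (fun x => drop _ _) => apply: FP_drop
    | |- FP (fun x => head _ _) => apply: FP_head
    | |- FP (fun x => nth _ _ _) => apply: FP_nth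
    | |- FP (fun x => undup _) => apply: FP_undup
    | |- FP (fun x => addn _ _) => apply: FP_add
    | |- FP (fun x => subn _ _) => apply: FP_sub
    | |- FP (fun x => leq _ _) => apply: FP_leq
    | |- FP (fun x => S _) => apply: FP_S
    | |- FP (fun x => negb _) => apply: FP_negb
    | |- FP (fun x => andb _ _) => apply: FP_andb
    | |- FP (fun x => orb _ _) => apply: FP_orb
    | |- FP (fun x => implb _ _) => apply: FP_implb
    | |- FP (fun x => _ == _) => first [apply: FP_eqn | apply: FP_eqseq]
    | |- FP (fun x => _ \in _) => first [apply: FP_mem | apply: FP_mem2]
    end
  | lazymatch goal with |- FP (fun _ => _) => fail | |- FP ?f => change (FP (fun x => f x)) end ];
  cbv beta.

Ltac fp := repeat fp1.

(** * Reading the input *)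

Definition exec_block (c : seq instr) (m : memory) : memory :=
  foldl (fun m i => (exec_instr i 0 m).2) m c.

Definition nojump (i : instr) : bool := if i is IJz _ _ then false else true.

Lemma run_block c P b m :
  all nojump c -> fits P b c -> msteps P (size c) (b, m) (b + size c, exec_block c m).
Proof.
elim: c b m => [|i c IH] b m; first by rewrite addn0 => _ _; apply: msteps0.
move=> /= /andP[Hi Hc] /fits_cons [F1 F2].
apply: (msteps_instr F1).
have -> : exec_instr i b m = (b.+1, (exec_instr i 0 m).2) by case: i Hi {F1}.
by rewrite addnS -addSn; apply: IH.
Qed.

Lemma exec_block_cat c1 c2 m : exec_block (c1 ++ c2) m = exec_block c2 (exec_block c1 m).
Proof. exact: foldl_cat. Qed.

Definition cBase := 12.
Definition cIdx := 13.
Definition cLim := 14.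
Definition cSrc := 15.
Ltac nlia := unfold cBase, cIdx, cLim, cSrc in *; mlia.

(* The input occupies the register cells: cells 1..15 are first moved to
   M..M+14 with M = 32 * length, a region beyond the input. *)
Definition move_code : seq instr :=
  nseq 5 (IAdd 0 0 0) ++ [:: IStore 0 1; IConst 1 1] ++
  flatten [seq [:: IAdd 0 0 1; IStore 0 j] | j <- iota 2 14].

(** The moves leave [M + 14] in cell 0, the address written last. Registers 0 and 1 start as the
    empty list and the empty stack. *)
Definition const_code : seq instr :=
  [:: IConst 2 14; ISub cBase 0 2; IConst cOne 1; IConst cZero 0; IConst 0 0; IConst 1 0;
      IConst cIdx 0; IConst cLim 32; IAdd cSrc cBase cZero].

(* Recovers the length by repeated subtraction of 32 from M. *)
Definition len_code (b : nat) : seq instr :=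
  [:: IJz cSrc (b + 4); ISub cSrc cSrc cLim; IAdd cIdx cIdx cOne; IJz cZero b].

Definition heap_code : seq instr := [:: IConst cLim 16; IAdd hp cBase cLim].

(** The word is read from its last entry backwards, so that consing builds it in order. A cell with
    index below 16 is read from its copy beyond [M], any other cell in place. *)
Definition read_code (b : nat) : seq instr :=
  [:: IJz cIdx (b + 16); ISub cSrc cLim cIdx; IJz cSrc (b + 6);
      IAdd cSrc cBase cIdx; ISub cSrc cSrc cOne; IJz cZero (b + 7);
      IAdd cSrc cIdx cZero; ILoad 2 cSrc] ++ mcode (MCons 0 2 0) ++
  [:: ISub cIdx cIdx cOne; IJz cZero b].

Definition load_code : seq instr :=
  move_code ++ const_code ++ len_code 44 ++ heap_code ++ read_code 50.

Section Loader.
Variable w : seq nat.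
Hypothesis w_gt0 : 0 < size w.
Local Notation len := (size w).
Local Notation M := (32 * size w).
Local Notation init := (init_state w).2.

Lemma move_spec : let m := exec_block move_code init in
  [/\ m 0 = M + 14, forall i, i < 15 -> m (M + i) = nth 0 w i
    & forall x, 16 <= x < M -> m x = nth 0 w x.-1].
Proof.
have Step j m : 0 < j -> j < 15 -> m 0 = M + j.-1 -> m 1 = 1 ->
    (forall i, i < j -> m (M + i) = nth 0 w i) ->
    (forall x, 1 < x < M -> m x = nth 0 w x.-1) ->
    let m' := exec_block [:: IAdd 0 0 1; IStore 0 j.+1] m in
    [/\ m' 0 = M + j, m' 1 = 1, forall i, i < j.+1 -> m' (M + i) = nth 0 w i
      & forall x, 1 < x < M -> m' x = nth 0 w x.-1].
  move=> Hj Hj2 H0 H1 Hs Hu /=; rewrite !updE eqxx /= H0 H1.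
  have -> : M + j.-1 + 1 = M + j by lia.
  split.
  - by rewrite neq_lt //; lia.
  - by rewrite neq_lt //; lia.
  - move=> i Hi; rewrite !updE; case: eqP => [E|E].
      have -> : i = j by lia.
      by apply: Hu; lia.
    by rewrite (_ : (_ == 0) = false); [apply: Hs; lia | lia].
  - move=> x Hx; rewrite !updE neq_lt; last by lia.
    by rewrite (_ : (_ == 0) = false); [apply: Hu | lia].
pose c0 := nseq 5 (IAdd 0 0 0) ++ [:: IStore 0 1; IConst 1 1].
pose m0 := exec_block c0 init.
pose d := exec_block (nseq 5 (IAdd 0 0 0)) init.
have d0 : d 0 = M by rewrite /d /= !updE /=; lia.
have dS x : 0 < x -> d x = nth 0 w x.-1 by case: x.
have m0E x : m0 x = if x == 1 then 1 else if x == M then d 1 else d x.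
  by rewrite /m0 /c0 exec_block_cat -/d -d0.
have S0 : [/\ m0 0 = M + 1.-1, m0 1 = 1, forall i, i < 1 -> m0 (M + i) = nth 0 w i
      & forall x, 1 < x < M -> m0 x = nth 0 w x.-1].
  split=> [||[|//] _|x Hx]; rewrite m0E //=.
  - by rewrite d0 addn0; case: eqP => //; lia.
  - by rewrite addn0 eqxx (_ : (M == 1) = false) ?dS //; lia.
  - have N1 : (x == 1) = false by lia.
    have N2 : (x == M) = false by lia.
    by rewrite N1 N2 dS; lia.
have Gen : forall n, n <= 14 -> forall m, m = exec_block (flatten [seq [:: IAdd 0 0 1; IStore 0 j] | j <- iota 2 n]) m0 ->
   [/\ m 0 = M + n, m 1 = 1, forall i, i < n.+1 -> m (M + i) = nth 0 w i
      & forall x, 1 < x < M -> m x = nth 0 w x.-1].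
  elim=> [|n IH] Hn m ->; first by case: S0.
  have [|H0 H1 H2 H3] := IH _ _ erefl; first by lia.
  rewrite -[n.+1]addn1 iotaD map_cat flatten_cat exec_block_cat.
  by have := Step n.+1 _ erefl _ H0 H1 H2 H3; rewrite addn1; apply; lia.
rewrite /move_code catA exec_block_cat -/c0 -/m0.
have [//|H0 H1 H2 H3] := Gen 14 _ _ erefl.
by split=> // x Hx; apply: H3; lia.
Qed.

Lemma len_loop P b n m : fits P b (len_code b) ->
  m cSrc = 32 * n -> m cLim = 32 -> m cOne = 1 -> m cZero = 0 ->
  exists m', [/\ msteps P (4 * n + 1) (b, m) (b + 4, m'), m' cIdx = m cIdx + n
    & forall x, x != cSrc -> x != cIdx -> m' x = m x].
Proof.
move=> F; elim: n m => [|n IH] m Hs Hl H1 H0.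
  exists m; split=> //; last by rewrite addn0.
  move: F => /fits_cons [F _]; apply: (msteps_instr F) => /=; rewrite Hs /=; exact: msteps0.
pose m1 := upd m cSrc (m cSrc - m cLim).
pose m2 := upd m1 cIdx (m1 cIdx + m1 cOne).
have [||||m' [X E Fr]] := IH m2.
- by rewrite /m2 /m1 !updE /= Hs Hl; lia.
- by rewrite /m2 /m1 !updE.
- by rewrite /m2 /m1 !updE.
- by rewrite /m2 /m1 !updE.
exists m'; split.
- move: (F) => /fits_cons [F1 /fits_cons [F2 /fits_cons [F3 F4]]].
  have -> : 4 * n.+1 + 1 = (4 * n + 1).+4 by lia.
  apply: (msteps_instr F1) => /=; rewrite Hs /=.
  apply: (msteps_instr F2) => /=; apply: (msteps_instr F3) => /=; apply: (msteps_instr F4) => /=.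
  by rewrite -/m1 -/m2 /m2 /m1 !updE /= H0.
- by rewrite E /m2 /m1 !updE /= H1; lia.
- by move=> x N1 N2; rewrite Fr // /m2 /m1 !updE (negbTE N1) (negbTE N2).
Qed.

Lemma abs_hi m s d v : abs m s -> cTmp < d < heap0 -> abs (upd m d v) s.
Proof.
move=> [H1 H2 H3 H4] Hd.
have N r : r <= cTmp -> (r == d) = false by move=> H; rewrite neq_lt //; lia.
split; rewrite ?updE ?N // => r Hr; rewrite updE N; last by mlia.
apply: rep_ext (H4 r Hr) => [a Ha|]; last by rewrite updE N.
by rewrite updE neq_gt //; lia.
Qed.

Lemma read_loop P b n m s : fits P b (read_code b) -> n <= len ->
  abs m s -> s 0 = enc (drop n w) ->
  m cBase = M -> m cIdx = n -> m cLim = 16 -> M + 16 <= m hp ->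
  (forall i, i < 15 -> m (M + i) = nth 0 w i) -> (forall x, 16 <= x < M -> m x = nth 0 w x.-1) ->
  exists t m' s', [/\ t <= 17 * n + 1, msteps P t (b, m) (b + 16, m'), abs m' s' & s' 0 = enc w].
Proof.
move=> F; elim: n m s => [|n IH] m s Hn A E Hb Hi Hl Hh D1 D2.
  exists 1, m, s; split=> //; last by rewrite E drop0.
  move: F => /fits_cons [F _]; apply: (msteps_instr F) => /=; rewrite Hi /=; exact: msteps0.
pose src := if n.+1 < 16 then M + n else n.+1.
have Dn : m src = nth 0 w n.
  rewrite /src; case: ltnP => H; first by apply: D1.
  by apply: D2; lia.
have srcH : 16 <= src < M + 16 by rewrite /src; case: (ltnP n.+1 16) => H; lia.
have Hz : m cZero = 0 by case: A.
have Ho : m cOne = 1 by case: A.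
have [t1 [m1 [L1 X1 A1 E1 Fr1]]] : exists t m1, [/\ t <= 8, msteps P t (b, m) (b + 7, m1), abs m1 s,
    m1 cSrc = src & forall x, x != cSrc -> m1 x = m x].
  move: (F) => /fits_cons [F1 /fits_cons [F2 /fits_cons [F3 /fits_cons [F4 /fits_cons [F5 /fits_cons [F6 /fits_cons [F7 _]]]]]]].
  pose ma := upd m cSrc (m cLim - m cIdx).
  have Aa : abs ma s by apply: abs_hi.
  case: (ltnP n.+1 16) => H.
  - pose mb := upd ma cSrc (ma cBase + ma cIdx).
    pose mc := upd mb cSrc (mb cSrc - mb cOne).
    exists 6, mc; split=> //.
    + apply: (msteps_instr F1) => /=; rewrite Hi /=.
      apply: (msteps_instr F2) => /=; apply: (msteps_instr F3) => /=.
      rewrite -/ma (_ : (ma cSrc == 0) = false); last by rewrite /ma updE eqxx Hl Hi; lia.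
      apply: (msteps_instr F4) => /=; apply: (msteps_instr F5) => /=.
      apply: (msteps_instr F6) => /=; rewrite -/ma -/mb -/mc.
      rewrite {1}/mc {1}/mb {1}/ma !updE /= Hz /=; exact: msteps0.
    + by do 2! apply: abs_hi => //.
    + by rewrite /mc /mb /ma !updE /= Hb Hi Ho /src H; lia.
    + by move=> x /negbTE N; rewrite /mc /mb /ma !updE N.
  - pose mb := upd ma cSrc (ma cIdx + ma cZero).
    exists 4, mb; split=> //.
    + apply: (msteps_instr F1) => /=; rewrite Hi /=.
      apply: (msteps_instr F2) => /=; apply: (msteps_instr F3) => /=.
      rewrite -/ma (_ : (ma cSrc == 0) = true); last by rewrite /ma updE eqxx Hl Hi; lia.
      apply: (msteps_instr (i := IAdd cSrc cIdx cZero)); first by rewrite (_ : b + 6 = b.+4.+2) //; lia.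
      rewrite /= -/mb (_ : (b + 6).+1 = b + 7); [exact: msteps0 | lia].
    + by apply: abs_hi.
    + by rewrite /mb /ma !updE /= Hi Hz addn0 /src ltnNge H.
    + by move=> x /negbTE N; rewrite /mb /ma !updE N.
have [_ [Fl [Fc Ft]]] : True /\ fits P (b + 7) [:: ILoad 2 cSrc] /\ fits P (b + 8) (mcode (MCons 0 2 0))
   /\ fits P (b + 14) [:: ISub cIdx cIdx cOne; IJz cZero b].
  move: (F) => /fits_cons [_ /fits_cons [_ /fits_cons [_ /fits_cons [_ /fits_cons [_ /fits_cons [_ /fits_cons [_ F7]]]]]]].
  have {}F7 : fits P (b + 7) (ILoad 2 cSrc :: mcode (MCons 0 2 0) ++ [:: ISub cIdx cIdx cOne; IJz cZero b]).
    by rewrite (_ : b + 7 = b.+4.+3) //; lia.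
  have [F8 /fits_cat [F9 F10]] := fits_cons F7.
  have E8 : b + 8 = (b + 7).+1 by lia.
  have E14 : b + 14 = (b + 7).+1 + 6 by lia.
  by rewrite E8 E14; split; [exact: I | split; [exact: F8 | split; [exact: F9 | exact: F10]]].
have Hne : src != cSrc by nlia.
clearbody src.
pose m2 := upd m1 2 (m1 (m1 cSrc)).
have Am2 : abs m2 (supd s 2 (Num (nth 0 w n))).
  by apply: abs_upd => //=; rewrite E1 Fr1.
have [m3 [X3 A3 H3 Fr3]] := @abs_cons _ _ 2 0 0 Am2 isT isT isT.
have Hhp : m2 hp = m hp by rewrite /m2 updE /= Fr1.
have Fr x : 12 <= x < M + 16 -> x != cSrc -> m3 x = m x.
  move=> Hx N; rewrite Fr3 ?inE ?Hhp; last by nlia.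
  by rewrite /m2 updE neq_gt ?Fr1 //; lia.
set s3 := supd _ 0 _ in A3.
have E3 : s3 0 = enc (drop n w) by rewrite (drop_nth 0) // /s3 /supd /= E.
pose m4 := upd m3 cIdx (m3 cIdx - m3 cOne).
have A4 : abs m4 s3 by apply: abs_hi.
have Ho3 : m3 cOne = 1 by case: A3.
have F4 x : 12 <= x < M + 16 -> x != cSrc -> x != cIdx -> m4 x = m x.
  by move=> Hx N1 N2; rewrite /m4 updE (negbTE N2) Fr.
have [|||||||t [m' [s' [L X A' E']]]] := IH m4 s3 _ A4 E3.
- by lia.
- by rewrite F4 //; nlia.
- by rewrite /m4 updE eqxx Fr // ?Hi ?Ho3; nlia.
- by rewrite F4 //; nlia.
- by rewrite /m4 updE /= H3 Hhp; lia.
- by move=> i Hi'; rewrite F4; nlia || apply: D1.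
- by move=> x Hx; rewrite F4; nlia || apply: D2.
exists (t1 + (1 + (6 + (2 + t)))), m', s'; split=> //; first by lia.
apply: msteps_trans X1 _; apply: (msteps_instr Fl) => /=; rewrite -/m2.
rewrite (_ : (b + 7).+1 = b + 8); last by lia.
apply: msteps_trans (X3 _ _ Fc) _.
rewrite (_ : b + 8 + 6 = b + 14); last by lia.
move: Ft => /fits_cons [Fa Fb].
apply: (msteps_instr Fa) => /=; apply: (msteps_instr Fb) => /=.
by rewrite -/m4 (_ : m4 cZero = 0) //; case: A4.
Qed.

End Loader.

Lemma fits_load P : fits P 0 load_code ->
  [/\ fits P 0 move_code, fits P 35 const_code, fits P 44 (len_code 44), fits P 48 heap_code
    & fits P 50 (read_code 50)].
Proof.
rewrite /load_code => /fits_cat [F1 /fits_cat [F2 /fits_cat [F3 /fits_cat [F4 F5]]]].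
split; [exact: F1 | exact: F2 | exact: F3 | exact: F4 | exact: F5].
Qed.

Lemma const_spec m w : m 0 = 32 * w + 14 -> let m2 := exec_block const_code m in
  [/\ m2 cSrc = 32 * w, m2 cBase = 32 * w, m2 cLim = 32 & m2 cOne = 1] /\
  [/\ m2 cZero = 0, m2 0 = 0, m2 cIdx = 0 & forall x, 16 <= x -> m2 x = m x].
Proof.
move=> H0; rewrite /exec_block /= !updE /= H0 addnK addn0; split; split; try reflexivity.
move=> x Hx.
have N y : y < 16 -> (x == y) = false by lia.
by rewrite !updE !N.
Qed.

Lemma heap_spec m : let m' := exec_block heap_code m in
  [/\ m' hp = m cBase + 16, m' cLim = 16 & forall x, x != cLim -> x != hp -> m' x = m x].
Proof.
split=> // x /negbTE N1 /negbTE N2.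
by rewrite /exec_block /= !updE N1 N2.
Qed.

Lemma load_spec w P : 0 < size w -> fits P 0 load_code ->
  exists t m s, [/\ t <= 21 * size w + 48, msteps P t (init_state w) (66, m), abs m s & s 0 = enc w].
Proof.
move=> Hw /fits_load [F1 F2 F3 F4 F5].
have [H0 D1 D2] := move_spec Hw.
have X1 : msteps P 35 (init_state w) (35, _) := run_block (init_state w).2 (isT : all nojump move_code) F1.
set m1 := exec_block move_code _ in H0 D1 D2 X1; clearbody m1.
have X2 : msteps P 9 (35, m1) (44, _) := run_block m1 (isT : all nojump const_code) F2.
have E2 := const_spec H0.
set m2 := exec_block const_code m1 in X2 E2; clearbody m2.
have {E2} [[Es Eb El Eo] [Ez E0 Ei Fr2]] := E2.
have [m3 [X3 Ei3 Fr3]] := @len_loop w Hw P 44 (size w) m2 F3 Es El Eo Ez.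
have X4 : msteps P 2 (48, m3) (50, _) := run_block m3 (isT : all nojump heap_code) F4.
have [Ehp El4 E4] := heap_spec m3.
set m4 := exec_block heap_code m3 in X4 Ehp El4 E4; clearbody m4.
rewrite Fr3 // Eb in Ehp.
have A4 : abs m4 (fun r => Num (m4 r)).
  split=> //.
  - by rewrite E4 // Fr3.
  - by rewrite E4 // Fr3.
  - by rewrite Ehp /heap0; lia.
have Big x : 16 <= x -> m4 x = m1 x.
  by move=> Hx; rewrite E4 ?Fr3 ?Fr2 //; nlia.
have [|||||||t [m5 [s [Lt X5 A5 E5]]]] := @read_loop w Hw P 50 (size w) m4 _ F5 (leqnn _) A4.
- by rewrite E4 // Fr3 // E0 drop_size.
- by rewrite E4 // Fr3.
- by rewrite E4 // Ei3 Ei.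
- exact: El4.
- by rewrite Ehp.
- by move=> i Hi; rewrite Big ?D1 //; lia.
- by move=> x Hx; rewrite Big ?D2 //; lia.
exists (35 + (9 + (4 * size w + 1 + (2 + t)))), m5, s; split=> //; first by lia.
apply: msteps_trans X1 _; apply: msteps_trans X2 _; apply: msteps_trans X3 _.
by apply: msteps_trans X4 _.
Qed.

Lemma program_of_code c (f : seq nat -> nat) t : computes c f t ->
  exists A : program, forall w, 0 < size w -> runs_within A w (21 * size w + 48 + t w) (f w).
Proof.
(* [load_code] has 66 instructions, so 66 is the address at which the generated code starts. *)
move=> [Ok X]; exists (load_code ++ cgen c 66) => w Hw.
set A := _ ++ _.
have [|t1 [m1 [s1 [L1 X1 A1 E1]]]] := @load_spec w A Hw.
  by exists [::], (cgen c 66).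
have [t2 [s2 [L2 X2 E2 _]]] := X w s1 E1.
have [|m2 [X3 A2]] := run_code Ok X2 (P := A) (b := 66) _ A1.
  by exists load_code, [::]; rewrite cats0.
exists (t1 + t2), (66 + clen c, m2); split; first exact: leq_add.
split; first exact: msteps_trans X1 X3.
split; first by rewrite /halted /A size_cat size_cgen.
by case: A2 => _ _ _ /(_ 0 isT); rewrite E2.
Qed.

(** * Tower-bounded functions and fixed-parameter time *)

Definition tow (c n : nat) : nat := iter c (fun x => 2 ^ x) n.

Lemma tow_homo c : {homo tow c : m n / m <= n}.
Proof. by elim: c => [//|c IH] m n /IH H /=; rewrite leq_pexp2l. Qed.

(** Moves an additive constant into the argument of a tower, as the composition of two tower bounds
    requires. *)
Lemma tow_add c n d : tow c n + d <= tow c (n + d).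
Proof.
elim: c => [//|c IH] /=; apply: leq_trans (_ : 2 ^ (tow c n + d) <= _); last by rewrite leq_pexp2l.
have := ltn_expl d (isT : 1 < 2); rewrite expnD; have : 0 < 2 ^ tow c n by rewrite expn_gt0.
move: (2 ^ tow c n) (2 ^ d) => a b; nia.
Qed.

Lemma tow_incr c d n : tow c n <= tow (c + d) n.
Proof. by rewrite addnC /tow iterD; elim: d => //= d IH; apply: leq_trans IH (ltnW (ltn_expl _ _)). Qed.

(** Towers of constant height are closed under sums, products, powers and composition. Since only
    the bounding tower has to be computable, the combinatorial bounds themselves are never
    computed. *)
Definition TB (f : nat -> nat) := exists c, forall k, f k <= tow c (k + c).

Lemma TB_le f g : TB g -> (forall k, f k <= g k) -> TB f.
Proof. by move=> [c H] L; exists c => k; apply: leq_trans (L k) (H k). Qed.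

Lemma TB_weaken f c : (forall k, f k <= tow c (k + c)) -> forall d k, f k <= tow (c + d) (k + (c + d)).
Proof.
move=> H d k; apply: leq_trans (H k) _; apply: leq_trans (tow_incr c d _) _.
by apply: tow_homo; rewrite addnA leq_addr.
Qed.

Lemma TB_exp2 f : TB f -> TB (fun k => 2 ^ f k).
Proof.
move=> [c H]; exists c.+1 => k /=; rewrite leq_pexp2l //; apply: leq_trans (H k) _.
by apply: tow_homo; rewrite leq_add2l.
Qed.

Lemma TB_max f g : TB f -> TB g -> TB (fun k => maxn (f k) (g k)).
Proof.
move=> [c H] [d L]; exists (c + d) => k; rewrite geq_max (TB_weaken H) /=.
by rewrite addnC (TB_weaken L).
Qed.

Lemma leq_double_exp n : n + n <= 2 ^ n.
Proof. by elim: n => // n IH; case: n IH => // n IH; rewrite expnS; lia. Qed.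

Lemma TB_add f g : TB f -> TB g -> TB (fun k => f k + g k).
Proof.
move=> Hf Hg; apply: TB_le (TB_exp2 (TB_max Hf Hg)) _ => k.
by apply: leq_trans (leq_double_exp _); rewrite leq_add ?leq_maxl ?leq_maxr.
Qed.

Lemma TB_mul f g : TB f -> TB g -> TB (fun k => f k * g k).
Proof.
move=> Hf Hg; apply: TB_le (TB_exp2 (TB_add Hf Hg)) _ => k.
by rewrite expnD leq_mul // ltnW // ltn_expl.
Qed.

Lemma TB_pow f g : TB f -> TB g -> TB (fun k => f k ^ g k).
Proof.
move=> Hf Hg; apply: TB_le (TB_exp2 (TB_mul Hf Hg)) _ => k.
rewrite expnM; case: (g k) => // n; rewrite leq_exp2r // ltnW // ltn_expl //.
Qed.

Lemma TB_id : TB id.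
Proof. by exists 0 => k; rewrite addn0. Qed.

Lemma TB_const n : TB (fun _ => n).
Proof. by exists n => k; apply: leq_trans (tow_incr 0 n _); rewrite leq_addl. Qed.

Lemma TB_comp f g : TB f -> TB g -> TB (fun k => f (g k)).
Proof.
move=> [c H] [d L]; exists (c + d) => k.
apply: leq_trans (H _) _; have -> n : tow (c + d) n = tow c (tow d n) by rewrite /tow iterD.
apply: tow_homo; apply: leq_trans (_ : tow d (k + d) + c <= _); first by rewrite leq_add2r.
by apply: leq_trans (tow_add _ _ _) _; apply: tow_homo; lia.
Qed.

Lemma TB_S f : TB f -> TB (fun k => (f k).+1).
Proof. by move=> H; apply: TB_le (TB_add H (TB_const 1)) _ => k; rewrite addn1. Qed.

Lemma computes_tow c (A : encType) code (f : A -> nat) t : computes code f t ->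
  exists code' t', computes code' (fun x => tow c (f x)) t'.
Proof.
move=> H; elim: c => [|c [code' [t' IH]]]; first by exists code, t.
by eexists; eexists; exact: (computes_comp IH computes_pow2).
Qed.

Lemma computable_tow c : computable (fun k => tow c (k + c)).
Proof.
have [code [d [H _]]] : FP (fun w : seq nat => head 0 w + c) by fp.
have [code' [t' H']] := computes_tow c H.
have [A X] := program_of_code H'.
by exists A => x; eexists; apply: (X [:: x]).
Qed.

(** * Functions computable in fixed-parameter time *)

Definition FPT (A B : encType) (kappa : A -> nat) (f : A -> B) : Prop :=
  exists c F d, [/\ TB F, computes c f (fun x => F (kappa x) * (sz x).+2 ^ d)
    & forall x, sz (f x) <= F (kappa x) * (sz x).+2 ^ d].

Section FixedParameter.
Variables (A : encType) (kappa : A -> nat).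

Lemma FPT_intro (B : encType) c (f : A -> B) t F p : computes c f t -> TB F -> polyb p ->
  (forall x, t x <= F (kappa x) * p (sz x)) -> (forall x, sz (f x) <= F (kappa x) * p (sz x)) -> FPT kappa f.
Proof.
move=> X HF [d Hp] Ht Hs; exists c, F, d; split=> //.
  apply: computes_weaken X _ _ => // x; apply: leq_trans (Ht x) _.
  by rewrite leq_mul2l Hp orbT.
by move=> x; apply: leq_trans (Hs x) _; rewrite leq_mul2l Hp orbT.
Qed.

Lemma FPT_FP (B : encType) (f : A -> B) : FP f -> FPT kappa f.
Proof.
move=> [c [d [X S]]]; apply: (FPT_intro (F := fun _ => 1) X) => //; first exact: TB_const.
- exact: (polyb_pow d).
- by move=> x; rewrite mul1n.
- by move=> x; rewrite mul1n.
Qed.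

Lemma FPT_comp (B C : encType) (g : B -> C) (f : A -> B) : FP g -> FPT kappa f -> FPT kappa (fun x => g (f x)).
Proof.
move=> [c2 [d2 [X2 S2]]] [c1 [F [d1 [HF X1 S1]]]].
pose G k := (F k).+2 ^ d2 + F k.
pose p n := (n.+2 ^ d1).+2 ^ d2 + n.+2 ^ d1.
have Hp : polyb p by rewrite /p; polyb.
have HG : TB G by apply: TB_add => //; apply: TB_pow (TB_const d2); do 2! apply: TB_S.
have L x : (sz (f x)).+2 ^ d2 <= (F (kappa x)).+2 ^ d2 * ((sz x).+2 ^ d1).+2 ^ d2.
  rewrite -expnMn; case: (d2) => // e; rewrite leq_exp2r //.
  by have := S1 x; move: (expn _ d1) => y; nia.
apply: (FPT_intro (computes_comp X1 X2) HG Hp) => x; rewrite /G /p.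
- have := L x; set a := expn (sz (f x)).+2 d2; set b := expn (F _).+2 d2; set y := expn _ d1; set e := expn _ d2.
  by clearbody e y b a; nia.
- have := leq_trans (S2 (f x)) (L x); set b := expn (F _).+2 d2; set y := expn _ d1; set e := expn _ d2.
  by clearbody e y b; nia.
Qed.

Lemma FPT_pair (B C : encType) (f : A -> B) (g : A -> C) :
  FPT kappa f -> FPT kappa g -> FPT kappa (fun x => (f x, g x)).
Proof.
move=> [c1 [F1 [d1 [H1 X1 S1]]]] [c2 [F2 [d2 [H2 X2 S2]]]].
pose F k := F1 k + F2 k + 25.
pose p n := n.+2 ^ d1 + n.+2 ^ d2 + 1.
have Hp : polyb p by rewrite /p; polyb.
have HF : TB F by apply: TB_add (TB_const 25); apply: TB_add.
apply: (FPT_intro (computes_pair X1 X2) HF Hp) => x; rewrite /F /p.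
- by set a := expn _ d1; set b := expn _ d2; clearbody a b; nia.
- by rewrite sz_pair /=; have := S1 x; have := S2 x; set a := expn _ d1; set b := expn _ d2; clearbody a b; nia.
Qed.

(** A list of length two to the power [size l]: one storey of a tower of unary bounds. Its time
    depends on the length of the argument only, hence on the parameter whenever that length does. *)
Definition expl (l : seq nat) : seq nat := foldl (fun s _ => s ++ s) [:: 0] l.

Lemma size_expl l : size (expl l) = 2 ^ size l.
Proof.
rewrite /expl; have E s : size (foldl (fun s _ => s ++ s) s l) = 2 ^ size l * size s.
  by elim: l s => [|h l IH] s /=; rewrite ?mul1n // IH size_cat expnS; lia.
by rewrite E muln1.
Qed.

Lemma computes_expl : exists c t, computes c expl t /\
  exists2 T, TB T & forall l, t l <= T (size l).
Proof.
have [c1 [d1 [X1 S1]]] : FP (fun l : seq nat => (0, ([:: 0], l))) by fp.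
have [c2 [d2 [X2 S2]]] : FP (fun x : nat * (seq nat * nat) => x.2.1 ++ x.2.1) by fp.
have X := computes_comp X1 (computes_fold (f := fun _ s _ => s ++ s) X2).
eexists; eexists; split; first exact: X.
pose T n := n.*2.+3 ^ d1 + (n * ((2 ^ n).*2.+1 + 20) ^ d2 + n * 50) + 50.
exists T.
  rewrite /T; have HD f : TB f -> TB (fun k => (f k).*2).
    by move=> H; apply: TB_le (TB_add H H) _ => k; rewrite addnn.
  have HE := HD _ (TB_exp2 TB_id); have H2 := HD _ TB_id.
  apply: TB_add (TB_const _); apply: TB_add.
    by apply: TB_pow (TB_const _); do 3! apply: TB_S.
  apply: TB_add; last by apply: TB_mul (TB_const _); exact: TB_id.
  apply: TB_mul; first exact: TB_id.
  by apply: TB_pow (TB_const _); apply: TB_add (TB_const _); apply: TB_S.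
move=> l /=; rewrite /T -addnA sz_natseq; apply: leq_add => //; rewrite leq_add2r.
have : forall l1 l2, l = l1 ++ l2 ->
    fold_time (fun _ s _ => s ++ s) (fun x : nat * (seq nat * nat) => (sz x).+2 ^ d2) 0
      (expl l1) l2 <= size l2 * (((2 ^ size l).*2.+1 + 20) ^ d2 + 50).
  move=> l1 l2; elim: l2 l1 => [//|h l2 IH] l1 E /=.
  have := IH (rcons l1 h); rewrite cat_rcons => /(_ E).
  rewrite {1}/expl foldl_rcons -/(expl l1) mulSn => H; apply: leq_add H; rewrite leq_add2r.
  case: (d2) => // e; rewrite leq_exp2r // !sz_pair /= sz_natseq !sz_nat size_expl.
  have : 2 ^ size l1 <= 2 ^ size l by rewrite leq_pexp2l // E size_cat leq_addr.
  by set a := expn 2 _; set b := expn 2 _; clearbody a b; lia.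
by move=> /(_ [::] l erefl); rewrite mulnDr.
Qed.

Lemma FPT_expl (U : A -> seq nat) u : FPT kappa U -> TB u -> (forall x, size (U x) = u (kappa x)) ->
  FPT kappa (fun x => expl (U x)).
Proof.
move=> [c1 [F [d [HF X1 S1]]]] Hu Su.
have [c2 [t [X2 [T HT LT]]]] := computes_expl.
pose G k := F k + T (u k) + (2 ^ u k).*2.+1.
pose p n := n.+2 ^ d + 1.
have Hp : polyb p by rewrite /p; polyb.
have HE := TB_exp2 Hu.
have HG : TB G.
  apply: TB_add; first by apply: TB_add => //; apply: TB_comp.
  by apply: TB_S; apply: TB_le (TB_add HE HE) _ => k; rewrite addnn.
apply: (FPT_intro (computes_comp X1 X2) HG Hp) => x; rewrite /G /p.
- have := LT (U x); rewrite Su; move: (expn _ d) => a; nia.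
- by rewrite sz_natseq size_expl Su; move: (expn _ d) => a; nia.
Qed.

(* Lists serve as unary loop bounds; through them the parameter enters the running time. *)
Lemma FPT_tow (K : A -> seq nat) c : FP K -> (forall x, size (K x) = kappa x) ->
  exists2 U : A -> seq nat, FPT kappa U & forall x, size (U x) = tow c (kappa x + c).
Proof.
move=> HK SK.
suff : forall d, exists U : A -> seq nat, [/\ FPT kappa U, TB (fun k => tow d (k + c)) &
    forall x, size (U x) = tow d (kappa x + c)].
  by move=> /(_ c) [U [H1 _ H2]]; exists U.
elim=> [|d [U [H1 H2 H3]]].
  exists (fun x => K x ++ nseq c 0); split.
  - by apply: FPT_FP; apply: FP_cat => //; elim: c => [|c IH]; [apply: FP_nil | apply: FP_cons IH; apply: FP_const].
  - by apply: TB_add (TB_const _); exact: TB_id.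
  - by move=> x; rewrite size_cat size_nseq SK.
exists (fun x => expl (U x)); split.
- exact: (FPT_expl H1 H2 H3).
- exact: (TB_exp2 H2).
- by move=> x; rewrite size_expl H3.
Qed.

End FixedParameter.

(** * Connectivity in vertex lists *)

Lemma sub_in_count (T : eqType) (p q : pred T) s :
  (forall x, x \in s -> p x -> q x) -> count p s <= count q s.
Proof.
elim: s => //= x s IH H; apply: leq_add; last by apply: IH => y Hy; apply: H; rewrite inE Hy orbT.
by have := H x; rewrite inE eqxx; case: (p x) => // /(_ isT isT) ->.
Qed.

Section Graph.
Variable e : rel nat.
Hypothesis esym : symmetric e.
Implicit Types (A : nat -> bool) (D : seq nat).

Inductive conn (A : nat -> bool) (x : nat) : nat -> Prop :=
  | conn0 : A x -> conn A x x
  | connS y z : conn A x y -> e y z -> A z -> conn A x z.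

Lemma conn_r A x y : conn A x y -> A y.
Proof. by case. Qed.

Lemma conn_mono (A B : nat -> bool) x y : (forall v, A v -> B v) -> conn A x y -> conn B x y.
Proof. by move=> H; elim=> [/H|u v _ IH E /H]; [apply: conn0 | apply: connS IH E]. Qed.

Lemma conn_trans A x y z : conn A x y -> conn A y z -> conn A x z.
Proof. by move=> H; elim=> [//|u v _ IH E Av]; apply: connS IH E Av. Qed.

Lemma conn_sym A x y : conn A x y -> conn A y x.
Proof.
elim=> [H|u v H IH E Av]; first exact: conn0.
by apply: conn_trans IH; apply: connS (conn0 Av) _ (conn_r H); rewrite esym.
Qed.

Lemma conn1 A x y : A x -> A y -> e x y -> conn A x y.
Proof. by move=> Hx Hy E; apply: connS (conn0 Hx) E Hy. Qed.

Lemma connP A x y : conn A x y <-> exists p, [/\ path e x p, last x p = y & all A (x :: p)].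
Proof.
split=> [|[p [Hp <- Ap]]].
  elim=> [H|u v _ [p [P L Al]] E Av]; first by exists [::]; rewrite /= H.
  by exists (rcons p v); rewrite rcons_path P L E last_rcons -rcons_cons all_rcons Av Al.
elim: p x Hp Ap => [|v p IH] x /=; first by rewrite andbT => _; apply: conn0.
case/andP=> E Hp /andP[Ax Ap]; apply: conn_trans (IH _ Hp Ap).
by apply: conn1 => //; case/andP: Ap.
Qed.

Lemma conn_uniq A x y : conn A x y ->
  exists p, [/\ path e x p, last x p = y, all A (x :: p) & uniq (x :: p)].
Proof.
case/connP=> p [Hp <- Ap]; case/shortenP: Hp => p' Hp' U S; exists p'; split=> //.
apply/allP=> z; rewrite inE => /orP[/eqP->|/S Hz]; apply: (allP Ap); rewrite inE ?eqxx // Hz.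
by rewrite orbT.
Qed.

Definition reach_step (D R : seq nat) := [seq v <- D | (v \in R) || has (e v) R].

Definition reachset (D : seq nat) (x : nat) : seq nat :=
  foldl (fun R _ => reach_step D R) [seq v <- D | v == x] D.

Lemma reachP D x y : y \in reachset D x <-> conn (fun v => v \in D) x y.
Proof.
pose R n := iter n (reach_step D) [seq v <- D | v == x].
have -> : reachset D x = R (size D).
  rewrite /reachset; have H (l : seq nat) s : foldl (fun R _ => reach_step D R) s l = iter (size l) (reach_step D) s.
    by elim: l s => [|h l IH] s //=; rewrite IH -iterSr.
  exact: H.
split=> [|/conn_uniq [p [Hp L Ap U]]].
  elim: (size D) y => [|n IH] y /=.
    by rewrite mem_filter => /andP[/eqP-> H]; apply: conn0.
  rewrite mem_filter => /andP[/orP[/IH //|/hasP[z /IH Hz E]] Hy].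
  by apply: connS Hz _ Hy; rewrite esym.
have Mono n m : n <= m -> {subset R n <= R m}.
  move=> /subnK <-; elim: (m - n) => [//|d IH] z /IH H; rewrite addSn /= mem_filter H /=.
  case: (d + n) H => [|i] /=; rewrite mem_filter; by case/andP.
(* A simple path in [D] has fewer edges than [D] has vertices, so [size D] rounds reach its end. *)
have Sz : size p < size D.
  by apply: (uniq_leq_size U) => z Hz; apply: (allP Ap).
apply: (Mono (size p)); first exact: ltnW.
elim/last_ind: p y Hp L Ap {Sz U} => [|p z IH] y /=.
  by move=> _ <-; rewrite andbT mem_filter eqxx.
rewrite rcons_path last_rcons all_rcons => /andP[Hp E] <- /and3P[Hx Hz Ap].
rewrite size_rcons /= mem_filter Hz andbT; apply/orP; right.
by apply/hasP; exists (last x p); [apply: IH => //=; rewrite Hx | rewrite esym].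
Qed.

Lemma reach_sub D x : {subset reachset D x <= D}.
Proof. by move=> y /reachP /conn_r. Qed.

Lemma conn_eq (D D' : seq nat) x y : D =i D' -> conn (fun v => v \in D) x y -> conn (fun v => v \in D') x y.
Proof. by move=> E; apply: conn_mono => v; rewrite E. Qed.

Definition connected (D : seq nat) := forall x y, x \in D -> y \in D -> conn (fun v => v \in D) x y.

Definition connb (D : seq nat) := all (fun y => y \in reachset D (head 0 D)) D.

Lemma connbP D : connb D <-> connected D.
Proof.
split=> [/allP H x y Hx Hy|H].
  by apply: (@conn_trans _ _ (head 0 D)); [apply: conn_sym|]; apply/reachP/H.
apply/allP=> y Hy; apply/reachP/H => //.
by case: D Hy {H} => //= a D _; rewrite inE eqxx.
Qed.

Lemma connected_eq D D' : D =i D' -> connected D -> connected D'.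
Proof. by move=> E H x y; rewrite -!E => Hx Hy; apply: conn_eq E _; apply: H. Qed.

Lemma connected_add D u w : connected D -> w \in D -> e u w -> connected (u :: D).
Proof.
move=> H Hw E.
have K x : x \in u :: D -> conn (fun v => v \in u :: D) x w.
  rewrite inE => /orP[/eqP->|Hx]; first by apply: conn1 E; rewrite inE ?eqxx ?Hw ?orbT.
  by apply: conn_mono (H _ _ Hx Hw) => v; rewrite inE => ->; rewrite orbT.
by move=> x y Hx Hy; apply: conn_trans (K x Hx) _; apply: conn_sym; apply: K.
Qed.

(** Take the first edge of the walk that leaves [p]; the walk before it stays inside [p]. *)
Lemma conn_cross (A p : nat -> bool) x y : conn A x y -> p x -> ~~ p y ->
  exists u v, [/\ e u v, p u, ~~ p v & conn (fun z => A z && p z) x u /\ A v].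
Proof.
case/connP=> q [Hq <- Aq]; elim: q x Hq Aq => [|v q IH] x /=; first by move=> _ _ ->.
case/andP=> E Hq /and3P[Ax Av Aq] Px Nl; case Pv : (p v); last first.
  by exists x, v; rewrite Pv; split=> //; split=> //; apply: conn0; rewrite Ax.
have [|u [w [E' Pu Nw [C Aw]]]] := IH v Hq _ Pv Nl; first by rewrite /= Av.
exists u, w; split=> //; split=> //; apply: conn_trans C.
by apply: conn1 => //; rewrite ?Ax ?Av.
Qed.

(** * Degrees, non-cut vertices and branching vertices *)

Definition del (D : seq nat) (w : nat) := [seq u <- D | u != w].
Definition deg (D : seq nat) (v : nat) := count (fun u => (u != v) && e v u) D.
(** The empty list counts as connected, so the only vertex of a singleton is non-cut. *)
Definition noncut D (v : nat) := connb (del D v).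
Definition nc D := count (noncut D) D.
Definition br D := count (fun v => 2 < deg D v) D.

Lemma mem_del D w x : (x \in del D w) = (x != w) && (x \in D).
Proof. by rewrite mem_filter. Qed.

Lemma del_uniq D w : uniq D -> uniq (del D w).
Proof. exact: filter_uniq. Qed.

Lemma count_del (p : pred nat) D w : uniq D -> w \in D -> count p D = p w + count p (del D w).
Proof.
by move=> U Hw; rewrite /del -(rem_filter _ U) (permP (perm_to_rem Hw)) /=.
Qed.

Lemma size_del D w : uniq D -> w \in D -> size D = (size (del D w)).+1.
Proof. by move=> U /(count_del xpredT U); rewrite !count_predT. Qed.

Lemma deg_del D v w : uniq D -> w \in D -> w != v -> deg D v = e v w + deg (del D w) v.
Proof. by move=> U Hw N; rewrite /deg (count_del _ U Hw) N. Qed.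

Lemma connected_neighbour D w : connected D -> w \in D -> 1 < size D -> uniq D ->
  exists2 z, z \in del D w & e w z.
Proof.
move=> C Hw S U.
have [x] : exists x, x \in del D w.
  by move: S; rewrite (size_del U Hw) ltnS; case: (del D w) => // a l _; exists a; rewrite inE eqxx.
rewrite mem_del => /andP[N Hx].
have [u [v [E Pu Nv [_ Hv]]]] := conn_cross (p := pred1 w) (C _ _ Hw Hx) (eqxx w) N.
by exists v; [rewrite mem_del Nv | rewrite -(eqP Pu)].
Qed.

(** Grow a connected set from [v] one vertex at a time until a single vertex is missing; that vertex
    is non-cut and differs from [v]. *)
Lemma exists_noncut D v : uniq D -> connected D -> v \in D -> 1 < size D ->
  exists w, [/\ w \in D, w != v & connected (del D w)].
Proof.
move=> U C Hv S.
have Grow n : 0 < n -> n <= size D -> exists B, [/\ uniq B, {subset B <= D}, v \in B, connected B & size B = n].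
  elim: n => [//|[|n] IH] _ Hn.
    exists [:: v]; split=> //; first by move=> x; rewrite inE => /eqP->.
      by rewrite inE.
    by move=> x y; rewrite !inE => /eqP-> /eqP->; apply: conn0; rewrite inE.
  have [||B [UB SB VB CB SzB]] := IH; rewrite // ?(ltnW Hn) //.
  have [x Hx Nx] : exists2 x, x \in D & x \notin B.
    apply/hasP; rewrite has_predC; apply/negP=> /allP A.
    by have := uniq_leq_size U A; rewrite SzB leqNgt Hn.
  have [u [w [E Pu Nw [_ Hw]]]] := conn_cross (p := fun u => u \in B) (C _ _ Hv Hx) VB Nx.
  exists (w :: B); split=> /=; rewrite ?SzB //.
  - by rewrite UB andbT.
  - by move=> y; rewrite inE => /orP[/eqP->|/SB].
  - by rewrite inE VB orbT.
  - by apply: (connected_add CB (w := u)) => //; rewrite esym.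
have [||B [UB SB VB CB SzB]] := Grow (size D).-1; rewrite ?leq_pred //; first by case: (size D) S.
have [w Hw Nw] : exists2 x, x \in D & x \notin B.
  apply/hasP; rewrite has_predC; apply/negP=> /allP A.
  by have := uniq_leq_size U A; rewrite SzB; case: (size D) S => // n; rewrite ltnn.
exists w; split=> //; first by apply: contra Nw => /eqP->.
apply: connected_eq CB => x; apply: (uniq_min_size UB _ _).2.
- by move=> y Hy; rewrite mem_del SB // andbT; apply: contra Nw => /eqP<-.
- by rewrite SzB (size_del U Hw).
Qed.

(** After the deletion of [x], the vertex [w] can be put back because its neighbour [z] is still
    present to attach it. *)
Lemma noncut_del D w x z : connected (del D w) -> w \in D -> z \in del D w -> e w z -> z != x ->
  w != x -> noncut (del D w) x -> noncut D x.
Proof.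
move=> _ Hw Hz E N Nw /connbP C; apply/connbP.
apply: (connected_eq (D := w :: del (del D w) x)).
  move=> y; rewrite inE !mem_del; case: (y =P w) => [->|_] /=; last by [].
  by rewrite Nw Hw.
by apply: connected_add C _ E; rewrite mem_del eq_sym eq_sym N.
Qed.

(** A walk that starts at the only neighbour [z] and passes through [v] returns to [z] at once;
    restarting there removes every visit to [v]. *)
Lemma leaf_noncut D v : uniq D -> connected D -> v \in D -> deg D v <= 1 -> noncut D v.
Proof.
move=> U C Hv Hd; apply/connbP.
case: (ltnP 1 (size D)) => S; last first.
  have : del D v = [::] by apply/eqP; rewrite -size_eq0; have := size_del U Hv; lia.
  by move=> -> x.
have [z Hz Ez] := connected_neighbour C Hv S U.
have K x : conn (fun u => u \in D) z x -> x != v -> conn (fun u => u \in del D v) z x.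
  elim=> [_ _|a b _ IH E Hb Nb]; first exact: conn0.
  case: (a =P v) => [Ea|/eqP Na]; last by apply: connS (IH Na) E _; rewrite mem_del Nb.
  suff -> : b = z by apply: conn0.
  apply/eqP/negPn/negP=> Nbz; move: Hd; rewrite leqNgt => /negP; apply.
  have Hzv : z != v by move: Hz; rewrite mem_del => /andP[].
  have HzD : z \in D by move: Hz; rewrite mem_del => /andP[].
  rewrite (deg_del U HzD Hzv) Ez (deg_del (del_uniq _ U) _ Nb); last by rewrite mem_del Nbz.
  by rewrite -Ea E.
have HzD : z \in D by move: Hz; rewrite mem_del => /andP[].
move=> x y; rewrite !mem_del => /andP[Nx Hx] /andP[Ny Hy].
by apply: conn_trans (conn_sym (K x _ Nx)) (K y _ Ny); apply: C.
Qed.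

(** A tree containing all edges at [v] has at least as many leaves as [v] has neighbours. The
    induction deletes a non-cut vertex [w] other than [v]. If [w] is adjacent to [v], it is attached
    there and no other non-cut vertex is lost when it returns; otherwise at most its neighbour [z]
    is lost, and [w] itself makes up for it. *)
Lemma deg_le_nc D v : uniq D -> connected D -> v \in D ->
  deg D v <= count (fun u => (u != v) && noncut D u) D.
Proof.
move: {2}(size D) (leqnn (size D)) => n; elim: n D v => [|n IH] D v.
  by rewrite leqn0 size_eq0 => /eqP->.
move=> Sn U C Hv; case: (ltnP 1 (size D)) => S; last first.
  have E0 : del D v = [::] by apply/eqP; rewrite -size_eq0; have := size_del U Hv; lia.
  by rewrite /deg (count_del _ U Hv) eqxx E0.
have [w [Hw Nw Cw]] := exists_noncut U C Hv S.
have Nvw : v != w by rewrite eq_sym.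
have Hv' : v \in del D w by rewrite mem_del Nvw.
have {IH} := IH _ v _ (del_uniq w U) Cw Hv'.
have -> : size (del D w) <= n by move: Sn; rewrite (size_del U Hw).
move=> /(_ isT) IH.
rewrite (deg_del U Hw Nw) (count_del (fun u => _) U Hw) Nw /=.
have -> : noncut D w by apply/connbP.
case Evw : (e v w).
  rewrite leq_add2l; apply: leq_trans IH _; apply: sub_in_count => x Hx /andP[Nx /= Kx].
  have Ewv : e w v by rewrite esym.
  have Nw' : w != x by move: Hx; rewrite mem_del eq_sym => /andP[].
  by rewrite Nx /=; apply: (noncut_del Cw Hw Hv' Ewv _ Nw' Kx); rewrite eq_sym.
have [z Hz Ez] := connected_neighbour C Hw S U.
rewrite add0n; apply: leq_trans IH _.
rewrite [leqLHS](count_del _ (del_uniq w U) Hz).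
apply: leq_add; first by case: (_ && _).
apply: leq_trans (_ : count (fun u => (u != v) && noncut D u) (del (del D w) z) <= _).
  apply: sub_in_count => x; rewrite !mem_del => /and3P[Nxz Nxw Hx] /andP[-> /= Kx].
  by apply: (noncut_del Cw Hw Hz Ez _ _ Kx); rewrite eq_sym.
by rewrite [leqRHS](count_del _ (del_uniq w U) Hz) leq_addl.
Qed.

Lemma deg_nc D v : uniq D -> connected D -> v \in D -> deg D v <= nc D.
Proof.
move=> U C Hv; apply: leq_trans (deg_le_nc U C Hv) _; apply: sub_count => x /andP[_ H]; exact: H.
Qed.

Lemma leaves_nc D : uniq D -> connected D -> count (fun v => deg D v < 2) D <= nc D.
Proof. by move=> U C; apply: sub_in_count => v Hv; rewrite ltnS; apply: leaf_noncut. Qed.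

(** Only [w] and the neighbours of [w], whose degree drops, can cease to be branching. *)
Lemma br_del D w : uniq D -> w \in D -> br D <= br (del D w) + (2 < deg D w) + deg D w.
Proof.
move=> U Hw; rewrite /br (count_del _ U Hw) [leqRHS]addnAC [leqRHS]addnC leq_add2l.
have -> : deg D w = count (fun v => e v w) (del D w).
  rewrite /deg (count_del _ U Hw) eqxx /=; apply: eq_in_count => v.
  by rewrite mem_del => /andP[-> _] /=; rewrite esym.
rewrite -(count_predUI (fun v => 2 < deg (del D w) v)); apply: leq_trans (leq_addr _ _).
apply: sub_in_count => v; rewrite mem_del => /andP[Nv Hv] /=.
by rewrite (deg_del U Hw) 1?eq_sym //; case: (e v w); rewrite ?orbT // add0n => ->.
Qed.

(** With two neighbours, [w] stays attached whichever vertex [x] is deleted, so putting it back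
    turns no non-cut vertex into a cut vertex and adds [w]. *)
Lemma nc_del D w z z' : uniq D -> connected (del D w) -> w \in D ->
  z \in del D w -> e w z -> z' \in del D w -> e w z' -> z != z' -> nc (del D w) < nc D.
Proof.
move=> U Cw Hw Hz Ez Hz' Ez' Nz; rewrite {2}/nc (count_del _ U Hw).
have -> : noncut D w by apply/connbP.
rewrite add1n ltnS; apply: sub_in_count => x Hx Kx.
have Nw : w != x by move: Hx; rewrite mem_del eq_sym => /andP[].
case: (z =P x) => [Ezx|/eqP N]; last exact: (noncut_del Cw Hw Hz Ez N Nw Kx).
by apply: (noncut_del Cw Hw Hz' Ez' _ Nw Kx); rewrite -Ezx eq_sym.
Qed.

Lemma nc_del_leaf D w z : uniq D -> connected (del D w) -> w \in D -> z \in del D w -> e w z ->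
  nc (del D w) < nc D + noncut (del D w) z.
Proof.
move=> U Cw Hw Hz Ez; rewrite {2}/nc (count_del _ U Hw).
have -> : noncut D w by apply/connbP.
rewrite add1n addSn ltnS /nc (count_del _ (del_uniq w U) Hz) addnC leq_add2r.
apply: leq_trans (_ : count (noncut D) (del (del D w) z) <= _).
  apply: sub_in_count => x; rewrite !mem_del => /and3P[Nxz Nxw Hx] Kx.
  by apply: (noncut_del Cw Hw Hz Ez _ _ Kx); rewrite eq_sym.
by rewrite [leqRHS](count_del _ (del_uniq w U) Hz) leq_addl.
Qed.

Lemma deg2 D z : uniq D -> z \in D -> 1 < deg D z ->
  exists a b, [/\ a \in del D z, b \in del D z, e z a, e z b & a != b].
Proof.
move=> U Hz; rewrite /deg -size_filter; set s := filter _ D.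
have Us : uniq s by apply: filter_uniq.
have Ms x : x \in s -> x \in del D z /\ e z x.
  by rewrite mem_filter mem_del => /andP[/andP[-> ->] ->].
case: s Us Ms => [|a [|b s]] //= /andP[Nab _] Ms _.
exists a, b; split.
- by apply: (Ms a _).1; rewrite inE eqxx.
- by apply: (Ms b _).1; rewrite !inE eqxx orbT.
- by apply: (Ms a _).2; rewrite inE eqxx.
- by apply: (Ms b _).2; rewrite !inE eqxx orbT.
- by move: Nab; rewrite inE negb_or => /andP[].
Qed.

(** The arithmetic of [br_bound]: [B] bounds the branching vertices of the smaller graph, and the
    deletion costs at most [n + 3]. *)
Lemma br_step r b x d m n B M :
  r <= b + x + d -> b <= B -> x <= 1 -> d <= m -> m <= n -> B + n + 3 <= M -> r <= M.
Proof. lia. Qed.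

Lemma br_step2 r b x d b' x' d' m' m n B M :
  r <= b + x + d -> b <= b' + x' + d' -> b' <= B -> x = 0 -> d <= 1 -> x' <= 1 -> d' <= m' -> m' <= m ->
  m <= n -> B + n + 3 <= M -> r <= M.
Proof. lia. Qed.

(** Delete a non-cut vertex [w], which costs at most its degree plus one, a quantity bounded through
    [deg_nc]. If [w] has two neighbours, or its only neighbour [z] is a cut vertex of the rest, the
    number of non-cut vertices drops. Otherwise [z] is non-cut in the rest: if [z] is branching,
    deleting it too makes the number drop; if not, no branching vertex was lost, and the induction
    on the size applies with the same [N]. *)
Lemma br_bound D N : uniq D -> connected D -> nc D <= N -> br D <= N * (N + 4).
Proof.
move: {2}(size D) (leqnn (size D)) => n; elim/ltn_ind: n D N => n IH0 D N Sn U C HN; have IH := IH0.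
case: (ltnP 1 (size D)) => S; last first.
  rewrite (_ : br D = 0) //; apply/eqP; rewrite -leqn0 leqNgt -has_count; apply/negP=> /hasP[v Hv Hd].
  have : deg D v <= size D := count_size _ _.
  by move: Hd => /=; lia.
have [v Hv] : exists v, v \in D by case: D S {IH IH0 Sn U C HN} => // a l _; exists a; rewrite inE eqxx.
have [w [Hw _ Cw]] := exists_noncut U C Hv S.
have [z Hz Ez] := connected_neighbour C Hw S U.
have Uw := del_uniq w U.
have Sw : size (del D w) < n by move: Sn; rewrite (size_del U Hw).
have nc1 : 0 < nc D.
  by rewrite /nc -has_count; apply/hasP; exists w => //; apply/connbP.
have K : N.-1 * (N.-1 + 4) + N + 3 <= N * (N + 4).
  by case: N HN {IH IH0} => [|N]; [case: (nc D) nc1 | rewrite /=; lia].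
have {}IH D' : uniq D' -> connected D' -> size D' < n -> nc D' < nc D -> br D' <= N.-1 * (N.-1 + 4).
  by move=> U' C' S' L'; apply: (IH _ S' D' N.-1 (leqnn _) U' C'); lia.
have Dw := deg_nc U C Hw.
have Bw := br_del U Hw.
case: (ltnP 1 (deg D w)) => Dg.
  have [a [b [Ha Hb Ea Eb Nab]]] := deg2 U Hw Dg.
  have L := nc_del U Cw Hw Ha Ea Hb Eb Nab.
  exact: (br_step Bw (IH _ Uw Cw Sw L) (leq_b1 _) Dw HN K).
have L := nc_del_leaf U Cw Hw Hz Ez.
have Hz2 : z \in D by move: Hz; rewrite mem_del => /andP[].
have Nzw : z != w by move: Hz; rewrite mem_del => /andP[].
case Kz : (noncut (del D w) z); rewrite Kz in L; last first.
  by rewrite addn0 in L; exact: (br_step Bw (IH _ Uw Cw Sw L) (leq_b1 _) Dw HN K).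
have Dz := deg_del U Hw (v := z); rewrite eq_sym Nzw esym Ez in Dz.
case: (ltnP 2 (deg D z)) => Dgz.
  have [|a [b [Ha Hb Ea Eb Nab]]] := @deg2 _ z Uw Hz; first by move: Dgz; rewrite (Dz isT).
  have Cz : connected (del (del D w) z) by apply/connbP.
  have L2 := nc_del Uw Cz Hz Ha Ea Hb Eb Nab.
  have B2 := br_del Uw Hz.
  have D2 := deg_nc Uw Cw Hz.
  have Sz : size (del (del D w) z) < n by apply: leq_ltn_trans (ltnW _) Sw; rewrite (size_del Uw Hz).
  have L4 : nc (del D w) <= nc D by move: L; rewrite addn1 ltnS.
  have L3 : nc (del (del D w) z) < nc D by apply: leq_trans L2 L4.
  have X : (2 < deg D w : nat) = 0 by rewrite ltnNge (leq_trans Dg).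
  exact: (br_step2 Bw B2 (IH _ (del_uniq z Uw) Cz Sz L3) X Dg (leq_b1 _) D2 L4 HN K).
suff : br D <= br (del D w).
  move/leq_trans; apply; apply: (IH0 _ Sw _ _ (leqnn _) Uw Cw).
  by apply: leq_trans HN; move: L; rewrite addn1 ltnS.
rewrite {1}/br (count_del _ U Hw) (_ : (2 < deg D w) = false); last by rewrite ltnNge (leq_trans Dg).
rewrite add0n; apply: sub_in_count => x; rewrite mem_del => /andP[Nx Hx] H.
case: (x =P z) => [Exz|/eqP Nxz]; first by move: H; rewrite Exz ltnNge Dgz.
suff Exw : e x w = false by move: H; rewrite (deg_del U Hw) 1?eq_sym // Exw.
apply/negP=> Exw; move: Dg; rewrite leqNgt => /negP; apply.
rewrite (deg_del U Hz2) // Ez (deg_del (del_uniq _ U) (w := x)) ?mem_del ?Nxz //.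
by rewrite esym Exw.
Qed.

End Graph.

(** * Configurations and moves *)

Definition others (c : seq nat) (i : nat) : seq nat := [seq nth 0 c j | j <- iota 0 (size c) & j != i].

Lemma othersP c i v : reflect (exists j, [/\ j < size c, j != i & v = nth 0 c j]) (v \in others c i).
Proof.
apply: (iffP mapP) => [[j]|[j [Hj N ->]]].
  by rewrite mem_filter mem_iota => /andP[N Hj] ->; exists j.
by exists j; rewrite // mem_filter N mem_iota.
Qed.

Lemma size_others c i : i < size c -> (size (others c i)).+1 = size c.
Proof.
move=> Hi; rewrite size_map size_filter.
have := count_predC (pred1 i) (iota 0 (size c)).
rewrite size_iota (count_uniq_mem _ (iota_uniq _ _)) mem_iota Hi /= add1n => E.
by apply: etrans E; congr _.+1; apply: eq_count.
Qed.

Lemma others_uniq c i : uniq c -> i < size c -> nth 0 c i \notin others c i.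
Proof.
move=> U Hi; apply/othersP=> -[j [Hj N E]]; move: N.
by rewrite -(nth_uniq 0 Hj Hi U) E eqxx.
Qed.

Lemma uniq_set_nth c i y : uniq c -> i < size c -> y \notin others c i -> uniq (set_nth 0 c i y).
Proof.
move=> U Hi Hy; have S : size (set_nth 0 c i y) = size c by rewrite size_set_nth; apply/maxn_idPr.
apply/(uniqP 0) => a b; rewrite !inE S !nth_set_nth /= => Ha Hb.
case: (a =P i) => [->|/eqP Na]; case: (b =P i) => [->|/eqP Nb] //.
- by move=> E; case/othersP: Hy; exists b.
- by move=> E; case/othersP: Hy; exists a.
- by move/eqP; rewrite nth_uniq // => /eqP.
Qed.

Lemma set_nth_id c i : i < size c -> set_nth 0 c i (nth 0 c i) = c.
Proof.
move=> Hi; apply: (@eq_from_nth _ 0) => [|j _]; first by rewrite size_set_nth; apply/maxn_idPr.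
by rewrite nth_set_nth /=; case: eqP => [->|].
Qed.

Section Game.
Variables (e : rel nat) (V : seq nat).
Hypothesis esym : symmetric e.
Implicit Types (Y : nat -> bool) (c d : seq nat).

Definition free c i v := (v \in V) && (v \notin others c i).

(** [Y] restricts only the vertex where the move ends; the vertices passed on the way range over all
    free vertices of [V]. *)
Definition mv Y c c' := exists i y,
  [/\ i < size c, y != nth 0 c i, Y y, conn e (free c i) (nth 0 c i) y & c' = set_nth 0 c i y].

Inductive steps Y : nat -> seq nat -> seq nat -> Prop :=
  | steps0 c : steps Y 0 c c
  | stepsS n c c1 c2 : mv Y c c1 -> steps Y n c1 c2 -> steps Y n.+1 c c2.

Lemma size_mv Y c d : mv Y c d -> size d = size c.
Proof. by case=> i [y [Hi _ _ _ ->]]; rewrite size_set_nth; apply/maxn_idPr. Qed.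

Lemma uniq_mv Y c d : mv Y c d -> uniq c -> uniq d.
Proof.
case=> i [y [Hi _ _ C ->]] U; apply: uniq_set_nth => //.
by have /andP[] := conn_r C.
Qed.

Lemma sub_mv Y c d : mv Y c d -> {subset c <= V} -> {subset d <= V}.
Proof.
case=> i [y [Hi _ _ C ->]] S v /(nthP 0) [j]; rewrite size_set_nth nth_set_nth /= => Hj <-.
case: eqP => _; first by have /andP[] := conn_r C.
by apply/S/mem_nth; move: Hj; rewrite (maxn_idPr Hi).
Qed.

Lemma steps_trans Y m n c1 c2 c3 : steps Y m c1 c2 -> steps Y n c2 c3 -> steps Y (m + n) c1 c3.
Proof. by elim=> [//|a b d f M _ IH] /IH; rewrite addSn; apply: stepsS. Qed.

Lemma steps_inv Y n c d : steps Y n c d ->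
  uniq c -> {subset c <= V} -> [/\ size d = size c, uniq d & {subset d <= V}].
Proof.
elim=> [//|a b f g M _ IH] U S.
have [E1 E2 E3] := IH (uniq_mv M U) (sub_mv M S).
by split=> //; rewrite E1 (size_mv M).
Qed.

(** * Zones: parking on a fixed set of slots *)

Section Zones.
Variables (k : nat) (zone : nat -> nat) (L : nat -> seq nat).

Definition adj_zone a s := [/\ s \in V, zone s = 0 & exists w, [/\ w \in V, zone w = a & e s w]].
(** Robots parked in a zone [a] other than 0 stand on slots, so its core is always free. The two
    connectivity hypotheses below say that a slot reaches every boundary vertex of the zone, and
    that boundary vertices reach each other, through the core. *)
Definition core a v := (v \in V) && (zone v == a) && (v \notin L a).

Hypothesis zone_slot : forall a l, a != 0 -> l \in L a -> zone l = a /\ l \in V.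
Hypothesis slots : forall v, v \in V -> zone v != 0 -> uniq (L (zone v)) /\ k <= size (L (zone v)).
Hypothesis zone_edge : forall u v, u \in V -> v \in V -> e u v -> zone u != 0 -> zone v != 0 -> zone u = zone v.
Hypothesis slot_conn : forall a l s, a != 0 -> l \in L a -> adj_zone a s ->
  conn e (fun v => [|| v == l, v == s | core a v]) l s.
Hypothesis core_conn : forall a s s', a != 0 -> adj_zone a s -> adj_zone a s' ->
  conn e (fun v => [|| v == s, v == s' | core a v]) s s'.

Definition parkable v := (zone v == 0) || (v \in L (zone v)).

Definition Sim c c' := [/\ size c' = size c, uniq c' &
  forall i, i < size c -> if zone (nth 0 c i) == 0 then nth 0 c' i = nth 0 c i
                          else nth 0 c' i \in L (zone (nth 0 c i))].

(** The simulating robot follows the route of the original through zone 0 and crosses other zones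
    through their cores. A move that ends in the zone where it began is dropped; one that ends in
    another zone is redirected to a free slot there. *)
Lemma sim_mv c d c' : size c = k -> uniq c -> {subset c <= V} -> mv xpredT c d -> Sim c c' ->
  exists2 d', Sim d d' & d' = c' \/ mv parkable c' d'.
Proof.
move=> Sk U SV [i [y [Hi Ny _ C ->]]] [S' U' Z'].
set x := nth 0 c i in Ny C; set x' := nth 0 c' i.
have Hi' : i < size c' by rewrite S'.
have Zi := Z' _ Hi; rewrite -/x -/x' in Zi.
have xV : x \in V by apply/SV/mem_nth.
have x'V : x' \in V.
  by move: Zi; case: eqP => [_ ->|/eqP N] // H; case: (zone_slot N H).
have x'F : free c' i x' by rewrite /free x'V others_uniq.
have zx' : zone x' = zone x.
  by move: Zi; case: eqP => [_ ->|/eqP N] // H; case: (zone_slot N H).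
have f0 v : zone v = 0 -> free c i v -> free c' i v.
  move=> Zv /andP[vV /othersP H]; rewrite /free vV; apply/othersP=> -[j [Hj N E]]; apply: H.
  exists j; rewrite -S'; split=> //; have := Z' j; rewrite -S' => /(_ Hj).
  by case: eqP => [_ <- //|/eqP Nz /(zone_slot Nz) [E' _]]; move: Nz; rewrite -E' -E Zv.
have f2 a v : a != 0 -> core a v -> free c' i v.
  move=> Na /andP[/andP[Hv /eqP Zv] Nv]; rewrite /free Hv; apply/othersP=> -[j [Hj N E]].
  have := Z' j; rewrite -S' => /(_ Hj); rewrite -E; case: eqP => [E0 E1|/eqP Nz H].
    by move: Na; rewrite -Zv E1 E0.
  by move: Nv; have [E2 _] := zone_slot Nz H; rewrite -Zv E2 H.
(* Inside a zone the simulating robot need not reach [u]; it suffices that it reaches every free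
   boundary vertex. The last disjunction remembers a way into the zone for the case that the move
   ends there. *)
pose Inv u := if zone u == 0 then conn e (free c' i) x' u else
  (forall s, adj_zone (zone u) s -> free c' i s -> conn e (free c' i) x' s) /\
  (zone u = zone x \/ exists2 s, adj_zone (zone u) s & conn e (free c' i) x' s).
have Iy : Inv y.
  elim: C {Ny} => [Fx|u v Cu Iu E Fv].
    rewrite /Inv; case: eqP => [E|/eqP N].
      by move: Zi; rewrite E eqxx => <-; apply: conn0.
    split; last by left.
    move=> s As Fs; move: Zi; rewrite (negbTE N) => Zi.
    apply: conn_mono (slot_conn N Zi As) => v /or3P[/eqP->|/eqP->|] //; exact: f2.
  have /andP[uV _] := conn_r Cu; have /andP[vV _] := Fv.
  move: Iu; rewrite /Inv; case: eqP => [Zu Iu|/eqP Nu [I1 I2]]; case: eqP => [Zv|/eqP Nv].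
  - by apply: connS Iu E _; apply: f0.
  - have Au : adj_zone (zone v) u by split=> //; exists v.
    split; last by right; exists u.
    move=> s As Fs; apply: conn_trans Iu _.
    apply: conn_mono (core_conn Nv Au As) => w /or3P[/eqP->|/eqP->|] //; last exact: f2.
    exact: f0 (conn_r Cu).
  - apply: I1; last exact: f0.
    by split=> //; exists u; rewrite esym.
  - by rewrite -(zone_edge uV vV E).
have /andP[yV Fy] := conn_r C.
have Sd y' : size (set_nth 0 c' i y') = size (set_nth 0 c i y) by rewrite !size_set_nth S'.
have SimI y' : free c' i y' -> (if zone y == 0 then y' = y else y' \in L (zone y)) ->
    Sim (set_nth 0 c i y) (set_nth 0 c' i y').
  move=> /andP[_ Fy'] Hy'; split=> //; first exact: uniq_set_nth.
  move=> j; rewrite size_set_nth (maxn_idPr Hi) !nth_set_nth /= => Hj.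
  by case: (j =P i) => // _; apply: Z'.
move: Iy; rewrite /Inv; case: eqP => [Zy Cy|/eqP Ny0 [_ I2]].
  exists (set_nth 0 c' i y); first by apply: SimI; rewrite ?Zy // (conn_r Cy).
  right; exists i, y; split=> //; last by rewrite /parkable Zy.
  apply: contra Ny => /eqP E; have Ex : zone x = 0 by rewrite -zx' /x' -E.
  by move: Zi; rewrite Ex eqxx /x' -E => ->.
case: (zone y =P zone x) => [Exy|/eqP Nxy].
  exists c'; last by left.
  move: Zi; rewrite -Exy (negbTE Ny0) => Zi.
  have := SimI x' x'F; rewrite (negbTE Ny0) => /(_ Zi).
  by rewrite set_nth_id.
have [E|[s As Cs]] := I2; first by rewrite E eqxx in Nxy.
have [UL kL] := slots yV Ny0.
(* There are at least [k] slots, but only [k - 1] other robots. *)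
have [l Hl Nl] : exists2 l, l \in L (zone y) & l \notin others c' i.
  apply/hasP; rewrite has_predC; apply/negP=> /allP A.
  by have := leq_trans kL (uniq_leq_size UL A); rewrite -Sk -S' -(size_others Hi') ltnn.
have [Zl lV] := zone_slot Ny0 Hl.
have Fl : free c' i l by rewrite /free lV.
exists (set_nth 0 c' i l); first by apply: SimI => //; rewrite (negbTE Ny0).
right; exists i, l; split=> //.
- by apply: contra Nxy => /eqP El; rewrite -zx' /x' -El Zl.
- by rewrite /parkable Zl Hl orbT.
- apply: (conn_trans Cs); apply: conn_sym => //.
  apply: conn_mono (slot_conn Ny0 Hl As) => v /or3P[/eqP->|/eqP->|] //; last exact: f2.
  exact: conn_r Cs.
Qed.

Lemma sim_steps n c d c' : size c = k -> uniq c -> {subset c <= V} -> steps xpredT n c d -> Sim c c' ->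
  exists m d', [/\ m <= n, steps parkable m c' d' & Sim d d'].
Proof.
move=> Sk U SV H; elim: H c' Sk U SV => [c1|{}n {}c c1 c2 M _ IH] c' Sk U SV S.
  by exists 0, c'; split=> //; apply: steps0.
have [c1' S1 M1] := sim_mv Sk U SV M S.
have [m [d' [Lm Hm Sd]]] := IH c1' (etrans (size_mv M) Sk) (uniq_mv M U) (sub_mv M SV) S1.
case: M1 => [E|M1]; first by exists m, d'; rewrite -E; split=> //; apply: leqW.
by exists m.+1, d'; split=> //; apply: stepsS M1 Hm.
Qed.

End Zones.
End Game.

(** * Replacing the parking positions on a path *)

Section Paths.
Variables (e : rel nat) (V : seq nat).
Hypothesis esym : symmetric e.

Definition chain (l : seq nat) := forall i, i.+1 < size l -> e (nth 0 l i) (nth 0 l i.+1).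

Lemma chain_conn (A : nat -> bool) l a b : chain l -> a <= b -> b < size l ->
  (forall j, a <= j <= b -> A (nth 0 l j)) -> conn e A (nth 0 l a) (nth 0 l b).
Proof.
move=> C Hab Hb; elim: b Hab Hb => [|b IH] Hab Hb H.
  by move: Hab; rewrite leqn0 => /eqP E; rewrite E; apply: conn0; apply: H; rewrite E.
case: (ltnP b a) => Hba.
  by have Ea : a = b.+1 by [lia]; rewrite Ea; apply: conn0; apply: H; rewrite Ea !leqnn.
apply: (connS (y := nth 0 l b)); last 1 first.
- by apply: H; rewrite Hab /=.
- by apply: IH => //; [exact: ltnW | move=> j /andP[H1 H2]; apply: H; rewrite H1 ltnW].
- exact: C.
Qed.

Lemma chain_conn2 (A : nat -> bool) l u v : chain l -> u \in l -> v \in l ->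
  (forall w, w \in l -> minn (index u l) (index v l) <= index w l <= maxn (index u l) (index v l) -> A w) ->
  uniq l -> conn e A u v.
Proof.
move=> C; wlog Huv : u v / index u l <= index v l.
  move=> W Hu Hv H U; case: (leqP (index u l) (index v l)) => Huv; first exact: W.
  by apply: conn_sym => //; apply: W => //; [exact: ltnW | move=> w Hw; rewrite minnC maxnC; apply: H].
move=> Hu Hv H U; rewrite -(nth_index 0 Hu) -(nth_index 0 Hv).
apply: chain_conn => //; first by rewrite index_mem.
move=> j /andP[H1 H2]; have Hj : j < size l by apply: leq_ltn_trans H2 _; rewrite index_mem.
by apply: H; [exact: mem_nth | rewrite index_uniq // (minn_idPl Huv) (maxn_idPr Huv) H1].
Qed.

(** A robot standing on neither of two positions at distance at most one lies on the same side of
    both. *)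
Lemma step_cmp (o u v : nat) : v <= u.+1 -> u <= v.+1 -> o != u -> o != v ->
  ((o < u) = (o < v)) * ((u < o) = (v < o)).
Proof. by move=> H1 H2 N1 N2; split; apply/idP/idP; lia. Qed.

Section OnePath.
Variables (l : seq nat) (Q : seq nat) (phi : nat -> nat).
Local Notation pos v := (index v l).
Hypothesis l_uniq : uniq l.
Hypothesis l_chain : chain l.
Hypothesis lV : {subset l <= V}.
Hypothesis l_adj : forall u v, u \in l -> v \in l -> e u v -> pos v <= (pos u).+1.
Hypothesis phi_out : forall v, v \notin l -> phi v = v.
Hypothesis phi_in : forall v, v \in Q -> v \in l -> phi v \in l.
Hypothesis phi_mono : forall u v, u \in Q -> v \in Q -> u \in l -> v \in l -> pos u < pos v -> pos (phi u) < pos (phi v).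
(** Every exit from the path is mirrored by an exit to the same vertex in the corresponding gap
    between the images of the used positions. *)
Hypothesis phi_nbr : forall v f, v \in l -> f \notin l -> e v f -> exists z, [/\ z \in l, e z f &
  forall y, y \in Q -> y \in l -> (pos y < pos v -> pos (phi y) < pos z) /\ (pos v < pos y -> pos z < pos (phi y))].

Lemma phi_inj u v : u \in Q -> v \in Q -> phi u = phi v -> u = v.
Proof.
move=> Hu Hv E; case lu : (u \in l); case lv : (v \in l).
- case: (ltngtP (pos u) (pos v)) => H.
  + by have := phi_mono Hu Hv lu lv H; rewrite E ltnn.
  + by have := phi_mono Hv Hu lv lu H; rewrite E ltnn.
  + by rewrite -(nth_index 0 lu) H nth_index.
- by have := phi_in Hu lu; rewrite E phi_out ?lv.
- by have := phi_in Hv lv; rewrite -E phi_out ?lu.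
- by move: E; rewrite !phi_out ?lu ?lv.
Qed.

Lemma others_map c i : others (map phi c) i = map phi (others c i).
Proof.
rewrite /others size_map -map_comp; apply/eq_in_map => j.
by rewrite mem_filter mem_iota => /andP[_ Hj]; rewrite /= (nth_map 0).
Qed.

Lemma map_set_nth c i y : i < size c -> map phi (set_nth 0 c i y) = set_nth 0 (map phi c) i (phi y).
Proof.
move=> Hi; apply: (@eq_from_nth _ 0) => [|j].
  by rewrite size_map !size_set_nth size_map.
rewrite size_map => Hj; rewrite (nth_map 0) // !nth_set_nth /=; case: eqP => // _.
by rewrite (nth_map 0) //; move: Hj; rewrite size_set_nth (maxn_idPr Hi).
Qed.

(** Off the path the image of the moving robot follows it exactly. On the path only the gap between
    the other robots matters, because the image can move freely within the corresponding gap. *)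
Lemma phi_mv (Y Y' : nat -> bool) c d : uniq c -> {subset c <= Q} -> {subset d <= Q} ->
  (forall y, y \in Q -> Y y -> Y' (phi y)) -> mv e V Y c d -> mv e V Y' (map phi c) (map phi d).
Proof.
move=> U cQ dQ HY [i [y [Hi Ny Yy C Ed]]].
have yQ : y \in Q by apply: dQ; rewrite Ed; apply/(nthP 0); exists i;
  rewrite ?size_set_nth ?nth_set_nth /= ?eqxx // (maxn_idPr _).
set x := nth 0 c i in Ny C.
have xQ : x \in Q by apply/cQ/mem_nth.
have OQ o : o \in others c i -> o \in Q by case/othersP=> j [Hj _ ->]; apply/cQ/mem_nth.
exists i, (phi y); rewrite size_map (nth_map 0) // -/x; split=> //.
- by apply: contra Ny => /eqP /(phi_inj yQ xQ) ->.
- exact: HY.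
- set F' := free V (map phi c) i.
  (* [z] lies among the images of the other robots as [v] lies among these robots. All such [z] are
     free and joined along the path ([f1], [f2]), so the exact choice does not matter. *)
  pose sg v z := z \in l /\ forall o, o \in others c i -> o \in l ->
    (pos o < pos v -> pos (phi o) < pos z) /\ (pos v < pos o -> pos z < pos (phi o)).
  have f0 u : u \notin l -> free V c i u -> F' u.
    move=> Nu /andP[uV Fu]; rewrite /F' /free uV others_map; apply: contra Fu => /mapP[o Ho Eo].
    case lo : (o \in l); last by move: Eo; rewrite phi_out ?lo // => ->.
    by move: Nu; rewrite Eo phi_in // OQ.
  have f1 v z : v \in l -> v \notin others c i -> sg v z -> F' z.
    move=> Hv Fv [Hz Sz]; rewrite /F' /free lV // others_map; apply/mapP=> -[o Ho Eo].
    case lo : (o \in l); last by move: Hz; rewrite Eo phi_out ?lo.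
    have [S1 S2] := Sz o Ho lo.
    case: (ltngtP (pos o) (pos v)) => H; [by have := S1 H; rewrite Eo ltnn | by have := S2 H; rewrite Eo ltnn |].
    by move: Fv; rewrite -(nth_index 0 Hv) -H nth_index // Ho.
  have f2 v z1 z2 : v \in l -> v \notin others c i -> sg v z1 -> sg v z2 -> conn e F' z1 z2.
    move=> Hv Fv S1 S2; apply: (chain_conn2 l_chain) => //; [by case: S1 | by case: S2 |].
    move=> w Hw /andP[W1 W2]; apply: (f1 v) => //; split=> // o Ho lo.
    have [A1 A2] := S1.2 o Ho lo; have [B1 B2] := S2.2 o Ho lo; split=> H.
      by apply: leq_trans W1; rewrite leq_min A1 // B1.
    by apply: leq_ltn_trans W2 _; rewrite gtn_max A2 // B2.
  have f3 v f : v \in l -> f \notin l -> e v f -> exists2 z, sg v z & e z f.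
    move=> Hv Hf E; have [z [Hz Ez Sz]] := phi_nbr Hv Hf E.
    by exists z => //; split=> // o Ho lo; apply: Sz => //; apply: OQ.
  have f4 v : v \in Q -> v \in l -> sg v (phi v).
    move=> vQ Hv; split; first exact: phi_in.
    by move=> o Ho lo; split; apply: phi_mono => //; apply: OQ.
  pose Inv u := if u \in l then forall z, sg u z -> conn e F' (phi x) z else conn e F' (phi x) u.
  have Iy : Inv y.
    have {yQ Yy Ny Ed dQ} := C; elim=> [Fx|u v Cu Iu E Fv].
      have xF : x \notin others c i by case/andP: Fx.
      rewrite /Inv; case: ifP => [lx z Sz|lx]; last by rewrite phi_out ?lx //; apply: conn0; apply: f0; rewrite ?lx.
      by apply: (f2 x) => //; apply: f4.
    have /andP[_ Fu] := conn_r Cu; have /andP[_ Fv'] := Fv.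
    move: Iu; rewrite /Inv; case: ifP => lu; case: ifP => lv Iu.
    - move=> z [Hz Sz]; apply: Iu; split=> // o Ho lo.
      have [S1 S2] := Sz o Ho lo.
      have Euv := l_adj lu lv E; have Evu : pos u <= (pos v).+1 by apply: l_adj => //; rewrite esym.
      have Nou : pos o != pos u.
        by apply: contra Fu => /eqP H; rewrite -(nth_index 0 lu) -H nth_index.
      have Nov : pos o != pos v.
        by apply: contra Fv' => /eqP H; rewrite -(nth_index 0 lv) -H nth_index.
      by have K := step_cmp Euv Evu Nou Nov; split=> H; [apply: S1; rewrite -K.1 | apply: S2; rewrite -K.2].
    - have [|z Sz Ez] := f3 u v lu _ E; first by rewrite lv.
      by apply: (connS (Iu z Sz) Ez); apply: f0; rewrite ?lv.
    - move=> z Sz; have Evu : e v u by rewrite esym.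
      have [z' Sz' Ez'] := f3 v u lv (negbT lu) Evu.
      apply: (@conn_trans _ _ _ z'); last exact: (f2 v).
      by apply: (connS Iu); [rewrite esym | apply: (f1 v)].
    - by apply: (connS Iu E); apply: f0; rewrite ?lv.
  move: Iy; rewrite /Inv; case: ifP => ly; last by rewrite (phi_out (negbT ly)).
  by apply; apply: f4.
- by rewrite Ed map_set_nth.
Qed.

Lemma phi_steps (Y Y' : nat -> bool) n c d : uniq c -> {subset c <= V} -> {subset c <= Q} ->
  (forall y, Y y -> y \in Q) -> (forall y, y \in Q -> Y y -> Y' (phi y)) ->
  steps e V Y n c d -> steps e V Y' n (map phi c) (map phi d).
Proof.
move=> U cV cQ YQ HY H; elim: H U cV cQ => [c1|{}n {}c c1 c2 M _ IH] U cV cQ; first exact: steps0.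
have dQ : {subset c1 <= Q}.
  case: M => i [y [Hi _ Yy _ ->]] v /(nthP 0) [j]; rewrite size_set_nth nth_set_nth /= => Hj <-.
  by case: eqP => _; [apply: YQ | apply/cQ/mem_nth; move: Hj; rewrite (maxn_idPr Hi)].
apply: stepsS (phi_mv U cQ dQ HY M) _.
by apply: IH => //; [apply: uniq_mv M U | apply: sub_mv M cV].
Qed.

End OnePath.

Lemma steps_used (Y : nat -> bool) n c d : steps e V Y n c d ->
  exists Q, [/\ size Q <= size c + n, {subset c <= Q} & steps e V (fun v => (v \in Q) && Y v) n c d].
Proof.
elim=> [c1|m a b g M _ [Q [SQ bQ H]]].
  by exists c1; split=> //; [rewrite addn0 | apply: steps0].
have Sb := size_mv M.
case: M => i [y [Hi Ny Yy C Eb]].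
exists (nth 0 a i :: Q); split.
- by rewrite /= addnS ltnS -Sb.
- move=> v /(nthP 0) [j Hj <-]; rewrite inE; case: (j =P i) => [->|/eqP N]; first by rewrite eqxx.
  apply/orP; right; apply: bQ; apply/(nthP 0); exists j; first by rewrite Sb.
  by rewrite Eb nth_set_nth /= (negbTE N).
- have Mono : forall y, (y \in Q) && Y y -> (y \in nth 0 a i :: Q) && Y y.
    by move=> z /andP[z1 z2]; rewrite inE z1 z2 orbT.
  apply: (@stepsS _ _ _ _ _ b).
    exists i, y; split=> //; rewrite Yy andbT inE; apply/orP; right; apply: bQ.
    by rewrite Eb; apply/(nthP 0); exists i; rewrite ?size_set_nth ?nth_set_nth /= ?eqxx // (maxn_idPr _).
  elim: H => [c1|q c1 c2 c3 [j [z [Hj Nz Yz Cz Ez]]] _ IH]; first exact: steps0.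
  by apply: stepsS IH; exists j, z; split=> //; apply: Mono.
Qed.

End Paths.

(** * Greedy parking positions on a path *)

Fixpoint subs (s : seq nat) : seq (seq nat) :=
  if s is x :: s' then [seq x :: t | t <- subs s'] ++ subs s' else [:: [::]].

Lemma size_subs s : size (subs s) = 2 ^ size s.
Proof. by elim: s => //= x s IH; rewrite size_cat size_map IH expnS mul2n addnn. Qed.

Lemma filter_subs (p : pred nat) s : filter p s \in subs s.
Proof.
elim: s => //= x s IH; case: (p x); rewrite mem_cat ?IH ?orbT //.
by apply/orP; left; apply: map_f.
Qed.

Section Greedy.
Variables (e : rel nat) (F : seq nat).

Definition typ v := [seq f <- F | e v f].
Definition seen (s : seq nat) := [seq f <- F | has (fun v => e v f) s].
(** The second comparison concerns the gap that a choice would close: it must offer the same exits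
    to [F], since robots may pass through it. *)
Definition same_sig s i j :=
  (typ (nth 0 s i) == typ (nth 0 s j)) && (seen (take i s) == seen (take j s)).
Definition fresh s i := all (fun j => ~~ same_sig s j i) (iota 0 i).
Definition nexts s := [seq drop i s | i <- iota 0 (size s) & fresh s i].

(* The elements of [glev n l] are suffixes of [l] (after the dummy head of
   level 0); their heads are the positions reached by n greedy steps. *)
Fixpoint glev (n : nat) (l : seq nat) : seq (seq nat) :=
  if n is n'.+1 then flatten [seq nexts (behead s) | s <- glev n' l] else [:: 0 :: l].

(** A fresh position is determined by its signature, which is a pair of subsets of [F]. *)
Lemma size_nexts s : size (nexts s) <= (2 ^ size F) * (2 ^ size F).
Proof.
rewrite size_map; set I := filter _ _.
pose sg i := (typ (nth 0 s i), seen (take i s)).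
have UI : uniq I by rewrite filter_uniq // iota_uniq.
have Inj : {in I &, injective sg}.
  move=> i j; rewrite !mem_filter !mem_iota => /andP[Fi _] /andP[Fj _] [E1 E2].
  case: (ltngtP i j) => // H.
  - by have := allP Fj i; rewrite mem_iota H => /(_ isT); rewrite /same_sig E1 E2 !eqxx.
  - by have := allP Fi j; rewrite mem_iota H => /(_ isT); rewrite /same_sig E1 E2 !eqxx.
have U : uniq (map sg I) by rewrite map_inj_in_uniq.
rewrite -(size_map sg) -size_subs -(size_allpairs pair); apply: (uniq_leq_size U).
by move=> _ /mapP[i _ ->]; apply: allpairs_f; apply: filter_subs.
Qed.

Lemma size_glev n l : size (glev n l) <= ((2 ^ size F) * (2 ^ size F)) ^ n.
Proof.
elim: n => //= n IH; rewrite size_flatten expnSr.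
apply: leq_trans (_ : size (glev n l) * (2 ^ size F * 2 ^ size F) <= _); last by rewrite leq_mul2r IH orbT.
elim: (glev n l) => //= s r IHr; rewrite mulSn; apply: leq_add => //; exact: size_nexts.
Qed.

Lemma fresh_exists s i0 : i0 < size s -> exists i, [/\ i <= i0, fresh s i & same_sig s i i0].
Proof.
elim/ltn_ind: i0 => i0 IH Hi0.
case Fr : (fresh s i0); first by exists i0; rewrite leqnn /same_sig !eqxx.
have [j] : exists2 j, j \in iota 0 i0 & same_sig s j i0.
  by apply/hasP; move: Fr; rewrite /fresh all_predC => /negbFE.
rewrite mem_iota => /andP[_ Hj] /andP[/eqP S1 /eqP S2].
have [i [Li Fi /andP[/eqP S3 /eqP S4]]] := IH j Hj (ltn_trans Hj Hi0).
exists i; split=> //; first by apply: ltnW; apply: leq_ltn_trans Li Hj.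
by rewrite /same_sig S3 S4 S1 S2 !eqxx.
Qed.

Lemma index_drop (s1 : seq nat) x s2 z : uniq (s1 ++ x :: s2) -> z \in s2 ->
  index z (s1 ++ x :: s2) = size s1 + (index z s2).+1.
Proof.
rewrite cat_uniq /= => /and3P[_ /norP[_ /hasPn H] /andP[Nx _]] Hz.
rewrite index_cat (negbTE (H z Hz)) /=; congr (_ + _).
by case: eqP => // E; move: Nx; rewrite E Hz.
Qed.

Lemma lt_addS a k : a < a + k.+1.
Proof. by rewrite addnS ltnS leq_addr. Qed.

Lemma nlt_addS a k : (a + k.+1 < a) = false.
Proof. by rewrite ltnNge leq_addr. Qed.

Lemma index_mid (s1 : seq nat) x s2 : uniq (s1 ++ x :: s2) -> index x (s1 ++ x :: s2) = size s1.
Proof.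
rewrite cat_uniq /= => /and3P[_ /norP[Nx _] _].
by rewrite index_cat (negbTE Nx) /= eqxx addn0.
Qed.

Lemma index_left (s1 : seq nat) x s2 z : z \in s1 -> index z (s1 ++ x :: s2) = index z s1 /\ index z s1 < size s1.
Proof. by move=> Hz; rewrite index_cat Hz index_mem. Qed.

Definition phi_spec (s t ys : seq nat) (X : nat -> Prop) (phi : nat -> nat) :=
  [/\ forall y, y \in ys -> phi y \in s /\ X (phi y),
      forall y y', y \in ys -> y' \in ys -> index y t < index y' t -> index (phi y) s < index (phi y') s
    & forall v f, v \in t -> f \in F -> e v f -> exists z, [/\ z \in s, e z f &
        forall y, y \in ys -> (index y t < index v t -> index (phi y) s < index z s) /\
                              (index v t < index y t -> index z s < index (phi y) s)]].

(** The greedy choice never lies behind the position that it replaces. What is left for it, [s], is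
    therefore the rest [t] of the original path, preceded by the vertices [g] that were saved so
    far. *)
Lemma greedy_ind l ys : forall n g s t, (exists2 r, r \in glev n l & behead r = s) -> s = g ++ t -> uniq s ->
  subseq ys t ->
  exists phi, phi_spec s t ys (fun z => exists m r, [/\ 0 < m, m <= n + size ys, r \in glev m l & head 0 r = z]) phi.
Proof.
elim: ys => [|y ys IH] n g s t [r Hr Er] Es Us Sub.
  exists id; split=> // v f Hv Hf E; exists v; split=> //.
  by rewrite Es mem_cat Hv orbT.
have [a [b [Et Sb]]] : exists a b, t = a ++ y :: b /\ subseq ys b.
  elim: t Sub {Es} => [//|x t IHt] /=; case: eqP => [->|_] H; first by exists [::], t.
  by have [a [b [-> Hb]]] := IHt H; exists (x :: a), b.
pose i0 := size (g ++ a).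
have Es' : s = (g ++ a) ++ y :: b by rewrite Es Et catA.
have Hi0 : i0 < size s by rewrite Es' size_cat -/i0 /= addnS ltnS leq_addr.
have [i [Li Fi /andP[/eqP Sg1 /eqP Sg2]]] := fresh_exists Hi0.
have Hi : i < size s := leq_ltn_trans Li Hi0.
have Ny : nth 0 s i0 = y by rewrite Es' nth_cat /i0 ltnn subnn.
have Ty : take i0 s = g ++ a by rewrite Es' take_size_cat.
rewrite Ny Ty in Sg1 Sg2.
pose x := nth 0 s i; rewrite -/x in Sg1.
pose s1 := take i s; rewrite -/s1 in Sg2; pose s2 := drop i.+1 s.
have Ex : s = s1 ++ x :: s2 by rewrite /s1 /x /s2 -drop_nth ?cat_take_drop.
have Ss1 : size s1 = i by rewrite size_takel // ltnW.
have [g' Eg'] : exists g', s2 = g' ++ b.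
  exists (take (i0 - i) s2); rewrite -{1}(cat_take_drop (i0 - i) s2); congr (_ ++ _).
  rewrite /s2 drop_drop addnS subnK //.
  by rewrite Es' -cat_rcons drop_size_cat // size_rcons.
have Us2 : uniq s2 by rewrite /s2 drop_uniq.
have Hr2 : drop i s \in glev n.+1 l.
  apply/flattenP; exists (nexts (behead r)); first by apply: map_f.
  by rewrite Er; apply/mapP; exists i => //; rewrite mem_filter Fi mem_iota.
have [|phi [P1 P2 P3]] := IH n.+1 g' s2 b _ Eg' Us2 Sb.
  by exists (drop i s) => //; rewrite (drop_nth 0).
have Ut : uniq t by move: Us; rewrite Es cat_uniq => /and3P[].
rewrite Et in Ut.
have Nyb : y \notin b by move: Ut; rewrite cat_uniq /= => /and3P[_ _ /andP[]].
have Nyys : y \notin ys by apply: contra Nyb => /(mem_subseq Sb).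
have ysb : {subset ys <= b} by apply: mem_subseq.
have Usx : uniq (s1 ++ x :: s2) by rewrite -Ex.
have s2s z : z \in s2 -> z \in s by rewrite Ex mem_cat inE => ->; rewrite !orbT.
have ix2 z : z \in s2 -> index z s = size s1 + (index z s2).+1.
  by move=> Hz; rewrite {1}Ex index_drop.
have ixx : index x s = size s1 by rewrite Ex index_mid.
have it2 z : z \in b -> index z t = size a + (index z b).+1.
  by move=> Hz; rewrite Et index_drop.
have ity : index y t = size a by rewrite Et index_mid.
pose psi v := if v == y then x else phi v.
have psiy : psi y = x by rewrite /psi eqxx.
have psib v : v \in ys -> psi v = phi v.
  by move=> Hv; rewrite /psi; case: eqP => // E; move: Nyys; rewrite -E Hv.
exists psi; split.
- move=> v; rewrite inE => /orP[/eqP->|Hv].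
    rewrite psiy; split; first by rewrite mem_nth.
    exists n.+1, (drop i s); split=> //; first by rewrite /= addnS ltnS leq_addr.
    by rewrite (drop_nth 0).
  rewrite psib //; have [H1 [m [r' [m1 m2 m3 m4]]]] := P1 v Hv.
  by split; [apply: s2s | exists m, r'; split=> //; rewrite /= addnS -addSn].
- move=> u v; rewrite !inE => /orP[/eqP->|Hu] /orP[/eqP->|Hv].
  + by rewrite ltnn.
  + by move=> _; rewrite psiy psib // ixx ix2 ?(P1 v Hv).1 // lt_addS.
  + by rewrite ity it2 ?ysb // nlt_addS.
  + rewrite !psib // !it2 ?ysb // !ix2 ?(P1 u Hu).1 ?(P1 v Hv).1 // !ltn_add2l !ltnS.
    exact: P2.
- move=> v f; rewrite {1}Et mem_cat inE => /or3P[Hv|/eqP->|Hv] Hf E.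
  (* Here [v] lies in the gap before [y]. Its exit [f] is seen from [g ++ a], hence also from [s1],
     the gap before the greedy choice. *)
  + have [z Hz Ez] : exists2 z, z \in s1 & e z f.
      have : f \in seen s1 by rewrite Sg2 mem_filter Hf andbT; apply/hasP; exists v => //; rewrite mem_cat Hv orbT.
      by rewrite mem_filter => /andP[/hasP].
    have [I1 I2] := @index_left s1 x s2 z Hz.
    have [J1 J2] := @index_left a y b v Hv.
    rewrite -Ex in I1; rewrite -Et in J1.
    exists z; split=> //; first by rewrite Ex mem_cat Hz.
    move=> u; rewrite inE => /orP[/eqP->|Hu].
      by rewrite psiy ity ixx I1 J1 I2; split=> // H; move: H; rewrite ltnNge (ltnW J2).
    rewrite psib // it2 ?ysb // ix2 ?(P1 u Hu).1 // I1 J1; split=> H; last exact: ltn_addr.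
    by move: (leq_ltn_trans (leq_addr _ _) H); rewrite ltnNge (ltnW J2).
  + exists x; split; first by rewrite mem_nth.
      have : f \in typ x by rewrite Sg1 mem_filter Hf E.
      by rewrite mem_filter => /andP[].
    move=> u; rewrite inE => /orP[/eqP->|Hu]; first by rewrite !ltnn.
    by rewrite psib // it2 ?ysb // ity ixx ix2 ?(P1 u Hu).1 // nlt_addS; split=> // _; exact: lt_addS.
  + have [z [Hz Ez Sz]] := P3 v f Hv Hf E.
    exists z; split=> //; first exact: s2s.
    move=> u; rewrite inE => /orP[/eqP->|Hu].
      by rewrite psiy (it2 v Hv) ity ixx (ix2 z Hz) nlt_addS; split=> // _; exact: lt_addS.
    rewrite psib // (it2 v Hv) (it2 u (ysb _ Hu)) (ix2 z Hz) (ix2 _ (P1 u Hu).1) !ltn_add2l !ltnS.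
    exact: Sz.
Qed.

Lemma greedy_phi l Q : uniq l -> exists phi, [/\ forall v, v \notin l -> phi v = v,
   forall y, y \in Q -> y \in l -> phi y \in l /\ exists m r, [/\ 0 < m, m <= size Q, r \in glev m l & head 0 r = phi y],
   forall y y', y \in Q -> y' \in Q -> y \in l -> y' \in l -> index y l < index y' l -> index (phi y) l < index (phi y') l
 & forall v f, v \in l -> f \in F -> e v f -> exists z, [/\ z \in l, e z f & forall y, y \in Q -> y \in l ->
    (index y l < index v l -> index (phi y) l < index z l) /\ (index v l < index y l -> index z l < index (phi y) l)]].
Proof.
move=> U; pose ys := [seq y <- l | y \in Q].
have Hys y : (y \in ys) = (y \in Q) && (y \in l) by rewrite mem_filter.
have [|phi [P1 P2 P3]] := @greedy_ind l ys 0 [::] l l _ erefl U (filter_subseq _ _).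
  by exists (0 :: l); rewrite ?inE.
exists (fun v => if v \in l then phi v else v); split.
- by move=> v /negbTE ->.
- move=> y yQ yl; rewrite yl; have [|H [m [r [m1 m2 m3 m4]]]] := P1 y; first by rewrite Hys yQ.
  split=> //; exists m, r; split=> //; apply: leq_trans m2 _; rewrite add0n.
  by apply: uniq_leq_size; [apply: filter_uniq | move=> z; rewrite Hys => /andP[]].
- by move=> y y' yQ y'Q yl y'l; rewrite yl y'l; apply: P2; rewrite Hys ?yQ ?y'Q.
- move=> v f vl fF E; have [z [Hz Ez Sz]] := P3 v f vl fF E; exists z; split=> // y yQ yl.
  by rewrite yl; apply: Sz; rewrite Hys yQ.
Qed.

End Greedy.

(** * Shortest schedules are short *)

Fixpoint words (T : Type) (n : nat) (J : seq T) : seq (seq T) :=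
  if n is n'.+1 then flatten [seq [seq x :: w | w <- words n' J] | x <- J] else [:: [::]].

Lemma size_words (T : Type) n (J : seq T) : size (words n J) = size J ^ n.
Proof.
elim: n => //= n IH; rewrite expnS -IH size_flatten /shape -map_comp.
by elim: J {IH} (words n J) => //= x J IHJ w; rewrite IHJ size_map mulSn.
Qed.

Lemma mem_words (T : eqType) n (J : seq T) s : (s \in words n J) = (size s == n) && all (fun x => x \in J) s.
Proof.
elim: n s => [|n IH] s /=; first by rewrite inE; case: s.
apply/flatten_mapP/andP => [[x Hx /mapP[w]]|].
  by rewrite IH => /andP[/eqP Sw Aw] ->; rewrite /= Sw Hx.
case: s => [|x w] [] //= Sw /andP[Hx Aw]; exists x => //; apply: map_f.
by rewrite IH -eqSS Sw.
Qed.

Lemma ex_max (f : nat -> nat) s : s != [::] -> exists2 i, i \in s & forall j, j \in s -> f j <= f i.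
Proof.
elim: s => // a s IH _; case: (s =P [::]) => [->|/eqP /IH [i Hi M]].
  by exists a; rewrite ?inE // => j; rewrite inE => /eqP->.
case: (leqP (f a) (f i)) => H.
  by exists i => [|j]; rewrite inE ?Hi ?orbT // => /orP[/eqP->|/M].
exists a => [|j]; rewrite inE ?eqxx // => /orP[/eqP->|/M Hj] //.
exact: leq_trans Hj (ltnW H).
Qed.

Lemma others_set c i y : i < size c -> others (set_nth 0 c i y) i = others c i.
Proof.
move=> Hi; rewrite /others size_set_nth (maxn_idPr Hi); apply/eq_in_map => j.
by rewrite mem_filter nth_set_nth /= => /andP[/negbTE ->].
Qed.

Section Short.
Variables (e : rel nat) (V : seq nat).
Hypothesis e_sym : symmetric e.

Lemma mv_rev (Y : nat -> bool) c d : {subset c <= Y} -> mv e V Y c d -> mv e V Y d c.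
Proof.
move=> cY [i [y [Hi Ny Yy C ->]]]; have S : size (set_nth 0 c i y) = size c.
  by rewrite size_set_nth; apply/maxn_idPr.
have E : free V (set_nth 0 c i y) i =1 free V c i by move=> v; rewrite /free others_set.
exists i, (nth 0 c i); rewrite S nth_set_nth /= eqxx eq_sym; split=> //.
- exact/cY/mem_nth.
- by apply: conn_sym => //; apply: conn_mono C => v; rewrite E.
- apply: (@eq_from_nth _ 0) => [|j _]; first by rewrite size_set_nth S; apply/esym/maxn_idPr.
  by rewrite !nth_set_nth /= nth_set_nth /=; case: (j =P i) => [->|].
Qed.

Variables (WS : seq (seq nat)) (F : seq nat) (Y : nat -> bool) (k : nat).
Local Notation W := (flatten WS).
Local Notation idx v := (index v W).
Hypothesis W_uniq : uniq W.
Hypothesis W_chain : forall l, l \in WS -> chain e l.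
Hypothesis WV : {subset W <= V}.
Hypothesis WY : {subset W <= Y}.
Hypothesis YF : forall v, Y v -> (v \in F) || (v \in W).

Definition pid v := find (fun l : seq nat => v \in l) WS.

Lemma pid_split v : v \in W -> exists l1 l l2, [/\ WS = l1 ++ l :: l2, size l1 = pid v & v \in l].
Proof.
move=> /flattenP[l0 Hl0 Hv]; have Hh : has (fun l : seq nat => v \in l) WS by apply/hasP; exists l0.
have Hp : pid v < size WS by rewrite -has_find.
exists (take (pid v) WS), (nth [::] WS (pid v)), (drop (pid v).+1 WS).
by rewrite -drop_nth // cat_take_drop size_takel ?(ltnW Hp) // (nth_find [::] Hh).
Qed.

Lemma conn_between (A : nat -> bool) u v : u \in W -> v \in W -> pid u = pid v ->
  (forall w, w \in W -> minn (idx u) (idx v) <= idx w <= maxn (idx u) (idx v) -> A w) -> conn e A u v.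
Proof.
move=> /pid_split [l1 [l [l2 [E S Hu]]]] /pid_split [l1' [l' [l2' [E' S' Hv]]]] Ep H.
have [_ El] : l1 = l1' /\ l = l'.
  have := E'; rewrite E => /eqP; rewrite eqseq_cat ?S ?S' ?Ep // => /andP[/eqP-> /eqP[-> _]].
  by [].
rewrite -El in Hv.
have EW : W = flatten l1 ++ (l ++ flatten l2) by rewrite E flatten_cat.
have UW := W_uniq; rewrite EW cat_uniq cat_uniq in UW.
case/and3P: UW => _ /hasPn Hn /and3P[Ul _ _].
have ix w : w \in l -> idx w = size (flatten l1) + index w l.
  move=> Hw; rewrite EW index_cat (negbTE (Hn w _)) ?mem_cat ?Hw //.
  by rewrite index_cat Hw.
apply: (chain_conn2 e_sym (l := l)) => //; first by apply: W_chain; rewrite E mem_cat inE eqxx orbT.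
move=> w Hw Iw; apply: H; first by rewrite EW !mem_cat Hw orbT.
by rewrite !ix // -addn_minr -addn_maxr !leq_add2l.
Qed.

(** Such configurations differ by a shift along the paths. The single index into the concatenation
    of the paths also compares robots on different paths, whose order is fixed by the paths. *)
Definition compat P Q := [/\ size Q = size P,
  forall i, i < size P -> if nth 0 P i \in W then (nth 0 Q i \in W) /\ pid (nth 0 Q i) = pid (nth 0 P i)
                          else nth 0 Q i = nth 0 P i
  & forall i j, i < size P -> j < size P -> nth 0 P i \in W -> nth 0 P j \in W ->
      (idx (nth 0 P i) < idx (nth 0 P j)) = (idx (nth 0 Q i) < idx (nth 0 Q j))].

Lemma compat_W P Q i : compat P Q -> i < size P -> (nth 0 P i \in W) = (nth 0 Q i \in W).
Proof. by case=> _ C _ Hi; have := C i Hi; case: ifP => [_ [-> _]|N ->]; rewrite ?N. Qed.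

Lemma compat_sym P Q : compat P Q -> compat Q P.
Proof.
move=> C; have [S C1 C2] := C; split; rewrite ?S //.
- by move=> i Hi; rewrite -(compat_W C Hi); have := C1 i Hi; case: ifP => // _ [_ ->].
- by move=> i j Hi Hj; rewrite -!(compat_W C) // => Wi Wj; rewrite C2.
Qed.

Lemma idx_inj u v : u \in W -> idx u = idx v -> u = v.
Proof.
move=> Hu E; have Hv : v \in W by rewrite -index_mem -E index_mem.
by rewrite -(nth_index 0 Hu) E nth_index.
Qed.

(** Among the robots that have to go forward, the foremost can go to its goal directly: since the
    orders agree, a robot in its way would have to go forward as well and stand further ahead. *)
Lemma mover P Q i0 : uniq P -> uniq Q -> compat P Q -> i0 < size P -> nth 0 P i0 \in W ->
  idx (nth 0 P i0) < idx (nth 0 Q i0) ->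
  exists i, [/\ i < size P, nth 0 P i != nth 0 Q i, mv e V Y P (set_nth 0 P i (nth 0 Q i))
    & compat (set_nth 0 P i (nth 0 Q i)) Q].
Proof.
move=> UP UQ C Hi0 Wi0 L0; have [S C1 C2] := C.
pose M := [seq i <- iota 0 (size P) | (nth 0 P i \in W) && (idx (nth 0 P i) < idx (nth 0 Q i))].
have MP i : (i \in M) = [&& nth 0 P i \in W, idx (nth 0 P i) < idx (nth 0 Q i) & i < size P].
  by rewrite mem_filter mem_iota -andbA.
have [|i] := @ex_max (fun i => idx (nth 0 P i)) M.
  by apply/negP=> /eqP E; have := MP i0; rewrite E Wi0 L0 Hi0.
rewrite MP => /and3P[Wi Li Hi] Mx; exists i.
set x := nth 0 P i in Wi Li Mx *; set y := nth 0 Q i in Li *.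
have [Wy Py] : (y \in W) /\ pid y = pid x by have := C1 i Hi; rewrite Wi.
have Nxy : x != y by apply: contraTneq Li => ->; rewrite ltnn.
have Free j : j < size P -> j != i -> nth 0 P j \in W -> idx x < idx (nth 0 P j) -> idx y < idx (nth 0 P j).
  move=> Hj Nj Wj Lj; rewrite ltnNge; apply/negP=> Gj.
  have Lq : idx y < idx (nth 0 Q j) by rewrite -C2.
  have Mj : j \in M by rewrite MP Wj Hj (leq_ltn_trans Gj Lq).
  by have := Mx j Mj; rewrite leqNgt Lj.
have Cxy : conn e (free V P i) x y.
  apply: conn_between => // w Hw; rewrite (minn_idPl (ltnW Li)) (maxn_idPr (ltnW Li)) => /andP[L1 L2].
  rewrite /free WV //; apply/othersP=> -[j [Hj Nj Ew]].
  have Nwx : w != x by rewrite Ew nth_uniq.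
  have Lw : idx x < idx w.
    by rewrite ltn_neqAle L1 andbT; apply: contra Nwx => /eqP /(idx_inj Wi) ->.
  by have := Free j Hj Nj; rewrite -Ew => /(_ Hw Lw); rewrite ltnNge L2.
have Sz : size (set_nth 0 P i y) = size P by rewrite size_set_nth; apply/maxn_idPr.
split=> //.
- by exists i, y; split=> //; [rewrite eq_sym | apply: WY].
- split; rewrite ?Sz //.
  + move=> j Hj; rewrite nth_set_nth /=; case: eqP => [->|_]; first by rewrite Wy.
    exact: C1.
  + have Cmp j : j < size P -> j != i -> nth 0 P j \in W ->
      (idx y < idx (nth 0 P j)) = (idx y < idx (nth 0 Q j)) /\
      (idx (nth 0 P j) < idx y) = (idx (nth 0 Q j) < idx y).
      move=> Hj Nj Wj; have C3 := C2 i j Hi Hj Wi Wj; have C4 := C2 j i Hj Hi Wj Wi.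
      rewrite -/x -/y in C3 C4; rewrite -C3 -C4.
      case: (ltngtP (idx x) (idx (nth 0 P j))) => H.
      - have K := Free j Hj Nj Wj H; rewrite K; split=> //.
        by apply/negbTE; rewrite -leqNgt ltnW.
      - have K := ltn_trans H Li; rewrite K; split=> //.
        by apply/negbTE; rewrite -leqNgt ltnW.
      - by move/(idx_inj Wi)/eqP: H; rewrite nth_uniq // eq_sym (negbTE Nj).
    move=> a b Ha Hb; rewrite !nth_set_nth /=.
    case: (a =P i) => [->|/eqP Na]; case: (b =P i) => [->|/eqP Nb] //.
    * by move=> _ Wb; have [-> _] := Cmp b Hb Nb Wb.
    * by move=> Wa _; have [_ ->] := Cmp a Ha Na Wa.
    * exact: C2.
Qed.

Definition ndiff P Q := count (fun i => nth 0 P i != nth 0 Q i) (iota 0 (size P)).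

Lemma ndiff_sym P Q : size Q = size P -> ndiff P Q = ndiff Q P.
Proof. by move=> S; rewrite /ndiff S; apply: eq_count => i; rewrite eq_sym. Qed.

Lemma ndiff_set P Q i : i < size P -> nth 0 P i != nth 0 Q i ->
  (ndiff (set_nth 0 P i (nth 0 Q i)) Q).+1 = ndiff P Q.
Proof.
move=> Hi Ni; have Sz : size (set_nth 0 P i (nth 0 Q i)) = size P by rewrite size_set_nth; apply/maxn_idPr.
have Ui := iota_uniq 0 (size P); have Mi : i \in iota 0 (size P) by rewrite mem_iota.
rewrite /ndiff Sz !(count_del _ Ui Mi) Ni nth_set_nth /= eqxx eqxx add0n add1n; congr _.+1.
apply: eq_in_count => j; rewrite mem_del nth_set_nth /= => /andP[/negbTE -> _].
by [].
Qed.

(** Every robot moves at most once. A robot that has to go back is treated at the other end of the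
    schedule, as the reverse of a forward move from [Q]. *)
Lemma slide n P Q : uniq P -> uniq Q -> {subset P <= Y} -> {subset Q <= Y} -> compat P Q -> ndiff P Q <= n ->
  exists2 m, m <= n & steps e V Y m P Q.
Proof.
have SubSet A B i : {subset A <= Y} -> {subset B <= Y} -> i < size A -> i < size B -> {subset set_nth 0 A i (nth 0 B i) <= Y}.
  move=> HA HB Hi Hi' v /(nthP 0) [j]; rewrite size_set_nth (maxn_idPr Hi) nth_set_nth /= => Hj <-.
  by case: eqP => _; [apply/HB/mem_nth | apply/HA/mem_nth].
elim: n P Q => [|n IH] P Q UP UQ YP YQ C; have [S C1 C2] := C.
  rewrite leqn0 => /eqP D0; exists 0 => //.
  have -> : Q = P; last exact: steps0.
  apply: (@eq_from_nth _ 0) => // i; rewrite S => Hi.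
  apply/eqP/negPn/negP=> Ni; have : has (fun i => nth 0 P i != nth 0 Q i) (iota 0 (size P)).
    by apply/hasP; exists i; rewrite ?mem_iota // eq_sym.
  by rewrite has_count -/(ndiff P Q) D0.
move=> Dn; case Df : (has (fun i => nth 0 P i != nth 0 Q i) (iota 0 (size P))); last first.
  have D0 : ndiff P Q <= n by move: Df; rewrite has_count -/(ndiff P Q); case: (ndiff P Q).
  by have [m Lm H] := IH P Q UP UQ YP YQ C D0; exists m => //; apply: leqW.
case/hasP: Df => i0; rewrite mem_iota /= => Hi0 Ni0.
have Wi0 : nth 0 P i0 \in W.
  by apply/negPn/negP=> N; have := C1 i0 Hi0; rewrite (negbTE N) => E; rewrite E eqxx in Ni0.
have Wq0 : nth 0 Q i0 \in W by rewrite -(compat_W C Hi0).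
case: (ltngtP (idx (nth 0 P i0)) (idx (nth 0 Q i0))) => H.
- have [i [Hi Ni M C']] := mover UP UQ C Hi0 Wi0 H.
  have [||m Lm St] := IH _ Q (uniq_mv M UP) UQ _ YQ C'.
  + by apply: SubSet => //; rewrite S.
  + by rewrite -ltnS ndiff_set.
  by exists m.+1 => //; apply: stepsS M St.
- have Hi0' : i0 < size Q by rewrite S.
  have [i [Hi Ni M C']] := mover UQ UP (compat_sym C) Hi0' Wq0 H.
  have SQ : {subset set_nth 0 Q i (nth 0 P i) <= Y} by apply: SubSet => //; rewrite -S.
  have Sz : size (set_nth 0 Q i (nth 0 P i)) = size P by rewrite (size_mv M).
  have [|m Lm St] := IH P _ UP (uniq_mv M UQ) YP SQ (compat_sym C').
  + by rewrite ndiff_sym // -ltnS ndiff_set // -ndiff_sym.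
  exists m.+1 => //; rewrite -addn1; apply: steps_trans St _.
  exact: stepsS (mv_rev YQ M) (steps0 _ _ _ _).
- by move/(idx_inj Wi0)/eqP: H; rewrite (negbTE Ni0).
Qed.

Definition rank c v := count (fun u => (u \in W) && (idx u < idx v)) c.
(** A robot on a path is recorded by its path and its rank among the robots on all paths, so that
    equal labels mean a mere shift. The second component is zero exactly for the robots off the
    paths. *)
Definition lab c := [seq if v \in W then (pid v, (rank c v).+1) else (v, 0) | v <- c].
Definition items := [seq (v, 0) | v <- F] ++ [seq (p, r.+1) | p <- iota 0 (size WS), r <- iota 0 k].

Lemma size_items : size items = size F + size WS * k.
Proof. by rewrite size_cat size_map size_allpairs !size_iota. Qed.

Lemma rank_lt c u v : u \in c -> u \in W -> v \in W -> (idx u < idx v) = (rank c u < rank c v).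
Proof.
move=> Hc Wu Wv; case: (ltnP (idx u) (idx v)) => H; apply/esym.
  apply: leq_trans (_ : rank c u + count (pred1 u) c <= _).
    by rewrite -addn1 leq_add2l -has_count has_pred1.
  rewrite /rank -count_predUI [X in _ + X](_ : _ = 0) ?addn0.
    apply: sub_count => z /orP[/andP[-> Hz]|/eqP->] /=; last by rewrite Wu.
    exact: ltn_trans Hz H.
  rewrite -(count_pred0 c); apply: eq_count => z /=.
  by case: (z =P u) => [->|]; rewrite ?ltnn ?andbF.
apply/negbTE; rewrite -leqNgt; apply: sub_count => z /andP[-> Hz] /=.
exact: leq_trans Hz H.
Qed.

Lemma rank_size c v : v \in c -> rank c v < size c.
Proof.
move=> Hv; rewrite -(count_predC (fun u => (u \in W) && (idx u < idx v))) -[ltnLHS]addn0 ltn_add2l -has_count.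
by apply/hasP; exists v => //=; rewrite ltnn andbF.
Qed.

Lemma lab_compat P Q : lab P = lab Q -> compat P Q.
Proof.
move=> E; have S : size P = size Q by rewrite -(size_map (fun v => if v \in W then (pid v, (rank P v).+1) else (v, 0)) P) -/(lab P) E size_map.
have N i : i < size P -> (if nth 0 P i \in W then (pid (nth 0 P i), (rank P (nth 0 P i)).+1) else (nth 0 P i, 0))
   = (if nth 0 Q i \in W then (pid (nth 0 Q i), (rank Q (nth 0 Q i)).+1) else (nth 0 Q i, 0)).
  move=> Hi; have := congr1 (fun s => nth (0, 0) s i) E.
  by rewrite !(nth_map 0) // -S.
split=> //.
- by move=> i /N; case: ifP; case: ifP => // _ _ [].
- move=> i j Hi Hj Wi Wj; have := N i Hi; have := N j Hj; rewrite Wi Wj.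
  case: ifP => // Qj [_ Rj]; case: ifP => // Qi [_ Ri].
  by rewrite (@rank_lt P) ?mem_nth // (@rank_lt Q) ?mem_nth -?S // Ri Rj.
Qed.

Lemma lab_words c : size c = k -> {subset c <= Y} -> lab c \in words k items.
Proof.
move=> S cY; rewrite mem_words size_map S eqxx; apply/allP=> _ /mapP[v Hv ->].
rewrite mem_cat; case: ifP => Wv; apply/orP.
  right; apply/allpairsP; exists (pid v, rank c v); rewrite !mem_iota /= !add0n; split=> //.
    by rewrite -has_find; case/flattenP: Wv => l Hl Hvl; apply/hasP; exists l.
  by rewrite -S rank_size.
by left; apply: map_f; have := YF (cY _ Hv); rewrite Wv orbF.
Qed.

Inductive stepsL (La : seq (seq (nat * nat))) : nat -> seq nat -> seq nat -> Prop :=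
  | stepsL0 c : lab c \in La -> stepsL La 0 c c
  | stepsLS n c c1 c2 : lab c \in La -> mv e V Y c c1 -> stepsL La n c1 c2 -> stepsL La n.+1 c c2.

Lemma stepsL_l La n c d : stepsL La n c d -> lab c \in La.
Proof. by case. Qed.

Definition good c := [/\ uniq c, {subset c <= V}, {subset c <= Y} & size c = k].

Lemma good_mv c d : good c -> mv e V Y c d -> good d.
Proof.
case=> U SV SY S M; split; [exact: uniq_mv M U | exact: sub_mv M SV | | by rewrite (size_mv M)].
case: M => i [y [Hi _ Yy _ ->]] v /(nthP 0) [j]; rewrite size_set_nth nth_set_nth /= => Hj <-.
by case: eqP => // _; apply/SY/mem_nth; move: Hj; rewrite (maxn_idPr Hi).
Qed.

Lemma last_visit La a n c d : good c -> stepsL La n c d ->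
  (exists n', n' <= n /\ stepsL [seq x <- La | x != a] n' c d) \/
  (exists c', [/\ good c', lab c' = a & c' = d \/ exists c'' n', mv e V Y c' c'' /\
      stepsL [seq x <- La | x != a] n' c'' d]).
Proof.
move=> G H; elim: H G => [c1 L1|{}n {}c c1 c2 L1 M H IH] G.
  case: (lab c1 =P a) => [E|/eqP N]; last by left; exists 0; split=> //; apply: stepsL0; rewrite mem_filter N.
  by right; exists c1; split=> //; left.
have [[n' [Ln' H']]|[c' H']] := IH (good_mv G M); last by right; exists c'.
case: (lab c =P a) => [E|/eqP N].
  by right; exists c; split=> //; right; exists c1, n'.
by left; exists n'.+1; split=> //; apply: stepsLS M H'; rewrite mem_filter N.
Qed.

(** Slide from [c] directly to the last configuration with the label of [c], in at most [k] moves,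
    and make the next move from there. The label does not recur, so each label costs at most [k.+1]
    moves. *)
Lemma stepsL_short La n c d : good c -> good d -> stepsL La n c d ->
  exists2 m, m <= k.+1 * size La & steps e V Y m c d.
Proof.
move: {2}(size La) (leqnn (size La)) => s; elim: s La n c d => [|s IH] La n c d Ss G Gd H.
  by have := stepsL_l H; move: Ss; rewrite leqn0 size_eq0 => /eqP->.
have La1 : size [seq x <- La | x != lab c] < size La.
  rewrite size_filter -(count_predC (fun x => x != lab c) La) -[ltnLHS]addn0 ltn_add2l -has_count.
  by apply/hasP; exists (lab c); [exact: stepsL_l H | rewrite /= negbK].
have Slide c' : good c' -> lab c' = lab c -> exists2 m, m <= k & steps e V Y m c c'.
  case: G => U _ SY Sk [U' _ SY' _] E.
  have [m Lm St] := slide U U' SY SY' (lab_compat (esym E)) (leqnn _).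
  exists m => //; apply: leq_trans Lm _.
  by rewrite -Sk -[leqRHS](size_iota 0); apply: count_size.
have [[n' [_ H']]|[c' [Gc' Ec' [<-|[c'' [n' [M H']]]]]]] := last_visit (lab c) G H.
- have := stepsL_l H'; by rewrite mem_filter eqxx.
- have [m Lm St] := Slide c' Gc' Ec'; exists m => //; apply: leq_trans Lm _.
  case: (size La) La1 => // q _; rewrite mulnS; apply: leq_trans (leqnSn k) (leq_addr _ _).
- have [m1 L1 St1] := Slide c' Gc' Ec'.
  have Gc'' := good_mv Gc' M.
  have Ss' : size [seq x <- La | x != lab c] <= s by rewrite -ltnS; apply: leq_trans La1 Ss.
  have [m2 L2 St2] := IH _ _ _ _ Ss' Gc'' Gd H'.
  exists (m1 + m2.+1); last by apply: steps_trans St1 _; apply: stepsS M St2.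
  case: (size La) La1 => // q; rewrite ltnS => Lq; rewrite mulnS addnS -addSn.
  by apply: leq_add; [rewrite ltnS | apply: leq_trans L2 _; rewrite leq_mul2l Lq orbT].
Qed.

Lemma short_steps n c d : good c -> steps e V Y n c d ->
  exists2 m, m <= k.+1 * (size F + size WS * k) ^ k & steps e V Y m c d.
Proof.
move=> G H; rewrite -size_items -size_words.
have [HL Gd] : stepsL (words k items) n c d /\ good d.
  elim: H G => [c1|{}n {}c c1 c2 M _ IH] G.
    by split=> //; apply: stepsL0; case: G => _ _ SY S; apply: lab_words.
  have [H1 H2] := IH (good_mv G M); split=> //; apply: stepsLS M H1.
  by case: G => _ _ SY S; apply: lab_words.
exact: stepsL_short G Gd HL.
Qed.

End Short.

(** * The core of a component *)

Lemma count_or (T : Type) (p q : pred T) s : count (fun x => p x || q x) s <= count p s + count q s.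
Proof. by rewrite -count_predUI leq_addr. Qed.

Lemma count_or3 (T : Type) (p q r : pred T) s :
  count (fun x => [|| p x, q x | r x]) s <= count p s + count q s + count r s.
Proof.
apply: leq_trans (count_or _ _ _) _; rewrite -addnA leq_add2l; exact: count_or.
Qed.

Section Core.
Variable e : rel nat.
Hypothesis esym : symmetric e.

Lemma reach_filter D x : reachset e D x = [seq v <- D | v \in reachset e D x].
Proof.
have [p ->] : exists p, reachset e D x = filter p D.
  suff H (l : seq nat) : exists p, foldl (fun R _ => reach_step e D R) [seq v <- D | v == x] l = filter p D by apply: H.
  elim/last_ind: l => [|l h _] /=; first by exists (fun v => v == x).
  by rewrite foldl_rcons; eexists; reflexivity.
by apply: eq_in_filter => v Hv; rewrite mem_filter Hv andbT.
Qed.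

(** By [reach_filter] the list is the part of [D] singled out by its members, in the order of [D].
    Components are thus equal as lists, and the head of the list names them. *)
Lemma reach_eq D x y : conn e (fun v => v \in D) x y -> reachset e D x = reachset e D y.
Proof.
move=> C; rewrite reach_filter [RHS]reach_filter; apply: eq_filter => v.
by apply/idP/idP => /(reachP esym) H; apply/(reachP esym);
  [apply: conn_trans (conn_sym esym C) H | apply: conn_trans C H].
Qed.

Lemma reach_uniq D x : uniq D -> uniq (reachset e D x).
Proof. by move=> U; rewrite reach_filter filter_uniq. Qed.

Lemma reach_connected D x : connected e (reachset e D x).
Proof.
have K y : y \in reachset e D x -> conn e (fun v => v \in reachset e D x) x y.
  move/(reachP esym) => H; have : conn e (fun v => v \in D) x y by [].
  elim=> [Hx|u v Hu IH E Hv]; first by apply: conn0; apply/(reachP esym) => //; apply: conn0.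
  by apply: (connS IH E); apply/(reachP esym); exact: connS Hu E Hv.
by move=> y z Hy Hz; apply: (@conn_trans _ _ _ x); [apply: conn_sym => //|]; apply: K.
Qed.

Lemma reach_closed D x u v : u \in reachset e D x -> v \in D -> e u v -> v \in reachset e D x.
Proof. by move=> /(reachP esym) H Hv E; apply/(reachP esym); exact: connS H E Hv. Qed.

Definition nb (T D : seq nat) := [seq t <- T | has (e t) D].

Definition goodcore (B C : seq nat) := connb e C && all (fun u => (u \in C) || has (e u) C) B.
(* A minimal connected subset of [D] that dominates [D ++ S]. By minimality each of its
   non-cut vertices has a private neighbour, which bounds their number ([nc_core]). *)
Definition coreof (D S : seq nat) :=
  foldl (fun C u => if goodcore (D ++ S) (del C u) then del C u else C) D D.
Definition restof (D S : seq nat) := [seq u <- D | u \notin coreof D S].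

Section OneCore.
Variables D S : seq nat.
Hypothesis D_uniq : uniq D.
Hypothesis D_conn : connected e D.
Hypothesis D_nil : D != [::].
Hypothesis S_D : forall s, s \in S -> s \notin D /\ has (e s) D.
Local Notation C := (coreof D S).

Lemma goodcore_all : goodcore (D ++ S) D.
Proof.
apply/andP; split; first exact/(connbP esym).
by apply/allP=> u; rewrite mem_cat => /orP[->//|/S_D[_ ->]]; rewrite orbT.
Qed.

(** The added vertices are dominated by [C1] and hence attached to it. It follows that a vertex
    which could not be deleted at some time cannot be deleted later, so a single pass over [D]
    reaches a minimal set. *)
Lemma goodcore_mono B C1 C2 : goodcore B C1 -> {subset C1 <= C2} -> {subset C2 <= B} -> C1 != [::] -> goodcore B C2.
Proof.
move=> /andP[/(connbP esym) K1 /allP A1] S12 S2B N1; apply/andP; split; last first.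
  apply/allP=> u /A1 /orP[/S12 ->//|/hasP[w /S12 Hw E]].
  by apply/orP; right; apply/hasP; exists w.
apply/(connbP esym) => //.
have [w Hw] : exists w, w \in C1 by case: C1 N1 {K1 A1 S12} => // a l _; exists a; rewrite inE eqxx.
have K u : u \in C2 -> conn e (fun v => v \in C2) u w.
  move=> Hu; case/orP: (A1 u (S2B u Hu)) => [Hu1|/hasP[z Hz E]].
    by apply: conn_mono (K1 _ _ Hu1 Hw) => v; apply: S12.
  apply: (@conn_trans _ _ _ z); first by apply: conn1 => //; apply: S12.
  by apply: conn_mono (K1 _ _ Hz Hw) => v; apply: S12.
by move=> u v Hu Hv; apply: conn_trans (K u Hu) _; apply: conn_sym => //; apply: K.
Qed.

Lemma goodcore_nil C1 : goodcore (D ++ S) C1 -> C1 != [::].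
Proof.
move=> /andP[_ /allP A]; apply/negP=> /eqP E; case: D D_nil A => // a l _ A.
by have := A a; rewrite E inE eqxx => /(_ isT).
Qed.

Lemma core_inv : [/\ uniq C, {subset C <= D}, goodcore (D ++ S) C &
  forall u, u \in C -> ~~ goodcore (D ++ S) (del C u)].
Proof.
pose f B := fun (C : seq nat) u => if goodcore B (del C u) then del C u else C.
have Sub B C0 l : {subset foldl (f B) C0 l <= C0}.
  elim: l C0 => [|u l IH] C0 v //= /IH; rewrite /f; case: ifP => // _.
  by rewrite mem_del => /andP[].
have H l C0 : uniq C0 -> {subset C0 <= D} -> goodcore (D ++ S) C0 ->
   [/\ uniq (foldl (f (D ++ S)) C0 l), {subset foldl (f (D ++ S)) C0 l <= D}, goodcore (D ++ S) (foldl (f (D ++ S)) C0 l) &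
     forall u, u \in l -> u \in foldl (f (D ++ S)) C0 l -> ~~ goodcore (D ++ S) (del (foldl (f (D ++ S)) C0 l) u)].
  elim: l C0 => [|u l IH] C0 U0 S0 G0 //=.
  have [|||I1 I2 I3 I4] := IH (f (D ++ S) C0 u).
  - by rewrite /f; case: ifP => // _; apply: del_uniq.
  - by rewrite /f; case: ifP => // _ v; rewrite mem_del => /andP[_ /S0].
  - by rewrite /f; case: ifP.
  split=> // v; rewrite inE => /orP[/eqP->|]; last exact: I4.
  move=> Hu; apply/negP=> G.
  have Nf : ~~ goodcore (D ++ S) (del C0 u).
    apply/negP=> G'; have := Sub _ _ _ _ Hu; rewrite /f G' mem_del eqxx //.
  case/negP: Nf; apply: (goodcore_mono G _ _ (goodcore_nil G)).
    move=> w; rewrite !mem_del => /andP[-> /Sub]; rewrite /f; case: ifP => // _.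
    by rewrite mem_del => /andP[].
  by move=> w; rewrite mem_del mem_cat => /andP[_ /S0 ->].
have [I1 I2 I3 I4] := H D D D_uniq (fun x h => h) goodcore_all.
by split=> // u Hu; apply: I4 => //; apply: I2.
Qed.

Lemma core_uniq : uniq C. Proof. by case: core_inv. Qed.
Lemma core_sub : {subset C <= D}. Proof. by case: core_inv. Qed.
Lemma core_connected : connected e C.
Proof. by case: core_inv => _ _ /andP[/(connbP esym)]. Qed.
Lemma core_nil : C != [::].
Proof. by case: core_inv => _ _ /goodcore_nil. Qed.
Lemma core_dom u : u \in D ++ S -> u \notin C -> exists2 c, c \in C & e u c.
Proof.
case: core_inv => _ _ /andP[_ /allP A] _ /A /orP[->//|/hasP[c Hc E]] _.
by exists c.
Qed.

Lemma nc_core : nc e C <= (size (restof D S) + size S).+1.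
Proof.
have [U CD G M] := core_inv.
(* A core with a single vertex accounts for the successor in the bound. *)
case: (ltnP 1 (size C)) => S1; last first.
  by apply: leq_trans (count_size _ _) _; apply: leq_trans S1 _.
apply: leqW.
pose bad v u := ~~ ((u \in del C v) || has (e u) (del C v)).
pose f v := head 0 [seq u <- D ++ S | bad v u].
pose N := [seq v <- C | noncut e C v].
have fP v : v \in N -> [/\ f v \in D ++ S, bad v (f v) & v \in C].
  rewrite mem_filter => /andP[Hn Hv]; have := M v Hv; rewrite /goodcore.
  have -> : connb e (del C v) by [].
  rewrite /= -has_predC => /hasP[u Hu Bu].
  have : f v \in [seq u <- D ++ S | bad v u].
    rewrite /f; have : u \in [seq u <- D ++ S | bad v u] by rewrite mem_filter Hu andbT.
    by case: [seq _ <- _ | _] => //= a l _; rewrite inE eqxx.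
  by rewrite mem_filter => /andP[].
have fR v : v \in N -> f v \notin C /\ forall c, c \in C -> e (f v) c -> c = v.
  move=> Nv; have [F1 F2 F3] := fP v Nv; move: F2; rewrite /bad negb_or => /andP[B1 /hasPn B2].
  have B3 c : c \in C -> e (f v) c -> c = v.
    move=> Hc E; apply/eqP/negPn/negP=> Ncv.
    by have := B2 c; rewrite mem_del Ncv Hc => /(_ isT); rewrite E.
  (* The private neighbour is outside the core: a vertex of the core is dominated by the rest of the
     core, even [v] itself, which has a neighbour in the connected core. *)
  split=> //; apply/negP=> Fc; move: B1; rewrite mem_del Fc andbT negbK => /eqP Ev.
  have [z Hz Ez] := connected_neighbour core_connected F3 S1 U.
  have := B2 z Hz; by rewrite Ev Ez.
have Inj : {in N &, injective f}.
  move=> v v' Nv Nv' E; have [F1 _ _] := fP v Nv; have [F2 F3] := fR v Nv.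
  have [c Hc Ec] := core_dom F1 F2.
  by rewrite -(F3 c Hc Ec); apply: (fR v' Nv').2 => //; rewrite -E.
rewrite /nc -size_filter -/N -size_cat -(size_map f).
apply: uniq_leq_size; first by rewrite map_inj_in_uniq // filter_uniq.
move=> _ /mapP[v Nv ->]; have [F1 _ _] := fP v Nv; have [F2 _] := fR v Nv.
by move: F1; rewrite !mem_cat mem_filter F2.
Qed.

(** The head is made a knot to break cycles: in a core that is a cycle all vertices have degree two,
    and no path could be started. *)
Definition knot v := (deg e C v != 2) || (v == head 0 C).
Definition knots := [seq v <- C | knot v].
Definition links := [seq v <- C | ~~ knot v].
Definition fixed := restof D S ++ knots.

Lemma mem_links v : (v \in links) = [&& v \in C, deg e C v == 2 & v != head 0 C].
Proof. by rewrite mem_filter /knot negb_or negbK andbC. Qed.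

Lemma D_split v : v \in D -> (v \in fixed) || (v \in links).
Proof.
move=> Hv; rewrite mem_cat !mem_filter Hv; case: (v \in C) => //=.
by rewrite andbT; case: (knot v).
Qed.

Lemma size_knots N : nc e C <= N -> size knots <= N + N * (N + 4) + 1.
Proof.
move=> HN; have U := core_uniq; have K := core_connected.
rewrite size_filter.
have L1 : count (fun v => deg e C v < 2) C <= N := leq_trans (leaves_nc esym U K) HN.
have L2 : br e C <= N * (N + 4) := br_bound esym U K HN.
have L3 : count (pred1 (head 0 C)) C <= 1 by rewrite count_uniq_mem // leq_b1.
apply: leq_trans (_ : count (fun v => deg e C v < 2) C + br e C + count (pred1 (head 0 C)) C <= _); last first.
  by apply: leq_add L3; apply: leq_add.
apply: leq_trans (count_or3 _ _ _ _); apply: sub_count => v; rewrite /knot /=.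
by case: (deg e C v) => [|[|[|d]]].
Qed.

End OneCore.
End Core.

(** * Decomposition of a graph of maximum degree two into paths *)

Section Walks.
Variable e : rel nat.
Hypothesis esym : symmetric e.
Variable Pi : seq nat.

Definition ext (l : seq nat) := [seq u <- Pi | e (last 0 l) u && (u \notin l)].
Definition walk (v : nat) := foldl (fun l _ => l ++ take 1 (ext l)) [:: v] Pi.
Definition ends := [seq v <- Pi | deg e Pi v <= 1].
(** A path has its second end on the walk from the first one, so that end is skipped. Components
    without an end are cycles and are not covered. *)
Definition paths := foldl (fun acc v => if v \in flatten acc then acc else acc ++ [:: walk v]) [::] ends.

Hypothesis Pi_deg : forall v, v \in Pi -> deg e Pi v <= 2.

Lemma deg_three v a b c : a \in Pi -> b \in Pi -> c \in Pi -> e v a -> e v b -> e v c ->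
  uniq [:: v; a; b; c] -> 2 < deg e Pi v.
Proof.
rewrite /= !inE !negb_or => Ha Hb Hc Ea Eb Ec /and4P[/and3P[Na Nb Nc] /andP[Nab Nac] Nbc _].
rewrite /deg -size_filter; apply: (@uniq_leq_size _ [:: a; b; c]).
  by rewrite /= !inE !negb_or Nab Nac Nbc.
by move=> x; rewrite !inE mem_filter => /or3P[] /eqP->; rewrite ?Ea ?Eb ?Ec ?Ha ?Hb ?Hc andbT /= eq_sym ?Na ?Nb ?Nc.
Qed.

Lemma deg_two v a b : a \in Pi -> b \in Pi -> e v a -> e v b -> uniq [:: v; a; b] -> 1 < deg e Pi v.
Proof.
rewrite /= !inE !negb_or => Ha Hb Ea Eb /and3P[/andP[Na Nb] Nab _].
rewrite /deg -size_filter; apply: (@uniq_leq_size _ [:: a; b]).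
  by rewrite /= !inE Nab.
by move=> x; rewrite !inE mem_filter => /orP[] /eqP->; rewrite ?Ea ?Eb ?Ha ?Hb andbT /= eq_sym ?Na ?Nb.
Qed.

(** The last vertex is exempt from the closure condition, because its next neighbour may not be on
    the walk yet. *)
Definition winv (l : seq nat) :=
  [/\ uniq l, {subset l <= Pi}, chain e l, l != [::] /\ head 0 l \in ends
    & forall u v, u \in l -> v \in Pi -> e u v -> u != v -> (index u l).+1 < size l ->
        v \in l /\ index v l <= (index u l).+1].

(** The vertex that ceases to be last has its predecessor and [z] as neighbours or, if it is the
    start of the walk, only [z]. A further neighbour off the walk would exceed its degree. *)
Lemma winv_ext l z : winv l -> z \in ext l -> winv (l ++ [:: z]).
Proof.
case=> U SP Ch [N Hd] Cl; rewrite mem_filter => /andP[/andP[Ez Nz] Hz].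
have l0 : 0 < size l by case: (l) N.
have Ll : last 0 l \in l by case: (l) N => //= a s _; exact: mem_last.
have Il : (index (last 0 l) l).+1 = size l.
  by rewrite -nth_last index_uniq ?prednK //; case: (size l) l0.
split.
- by rewrite cat_uniq U /= orbF Nz.
- by move=> v; rewrite mem_cat inE => /orP[/SP|/eqP->].
- move=> i; rewrite size_cat /= addn1 ltnS => Hi; rewrite !nth_cat Hi.
  case: (ltnP i.+1 (size l)) => Hi2; first exact: Ch.
  have -> : i.+1 = size l by apply/eqP; rewrite eqn_leq Hi.
  by rewrite subnn /=; have -> : i = (size l).-1 by [case: (size l) Hi Hi2 => // m H1 H2; apply/eqP; rewrite eqn_leq -ltnS H1 -ltnS H2]; rewrite nth_last.
- by split; [case: (l) N | case: (l) N Hd].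
- move=> u v Hu Hv E Nuv; rewrite size_cat /= addn1 ltnS => Hi.
  have {}Hu : u \in l by move: Hi; rewrite index_cat; case: ifP => // _; rewrite /= ltnNge leq_addr.
  rewrite !index_cat Hu; move: Hi; rewrite index_cat Hu leq_eqVlt => /orP[/eqP Eu|Hi].
    have Eul : u = last 0 l.
      by rewrite -(nth_index 0 Hu) -nth_last; congr nth; move: Eu => <-.
    have Hvl : (v \in l) || (v == z).
      apply/negPn/negP; rewrite negb_or => /andP[Nv Nvz].
      have Huz : u != z by apply: contra Nz => /eqP <-.
      rewrite -Eul in Ez.
      case: (ltnP 1 (size l)) => S2; last first.
        have Euh : u = head 0 l.
          by rewrite Eul; case: (l) S2 => [|a [|b s]].
        have Hd1 : deg e Pi u <= 1 by move: Hd; rewrite -Euh mem_filter => /andP[].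
        have := deg_two Hv Hz E Ez; rewrite /= !inE !negb_or Nuv Huz Nvz => /(_ isT).
        by rewrite ltnNge Hd1.
      have [n En] : exists n, size l = n.+2 by exists (size l).-2; case: (size l) S2 => [|[|]].
      pose p := nth 0 l n.
      have Hp : p \in l by apply: mem_nth; rewrite En.
      have Eu' : u = nth 0 l n.+1 by rewrite Eul -nth_last En.
      have Ep : e u p by rewrite esym Eu'; apply: Ch; rewrite En.
      have Nup : u != p by rewrite /p Eu' nth_uniq ?En // eqn_leq ltnn.
      have Nvp : v != p by apply: contra Nv => /eqP->.
      have Nzp : z != p by apply: contra Nz => /eqP->.
      have := deg_three Hv Hz (SP _ Hp) E Ez Ep; rewrite /= !inE !negb_or Nuv Huz Nup Nvz Nvp Nzp => /(_ isT).
      by rewrite ltnNge Pi_deg // SP.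
    split; first by rewrite mem_cat inE.
    case: ifP => Hvl'; first by rewrite Eu ltnW // index_mem.
    by rewrite Hvl' /= in Hvl; rewrite (eqP Hvl) /= eqxx addn0 Eu.
  have [Vl Iv] := Cl u v Hu Hv E Nuv Hi.
  by rewrite mem_cat Vl.
Qed.

Lemma winv_walk v : v \in ends -> winv (walk v) /\ ext (walk v) = [::].
Proof.
move=> Hv; have vPi : v \in Pi by move: Hv; rewrite mem_filter => /andP[].
have W0 : winv [:: v].
  split=> //=; first by move=> x; rewrite inE => /eqP->.
have H (n l : seq nat) : winv l -> let l' := foldl (fun l _ => l ++ take 1 (ext l)) l n in
    winv l' /\ (ext l' = [::] \/ size l' = size l + size n).
  elim: n l => [|a n IH] l Wl /=; first by split=> //; right; rewrite addn0.
  case E : (ext l) => [|z s] /=.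
    rewrite cats0; have [I1 I2] := IH l Wl; split=> //; left.
    have St : forall m : seq nat, foldl (fun l _ => l ++ take 1 (ext l)) l m = l.
      by elim=> //= b m IHm; rewrite E /= cats0.
    by rewrite St.
  rewrite take0; have [|I1 I2] := IH (l ++ [:: z]); first by apply: winv_ext => //; rewrite E inE eqxx.
  split=> //; case: I2 => H2; [by left | right].
  by rewrite H2 size_cat /= addn1 addSnnS.
(* Otherwise every round added a vertex, and the walk would have more vertices than [Pi]. *)
have [W1 [E|S1]] := H Pi _ W0; first by split.
have [U SP _ _ _] := W1; by have := uniq_leq_size U SP; rewrite /walk S1 /= add1n ltnn.
Qed.

Lemma walk_closed v x y : v \in ends -> x \in walk v -> y \in Pi -> e x y -> y \in walk v.
Proof.
move=> Hv Hx Hy E; have [[U SP Ch [N Hd] Cl] Ex] := winv_walk Hv.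
have [Exy|Nxy] := eqVneq x y; first by rewrite -Exy.
case: (ltnP (index x (walk v)).+1 (size (walk v))) => Hi; first by have [] := Cl x y Hx Hy E Nxy Hi.
have Exl : x = last 0 (walk v).
  rewrite -(nth_index 0 Hx) -nth_last; congr nth; apply/eqP; rewrite eqn_leq.
  have := Hx; rewrite -index_mem; case: (size _) Hi => // m; rewrite ltnS /= => -> Hm.
  by rewrite -ltnS Hm.
apply/negPn/negP=> Ny; have : y \in ext (walk v) by rewrite mem_filter Hy andbT Ny -Exl E.
by rewrite Ex.
Qed.

Lemma walk_adj v x y : v \in ends -> x \in walk v -> y \in walk v -> e x y ->
  index y (walk v) <= (index x (walk v)).+1.
Proof.
move=> Hv Hx Hy E; have [[U SP Ch [N Hd] Cl] Ex] := winv_walk Hv.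
have [Exy|Nxy] := eqVneq x y; first by rewrite -Exy.
case: (ltnP (index x (walk v)).+1 (size (walk v))) => Hi.
  by have [] := Cl x y Hx (SP _ Hy) E Nxy Hi.
by apply: leq_trans Hi; apply: ltnW; rewrite index_mem.
Qed.

Lemma walk_head v : v \in ends -> v \in walk v.
Proof.
move=> _; rewrite /walk; have H (n l : seq nat) : v \in l -> v \in foldl (fun l _ => l ++ take 1 (ext l)) l n.
  by elim: n l => [|a n IH] l Hl //=; apply: IH; rewrite mem_cat Hl.
by apply: H; rewrite inE.
Qed.

Lemma walk_conn v x : v \in ends -> x \in walk v -> forall y, y \in walk v -> conn e (fun u => u \in walk v) x y.
Proof.
move=> Hv Hx y Hy; have [[U SP Ch _ _] _] := winv_walk Hv.
exact: (chain_conn2 esym Ch).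
Qed.

Definition path_inv (acc : seq (seq nat)) (s : seq nat) :=
  [/\ uniq (flatten acc), size acc <= size s, forall l, l \in acc -> exists2 v, v \in ends & l = walk v
    & forall v, v \in s -> v \in flatten acc].

Lemma paths_inv : path_inv paths ends.
Proof.
have H s acc s0 : path_inv acc s0 -> {subset s <= ends} ->
  path_inv (foldl (fun acc v => if v \in flatten acc then acc else acc ++ [:: walk v]) acc s) (s0 ++ s).
  elim: s acc s0 => [|v s IH] acc s0 I Hs /=; first by rewrite cats0.
  rewrite -(cat_rcons v); apply: IH; last by move=> u Hu; apply: Hs; rewrite inE Hu orbT.
  have [U S A B] := I; have Hv : v \in ends by apply: Hs; rewrite inE eqxx.
  case: ifP => Fv.
    split=> //; first by rewrite size_rcons leqW.
    by move=> u; rewrite mem_rcons inE => /orP[/eqP->|/B].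
  split.
  - rewrite flatten_cat /= cats0 cat_uniq U /=.
    have -> : uniq (walk v) by case: (winv_walk Hv) => [[->]].
    rewrite andbT; apply/hasPn => x Hx; apply/negP=> /flattenP[l Hl Hxl].
    have [w Hw El] := A l Hl; rewrite El in Hxl.
    have : v \in walk w.
      have := walk_conn Hv Hx (walk_head Hv).
      elim=> [//|a b Hab IHc E Hb]; apply: (walk_closed Hw IHc) => //.
      by case: (winv_walk Hv) => [[_ SP _ _ _] _]; apply: SP.
    by move=> Hvw; have : v \in flatten acc by [apply/flattenP; exists l => //; rewrite El]; rewrite Fv.
  - by rewrite size_cat size_rcons /= addn1 ltnS.
  - move=> l; rewrite mem_cat inE => /orP[/A //|/eqP ->]; by exists v.
  - move=> u; rewrite mem_rcons inE flatten_cat /= cats0 mem_cat => /orP[/eqP->|/B ->] //.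
    by rewrite walk_head // orbT.
have := H ends [::] [::]; rewrite /paths /=; apply => //.
Qed.

Lemma paths_uniq : uniq (flatten paths). Proof. by case: paths_inv. Qed.
Lemma size_paths : size paths <= size ends. Proof. by case: paths_inv. Qed.

Lemma paths_sub l : l \in paths -> {subset l <= Pi}.
Proof. by case: paths_inv => _ _ A _ /A [v /winv_walk [[_ SP _ _ _] _] ->]. Qed.

Lemma paths_chain l : l \in paths -> chain e l.
Proof. by case: paths_inv => _ _ A _ /A [v /winv_walk [[_ _ Ch _ _] _] ->]. Qed.

Lemma paths_adj l u v : l \in paths -> u \in l -> v \in l -> e u v -> index v l <= (index u l).+1.
Proof. by case: paths_inv => _ _ A _ /A [w Hw ->]; apply: walk_adj. Qed.

Lemma paths_closed l u v : l \in paths -> u \in l -> v \in Pi -> e u v -> v \in l.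
Proof. by case: paths_inv => _ _ A _ /A [w Hw ->]; apply: walk_closed. Qed.

Lemma paths_cover v : (exists2 w, w \in ends & conn e (fun u => u \in Pi) w v) -> v \in flatten paths.
Proof.
case=> w Hw; elim=> [_|a b Hab IH E Hb]; first by case: paths_inv => _ _ _; apply.
by case/flattenP: IH => l Hl Ha; apply/flattenP; exists l => //; apply: paths_closed E.
Qed.

End Walks.

(** * The links of a core form paths that end next to knots *)

Section Links.
Variable e : rel nat.
Hypothesis esym : symmetric e.
Variables D S : seq nat.
Hypothesis D_uniq : uniq D.
Hypothesis D_conn : connected e D.
Hypothesis D_nil : D != [::].
Hypothesis S_D : forall s, s \in S -> s \notin D /\ has (e s) D.
Local Notation C := (coreof e D S).
Local Notation Pi := (links e D S).

Let CU : uniq C := core_uniq esym D_uniq D_conn D_nil S_D.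
Let CC : connected e C := core_connected esym D_uniq D_conn D_nil S_D.

Lemma links_core v : v \in Pi -> v \in C.
Proof. by rewrite mem_links => /and3P[]. Qed.

Lemma links_deg v : v \in Pi -> deg e Pi v <= 2.
Proof.
rewrite mem_links => /and3P[_ /eqP <- _].
by rewrite /deg count_filter; apply: sub_count => u /andP[].
Qed.

Lemma head_core : head 0 C \in C.
Proof. by have := core_nil esym D_uniq D_conn D_nil S_D; case: (C) => // a l _; rewrite inE eqxx. Qed.

Lemma links_neighbour u w : u \in Pi -> w \in C -> w \notin Pi -> e u w -> deg e Pi u <= 1.
Proof.
move=> Hu Hw Nw E; have := Hu; rewrite mem_links => /and3P[_ /eqP D2 _].
have Nwu : w != u by apply: contra Nw => /eqP->.
have Hwd : w \in del C u by rewrite mem_del Nwu.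
rewrite -ltnS -[X in _ < X]D2 /deg.
apply: leq_trans (_ : (count (fun x => (x != u) && e u x) (del C w)).+1 <= _); last first.
  by rewrite (count_del _ CU Hw) Nwu E.
rewrite ltnS /links count_filter /del count_filter; apply: sub_in_count => x Hx /= /andP[-> Kx] /=.
apply: contra Nw => /eqP Exw; rewrite mem_filter Hw andbT -Exw.
by move: Kx.
Qed.

(** The core is connected and its head is not a link. A walk in the core from [v] to the head leaves
    the links at a link adjacent to a knot, and such a link is an end. *)
Lemma links_cover v : v \in Pi -> v \in flatten (paths e Pi).
Proof.
move=> Hv; apply: paths_cover => //; first exact: links_deg.
have Nh : head 0 C \notin Pi by rewrite mem_links eqxx !andbF.
have [u [w [E Pu Nw [Cu Hw]]]] :=
  conn_cross (p := fun z => z \in Pi) (CC (links_core Hv) head_core) Hv Nh.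
exists u; first by rewrite mem_filter Pu andbT; apply: links_neighbour E.
by apply: conn_sym => //; apply: conn_mono Cu => z /andP[].
Qed.

(** A link has degree two in the core, so an end has a neighbour among the knots; by [deg_nc] a knot
    has at most [N] neighbours in the core. *)
Lemma size_ends N : nc e C <= N -> size (ends e Pi) <= size (knots e D S) * N.
Proof.
move=> HN; pose nbrs b := [seq u <- C | (u != b) && e b u].
have Sn b : b \in C -> size (nbrs b) <= N.
  by move=> Hb; rewrite size_filter; apply: leq_trans (deg_nc esym CU CC Hb) HN.
apply: leq_trans (_ : size (flatten [seq nbrs b | b <- knots e D S]) <= _).
  apply: uniq_leq_size; first by do 2! apply: filter_uniq.
  move=> u; rewrite mem_filter => /andP[Du Hu]; have Huc := links_core Hu.
  have [w Hw] : exists2 w, w \in C & [&& w != u, e u w & w \notin Pi].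
    apply/hasP/negPn/negP => Nh; move: Du; rewrite leqNgt => /negP; apply.
    have := Hu; rewrite mem_links => /and3P[_ /eqP D2 _].
    have : 1 < deg e C u by rewrite D2.
    move/leq_trans; apply; rewrite /deg count_filter; apply: sub_in_count => x Hx /andP[Nx Ex] /=.
    rewrite Nx Ex /=; move/hasPn: Nh => /(_ x Hx); rewrite Nx Ex /= negbK mem_filter => /andP[].
    by [].
  move=> /and3P[Nwu Ew Nw]; apply/flatten_mapP; exists w.
    by rewrite mem_filter Hw andbT; move: Nw; rewrite mem_filter Hw andbT negbK.
  by rewrite mem_filter Huc eq_sym Nwu esym Ew.
have : {subset knots e D S <= C} by move=> b; rewrite mem_filter => /andP[].
elim: (knots e D S) => //= b s IH Hs; rewrite size_cat mulSn; apply: leq_add.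
  by apply: Sn; apply: Hs; rewrite inE eqxx.
by apply: IH => x Hx; apply: Hs; rewrite inE Hx orbT.
Qed.

End Links.

(** * A bounded set of parking positions *)

Lemma uniq_flatten_map (T S : eqType) (f : T -> seq S) s :
  uniq s -> (forall x, x \in s -> uniq (f x)) ->
  (forall x y z, x \in s -> y \in s -> z \in f x -> z \in f y -> x = y) -> uniq (flatten [seq f x | x <- s]).
Proof.
elim: s => //= x s IH /andP[Nx Us] Hu Hd; rewrite cat_uniq Hu ?inE ?eqxx //=.
rewrite IH //; last 2 first.
- by move=> y Hy; apply: Hu; rewrite inE Hy orbT.
- by move=> y y' z Hy Hy'; apply: Hd; rewrite inE ?Hy ?Hy' orbT.
rewrite andbT; apply/hasPn => z /flatten_mapP[y Hy Hz]; apply/negP=> Hzx.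
have E : x = y by apply: (Hd x y z) => //; rewrite inE ?eqxx // Hy orbT.
by move: Nx; rewrite E Hy.
Qed.

Lemma flatten_flatten_map (T S : Type) (f : T -> seq (seq S)) s :
  flatten (flatten [seq f x | x <- s]) = flatten [seq flatten (f x) | x <- s].
Proof. by elim: s => //= x s IH; rewrite flatten_cat IH. Qed.

Section Candidates.
Variables (e : rel nat) (V T : seq nat) (k q : nat).

Definition nonterm := [seq v <- V | v \notin T].
Definition comp v := reachset e nonterm v.
Definition repv v := head 0 (comp v).
Definition nbT v := nb e T (comp v).
Definition reps := [seq v <- nonterm | repv v == v].
Definition twins d := [seq u <- reps | nbT u == nbT d].
Definition crowded d := k < size (twins d).
Definition rest d := restof e (comp d) (nbT d).
Definition univ d := k <= size (rest d).
Definition cpaths d := paths e (links e (comp d) (nbT d)).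
Definition cfixed d := fixed e (comp d) (nbT d).
Definition poor d := [&& d \in take k (twins d), ~~ crowded d & ~~ univ d].
(** The levels begin at one, since level zero has only the dummy head. *)
Definition greedyX d l :=
  flatten [seq [seq head 0 r | r <- glev e (T ++ cfixed d) m l] | m <- iota 1 q].
Definition contrib d :=
  if d \notin take k (twins d) then [::]
  else if crowded d then [:: d]
  else if univ d then take k (rest d) else cfixed d.
Definition contribX d := if poor d then flatten [seq greedyX d l | l <- cpaths d] else [::].
Definition fixedX := T ++ flatten [seq contrib d | d <- reps].
Definition pathsX := flatten [seq (if poor d then cpaths d else [::]) | d <- reps].
Definition candidates := fixedX ++ flatten [seq contribX d | d <- reps].

Hypothesis e_sym : symmetric e.
Hypothesis V_uniq : uniq V.
Hypothesis TV : {subset T <= V}.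
Hypothesis eV : forall u v, e u v -> v \in V.

Lemma mem_nonterm v : (v \in nonterm) = (v \notin T) && (v \in V).
Proof. by rewrite mem_filter. Qed.

Lemma nonterm_uniq : uniq nonterm.
Proof. exact: filter_uniq. Qed.

Lemma comp_sub v u : u \in comp v -> u \in nonterm.
Proof. exact: reach_sub. Qed.

Lemma comp_refl v : v \in nonterm -> v \in comp v.
Proof. by move=> Hv; apply/(reachP e_sym); apply: conn0. Qed.

Lemma comp_eq u v : u \in comp v -> comp u = comp v.
Proof. by move=> /(reachP e_sym) C; apply/esym/reach_eq. Qed.

Lemma comp_edge u v : u \in nonterm -> v \in nonterm -> e u v -> comp u = comp v.
Proof. by move=> Hu Hv E; apply/esym/comp_eq; apply: (reach_closed e_sym) E => //; apply: comp_refl. Qed.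

Lemma comp_uniq v : uniq (comp v). Proof. exact/reach_uniq/nonterm_uniq. Qed.
Lemma comp_connected v : connected e (comp v). Proof. exact: reach_connected. Qed.

Lemma comp_nil v : v \in nonterm -> comp v != [::].
Proof. by move=> /comp_refl; case: (comp v). Qed.

Lemma comp_nb v s : s \in nbT v -> s \notin comp v /\ has (e s) (comp v).
Proof.
rewrite mem_filter => /andP[H Hs]; split=> //.
by apply: contraL Hs => /comp_sub; rewrite mem_nonterm => /andP[].
Qed.

Lemma repv_comp v : v \in nonterm -> repv v \in comp v.
Proof. by move=> /comp_nil; rewrite /repv; case: (comp v) => // a l _; rewrite inE eqxx. Qed.

Lemma repv_reps v : v \in nonterm -> repv v \in reps.
Proof.
move=> Hv; have H := repv_comp Hv.
by rewrite mem_filter {1}/repv (comp_eq H) eqxx (comp_sub H).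
Qed.

Lemma reps_nonterm d : d \in reps -> d \in nonterm /\ repv d = d.
Proof. by rewrite mem_filter => /andP[/eqP-> ->]. Qed.

Lemma reps_comp d v : d \in reps -> v \in comp d -> repv v = d.
Proof. by move=> /reps_nonterm [_ Ed] H; rewrite /repv (comp_eq H). Qed.

Lemma reps_uniq : uniq reps. Proof. exact/filter_uniq/nonterm_uniq. Qed.

Lemma twins_refl d : d \in reps -> d \in twins d.
Proof. by move=> H; rewrite mem_filter eqxx. Qed.

Lemma twins_eq d u : nbT u = nbT d -> twins u = twins d.
Proof. by move=> E; rewrite /twins E. Qed.

Lemma mem_twins d u : u \in twins d -> nbT u = nbT d /\ u \in reps.
Proof. by rewrite mem_filter => /andP[/eqP]. Qed.

(* Zone 0 collects the vertices where robots may park freely; the other zones are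
   numbered by a representative plus one. *)
Definition zone v := if v \notin nonterm then 0 else
  if crowded (repv v) then (head 0 (twins (repv v))).+1 else if univ (repv v) then (repv v).+1 else 0.

Definition slotsL a := if a is d.+1 then
  if (d \in reps) && (zone d == a) then (if crowded d then take k (twins d) else take k (rest d)) else [::]
  else [::].

Lemma zone_T v : v \in T -> zone v = 0.
Proof. by move=> H; rewrite /zone mem_nonterm H. Qed.

Lemma zone_nonterm v : zone v != 0 -> v \in nonterm.
Proof. by rewrite /zone; case: (v \in nonterm). Qed.

Lemma zone_comp u v : u \in nonterm -> v \in nonterm -> comp u = comp v -> zone u = zone v.
Proof. by move=> Hu Hv E; rewrite /zone Hu Hv /repv E. Qed.

Lemma zoneP v : zone v != 0 -> exists d, [/\ d \in reps, zone v = d.+1, zone d = d.+1, nbT v = nbT d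
    & if crowded d then true else univ d && (repv v == d)].
Proof.
move=> Z; have Hv := zone_nonterm Z; move: Z; rewrite /zone Hv /=.
have Hr := repv_reps Hv; have [Rn Rr] := reps_nonterm Hr.
have En : nbT (repv v) = nbT v by rewrite /nbT (comp_eq (repv_comp Hv)).
case: ifP => Cr; last first.
  case: ifP => // Un _; exists (repv v).
  by rewrite Rn Rr Cr Un eqxx -En.
move=> _; set d := head 0 (twins (repv v)).
have Hd : d \in twins (repv v).
  by have := twins_refl Hr; rewrite /d; case: (twins _) => //= a l _; rewrite inE eqxx.
have [Ed Rd] := mem_twins Hd; have [Dn Dr] := reps_nonterm Rd.
have Cd : crowded d by rewrite /crowded (twins_eq Ed).
by exists d; rewrite Dn Dr Cd (twins_eq Ed) -/d -En Ed.
Qed.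

Lemma slotsE v d : d \in reps -> zone v = d.+1 -> zone d = d.+1 ->
  slotsL (zone v) = if crowded d then take k (twins d) else take k (rest d).
Proof. by move=> Hd -> Zd; rewrite /slotsL Hd Zd eqxx. Qed.

Lemma slotsP a l : l \in slotsL a -> exists2 d, a = d.+1 & [/\ d \in reps, zone d = a
   & l \in if crowded d then take k (twins d) else take k (rest d)].
Proof.
rewrite /slotsL; case: a => // d; case: ifP => // /andP[Hd /eqP Zd] Hl.
by exists d.
Qed.

Lemma rest_comp d l : l \in take k (rest d) -> l \in comp d.
Proof. by move=> /mem_take; rewrite mem_filter => /andP[]. Qed.

Lemma crowded_slot d l : d \in reps -> l \in take k (twins d) ->
  [/\ l \in reps, nbT l = nbT d, twins l = twins d & crowded l = crowded d].
Proof.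
move=> Hd /mem_take /mem_twins [E Hl]; split=> //; first exact: twins_eq.
by rewrite /crowded (twins_eq E).
Qed.

Lemma zone_crowded d u : d \in reps -> crowded d -> zone d = d.+1 -> u \in nonterm -> nbT u = nbT d -> zone u = d.+1.
Proof.
move=> Hd Cd Zd Hu E; have [Dn Dr] := reps_nonterm Hd.
have Eu : nbT (repv u) = nbT d by rewrite -E /nbT (comp_eq (repv_comp Hu)).
move: Zd; rewrite /zone Dn Dr Cd /= => Zd.
by rewrite Hu /= /crowded (twins_eq Eu) -/(crowded d) Cd.
Qed.

Lemma L_zone_slot a l : a != 0 -> l \in slotsL a -> zone l = a /\ l \in V.
Proof.
move=> Na /slotsP [d Ea [Hd Zd Hl]]; have [Dn Dr] := reps_nonterm Hd.
have : l \in nonterm /\ zone l = a.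
  case: ifP Hl => Cd Hl.
    have [Rl El _ _] := crowded_slot Hd Hl; have [Ln _] := reps_nonterm Rl.
    by split=> //; rewrite Ea; apply: (zone_crowded Hd Cd) => //; rewrite Zd.
  have Hc := rest_comp Hl; split; first exact: comp_sub Hc.
  by rewrite -Zd; apply: zone_comp => //; [exact: comp_sub Hc | exact: comp_eq].
by rewrite mem_nonterm => -[/andP[_ lV] ->].
Qed.

Lemma L_slots v : v \in V -> zone v != 0 -> uniq (slotsL (zone v)) /\ k <= size (slotsL (zone v)).
Proof.
move=> _ /zoneP [d [Hd Zv Zd _ Cu]]; rewrite (slotsE Hd Zv Zd).
case: ifP Cu => [Cd _|Cd /andP[Un _]].
  by split; [apply/take_uniq/filter_uniq/reps_uniq | rewrite size_takel // ltnW].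
by split; [apply/take_uniq/filter_uniq/comp_uniq | rewrite size_takel].
Qed.

Lemma L_zone_edge u v : u \in V -> v \in V -> e u v -> zone u != 0 -> zone v != 0 -> zone u = zone v.
Proof.
move=> _ _ E /zone_nonterm Hu /zone_nonterm Hv; apply: zone_comp => //; exact: comp_edge.
Qed.

(** The boundary of a zone consists of terminals, for a neighbour that is not a terminal belongs to
    the same component and thus to the same zone. *)
Lemma adj_zone_nb a s : a != 0 -> adj_zone e V zone a s -> s \in T /\ exists2 w, zone w = a & s \in nbT w.
Proof.
move=> Na [sV Zs [w [wV Zw E]]]; have Hw : w \in nonterm by apply: zone_nonterm; rewrite Zw.
have sT : s \in T.
  apply/negPn/negP=> Ns; have Hs : s \in nonterm by rewrite mem_nonterm Ns.
  by move: Na; rewrite -Zw -(zone_comp Hs Hw) ?Zs //; apply: comp_edge.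
split=> //; exists w => //; rewrite mem_filter sT andbT; apply/hasP; exists w => //; exact: comp_refl.
Qed.

Lemma nb_conn s d : s \in nbT d -> exists2 u, u \in comp d & e s u.
Proof. by rewrite mem_filter => /andP[/hasP[u Hu E] _]; exists u. Qed.

(** In a crowded zone the slots are representatives, so a component contains at most one slot and
    the rest of it is core. *)
Lemma comp_core_crowded d l w : d \in reps -> crowded d -> zone d = d.+1 -> l \in reps -> nbT l = nbT d ->
  w \in comp l -> (w != l) || (l \notin take k (twins d)) -> core V zone slotsL d.+1 w.
Proof.
move=> Hd Cd Zd Hl El Hw H; have Hwn := comp_sub Hw.
have Zw : zone w = d.+1.
  by apply: (zone_crowded Hd Cd Zd Hwn); rewrite -El /nbT (comp_eq Hw).
rewrite /core Zw eqxx andbT; have := Hwn; rewrite mem_nonterm => /andP[_ ->].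
rewrite andTb -Zw (slotsE Hd Zw Zd) Cd; apply/negP=> Hw2.
have [Rw _ _ _] := crowded_slot Hd Hw2.
have Ewl : w = l by rewrite -(reps_comp Hl Hw) (reps_nonterm Rw).2.
by move: H; rewrite Ewl eqxx /= -Ewl Hw2.
Qed.

Lemma core_core d w : d \in reps -> ~~ crowded d -> univ d -> zone d = d.+1 -> w \in coreof e (comp d) (nbT d) ->
  core V zone slotsL d.+1 w.
Proof.
move=> Hd Cd Ud Zd Hw; have [Dn Dr] := reps_nonterm Hd.
have Hwc : w \in comp d by apply: (core_sub e_sym (comp_uniq d) (@comp_connected d) (comp_nil Dn) (@comp_nb d)).
have Hwn := comp_sub Hwc; have Zw : zone w = d.+1.
  by rewrite -Zd; apply: zone_comp => //; apply: comp_eq.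
rewrite /core Zw eqxx andbT; have := Hwn; rewrite mem_nonterm => /andP[_ ->].
rewrite andTb -Zw (slotsE Hd Zw Zd) (negbTE Cd); apply/negP=> /mem_take.
by rewrite mem_filter Hw.
Qed.

(** In a crowded zone [s] is adjacent to the component of [l], which contains no other slot. In the
    other case both [l] and [s] have neighbours in the connected dominating set of the component,
    which contains no slot. *)
Lemma L_slot_conn a l s : a != 0 -> l \in slotsL a -> adj_zone e V zone a s ->
  conn e (fun v => [|| v == l, v == s | core V zone slotsL a v]) l s.
Proof.
move=> Na Hl As; have [sT [w Zw Sw]] := adj_zone_nb Na As.
have [d Ea [Hd Zd Hl2]] := slotsP Hl; have [Dn Dr] := reps_nonterm Hd.
have Nw : zone w != 0 by rewrite Zw.
have [d' [Hd' Zw' Zd' Nb' Cu]] := zoneP Nw.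
have Edd : d' = d by move: Zw'; rewrite Zw Ea => -[].
rewrite {}Edd {Hd' Zd'} in Zw' Nb' Cu; rewrite Nb' in Sw.
rewrite Ea in Zd *.
case: ifP Cu Hl2 => [Cd _|/negbT Cd /andP[Un _]] Hl2.
  have [Rl El _ _] := crowded_slot Hd Hl2; have [Ln _] := reps_nonterm Rl.
  rewrite -El in Sw; have [u Hu Eu] := nb_conn Sw.
  apply: (@connS _ _ _ u); last 2 first; rewrite 1?e_sym ?eqxx ?orbT //.
  apply: conn_mono (comp_connected (comp_refl Ln) Hu) => z Hz.
  case: (z =P l) => //= /eqP Nz; apply/orP; right.
  by apply: (comp_core_crowded Hd Cd Zd Rl El Hz); rewrite Nz.
have K := core_dom e_sym (comp_uniq d) (@comp_connected d) (comp_nil Dn) (@comp_nb d).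
have KC := core_connected e_sym (comp_uniq d) (@comp_connected d) (comp_nil Dn) (@comp_nb d).
have [||c Hc Ec] := K l; first by rewrite mem_cat (rest_comp Hl2).
  by move/mem_take: Hl2; rewrite mem_filter => /andP[].
have [||c' Hc' Ec'] := K s; first by rewrite mem_cat Sw orbT.
  apply: contraL sT => /(core_sub e_sym (comp_uniq d) (@comp_connected d) (comp_nil Dn) (@comp_nb d)) /comp_sub.
  by rewrite mem_nonterm => /andP[].
have Kc z : z \in coreof e (comp d) (nbT d) -> core V zone slotsL d.+1 z by apply: core_core.
apply: (@connS _ _ _ c'); last 2 first; rewrite 1?e_sym ?eqxx ?orbT //.
apply: (@conn_trans _ _ _ c); last by apply: conn_mono (KC _ _ Hc Hc') => z Hz; rewrite Kc ?orbT.
by apply: conn1 => //; rewrite ?eqxx // Kc ?orbT.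
Qed.

Lemma L_core_conn a s s' : a != 0 -> adj_zone e V zone a s -> adj_zone e V zone a s' ->
  conn e (fun v => [|| v == s, v == s' | core V zone slotsL a v]) s s'.
Proof.
move=> Na As As'; have [sT [w Zw Sw]] := adj_zone_nb Na As; have [sT' [w' Zw' Sw']] := adj_zone_nb Na As'.
have Nw : zone w != 0 by rewrite Zw.
have Nw' : zone w' != 0 by rewrite Zw'.
have [d [Hd Ed Zd Nbw Cu]] := zoneP Nw; have [d' [Hd' Ed' Zd' Nbw' _]] := zoneP Nw'.
have Edd : d' = d by move: Ed; rewrite Zw -Zw' Ed' => -[].
rewrite {}Edd {Hd' Ed' Zd'} in Nbw'.
rewrite Nbw in Sw; rewrite Nbw' in Sw'; have [Dn Dr] := reps_nonterm Hd.
have -> : a = d.+1 by rewrite -Zw.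
case: ifP Cu => [Cd _|/negbT Cd /andP[Un _]].
  (* There are more than [k] twins, so the component of one of them contains no slot. *)
  have [l Hl Nl] : exists2 l, l \in twins d & l \notin take k (twins d).
    apply/hasP; rewrite has_predC; apply/negP=> /allP A.
    have Cd2 : k < size (twins d) := Cd.
    have := uniq_leq_size (filter_uniq _ reps_uniq) A.
    by rewrite size_takel ?(ltnW Cd2) // leqNgt Cd2.
  have [El Rl] := mem_twins Hl; have [Ln _] := reps_nonterm Rl.
  rewrite -El in Sw Sw'; have [u Hu Eu] := nb_conn Sw; have [u' Hu' Eu'] := nb_conn Sw'.
  have Kc z : z \in comp l -> core V zone slotsL d.+1 z.
    by move=> Hz; apply: (comp_core_crowded Hd Cd Zd Rl El Hz); rewrite Nl orbT.
  apply: (@connS _ _ _ u'); last 2 first; rewrite 1?e_sym ?eqxx ?orbT //.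
  apply: (@conn_trans _ _ _ u); last by apply: conn_mono (comp_connected Hu Hu') => z Hz; rewrite Kc ?orbT.
  by apply: conn1 => //; rewrite ?eqxx // Kc ?orbT.
have K := core_dom e_sym (comp_uniq d) (@comp_connected d) (comp_nil Dn) (@comp_nb d).
have KC := core_connected e_sym (comp_uniq d) (@comp_connected d) (comp_nil Dn) (@comp_nb d).
have NT z : z \in T -> z \notin coreof e (comp d) (nbT d).
  move=> Hz; apply: contraL Hz => /(core_sub e_sym (comp_uniq d) (@comp_connected d) (comp_nil Dn) (@comp_nb d)) /comp_sub.
  by rewrite mem_nonterm => /andP[].
have [||c Hc Ec] := K s; [by rewrite mem_cat Sw orbT | exact: NT |].
have [||c' Hc' Ec'] := K s'; [by rewrite mem_cat Sw' orbT | exact: NT |].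
have Kc z : z \in coreof e (comp d) (nbT d) -> core V zone slotsL d.+1 z by apply: core_core.
apply: (@connS _ _ _ c'); last 2 first; rewrite 1?e_sym ?eqxx ?orbT //.
apply: (@conn_trans _ _ _ c); last by apply: conn_mono (KC _ _ Hc Hc') => z Hz; rewrite Kc ?orbT.
by apply: conn1 => //; rewrite ?eqxx // Kc ?orbT.
Qed.

Lemma comp_hyps d : d \in reps -> [/\ uniq (comp d), connected e (comp d), comp d != [::] &
  forall s, s \in nbT d -> s \notin comp d /\ has (e s) (comp d)].
Proof.
move=> /reps_nonterm [Dn _]; split; [exact: comp_uniq|exact: comp_connected|exact: comp_nil|].
by move=> s; apply: comp_nb.
Qed.

Lemma cpaths_comp d l v : d \in reps -> l \in cpaths d -> v \in l ->
  v \in links e (comp d) (nbT d) /\ v \in comp d.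
Proof.
move=> /comp_hyps [U C N S] Hl Hv.
have Pd u : u \in links e (comp d) (nbT d) -> deg e (links e (comp d) (nbT d)) u <= 2 by apply: links_deg.
have Hk : v \in links e (comp d) (nbT d) by apply: (paths_sub e_sym Pd Hl Hv).
by split=> //; apply: (core_sub e_sym U C N S); apply: links_core Hk.
Qed.

Lemma pathsX_cpaths l : l \in pathsX -> exists2 d, d \in reps & poor d /\ l \in cpaths d.
Proof. by move=> /flatten_mapP[d Hd]; case: ifP => // P Hl; exists d. Qed.

Lemma poor_zone d v : d \in reps -> poor d -> v \in comp d -> zone v = 0.
Proof.
move=> Hd /and3P[_ /negbTE Cd /negbTE Ud] Hv; have [Dn Dr] := reps_nonterm Hd.
rewrite (zone_comp (comp_sub Hv) Dn (comp_eq Hv)) /zone Dn Dr Cd Ud //.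
Qed.

Lemma pathsX_uniq : uniq (flatten pathsX).
Proof.
rewrite flatten_flatten_map; apply: uniq_flatten_map; first exact: reps_uniq.
  move=> d Hd; case: ifP => // _; have [U C N S] := comp_hyps Hd.
  by apply: (paths_uniq e_sym) => u; apply: links_deg.
move=> d d' v Hd Hd'; case: ifP => // _ /flattenP[l Hl Hv]; case: ifP => // _ /flattenP[l' Hl' Hv'].
by rewrite -(reps_comp Hd (cpaths_comp Hd Hl Hv).2) (reps_comp Hd' (cpaths_comp Hd' Hl' Hv').2).
Qed.

Lemma pathsX_chain l : l \in pathsX -> chain e l.
Proof.
move=> /pathsX_cpaths [d Hd [_ Hl]]; have [U C N S] := comp_hyps Hd.
by apply: (paths_chain e_sym _ Hl) => u; apply: links_deg.
Qed.

Lemma pathsX_nonterm v : v \in flatten pathsX -> v \in nonterm /\ zone v = 0.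
Proof.
move=> /flattenP[l /pathsX_cpaths [d Hd [P Hl]] Hv]; have [_ Hc] := cpaths_comp Hd Hl Hv.
by split; [exact: comp_sub Hc | exact: poor_zone Hc].
Qed.

Definition parking v := parkable zone slotsL v && (v \in V).

Lemma uncrowded_take d : d \in reps -> ~~ crowded d -> d \in take k (twins d).
Proof. by move=> Hd Cd; rewrite take_oversize ?twins_refl // leqNgt. Qed.

Lemma parkingP v : parking v -> (v \in fixedX) || (v \in flatten pathsX).
Proof.
case/andP=> P vV; case vT : (v \in T); first by rewrite mem_cat vT.
have Hv : v \in nonterm by rewrite mem_nonterm vT vV.
have Rv := repv_reps Hv; have Cv : v \in comp (repv v) by rewrite (comp_eq (repv_comp Hv)) comp_refl.
case/orP: P => [/eqP Z|Sl].
  move: Z; rewrite /zone Hv /=; case: ifP => // /negbT Nc; case: ifP => // /negbT Nu _.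
  have P : poor (repv v) by rewrite /poor Nc Nu uncrowded_take.
  have [U C N S] := comp_hyps Rv; have := D_split e (nbT (repv v)) Cv.
  case/orP=> H; apply/orP; [left|right].
    rewrite mem_cat; apply/orP; right; apply/flatten_mapP; exists (repv v) => //.
    by rewrite /contrib uncrowded_take //= (negbTE Nc) (negbTE Nu).
  have := links_cover e_sym U C N S H => /flattenP[l Hl Hvl].
  by apply/flattenP; exists l => //; apply/flatten_mapP; exists (repv v); rewrite ?P.
have [d Ed [Hd Zd Hl]] := slotsP Sl.
rewrite mem_cat -orbA orbCA; apply/orP; left; apply/flatten_mapP.
case: ifP Hl => Cd Hl.
  have [Rl El Tl Cl] := crowded_slot Hd Hl.
  by exists v => //; rewrite /contrib Tl Hl Cl Cd inE /=.
have [Dn Dr] := reps_nonterm Hd; exists d => //.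
rewrite /contrib uncrowded_take ?Cd //=.
by move: Zd; rewrite Ed /zone Dn Dr Cd; case: (univ d).
Qed.

Lemma map_phi_T phi c : (forall v, v \in T -> phi v = v) -> {subset c <= T} -> map phi c = c.
Proof. by move=> H cT; rewrite -[RHS]map_id; apply/eq_in_map => v /cT; apply: H. Qed.

(* The paths are treated one after the other; [RS] are the paths still to be treated. *)
Lemma normalize_paths RS (Y : nat -> bool) m c d : {subset RS <= pathsX} ->
  (forall v, Y v -> (v \in candidates) || (v \in flatten RS)) -> uniq c -> {subset c <= T} -> size c + m <= q ->
  steps e V Y m c d -> exists2 d', steps e V (fun v => v \in candidates) m c d'
    & forall i, i < size c -> nth 0 d i \in T -> nth 0 d' i = nth 0 d i.
Proof.
move=> RSX YC Uc cT Hq; elim: RS Y d RSX YC => [|l RS IH] Y d RSX YC H.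
  exists d => //; elim: H YC {Uc cT Hq} => [c1|n c1 c2 c3 [i [y [Hi Ny Yy C ->]]] _ IH] YC; first exact: steps0.
  by apply: stepsS (IH YC); exists i, y; split=> //; have := YC y Yy; rewrite orbF.
have lX : l \in pathsX by apply: RSX; rewrite inE eqxx.
have [d0 Hd [P Hl]] := pathsX_cpaths lX; have [U C N S] := comp_hyps Hd.
have Ul : uniq l.
  by have := pathsX_uniq; case/splitPr: lX => p1 p2; rewrite flatten_cat /= !cat_uniq => /and3P[_ _ /and3P[]].
have lN v : v \in l -> v \in nonterm.
  by move=> Hv; have [_ /comp_sub] := cpaths_comp Hd Hl Hv.
have Pd u : u \in links e (comp d0) (nbT d0) -> deg e (links e (comp d0) (nbT d0)) u <= 2 by apply: links_deg.
(* [Q] depends on the schedule, but it has at most [q] elements, so the images under [phi] occur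
   within the first [q] greedy levels. *)
have [Q [SQ cQ HQ]] := steps_used H.
have [phi [Pout Pin Pmono Pnbr]] := greedy_phi e (T ++ cfixed d0) Q Ul.
have PT v : v \in T -> phi v = v.
  by move=> Hv; apply: Pout; apply/negP=> /lN; rewrite mem_nonterm Hv.
have H1 : steps e V (fun v => (v \in candidates) || (v \in flatten RS)) m (map phi c) (map phi d).
  apply: (@phi_steps e V e_sym l Q phi Ul (pathsX_chain lX)) HQ => //.
  - by move=> v /lN; rewrite mem_nonterm => /andP[].
  - by move=> u v Hu Hv; apply: (paths_adj e_sym Pd Hl).
  - by move=> v Hv Hvl; have [] := Pin v Hv Hvl.
  (* A neighbour off the path is a terminal or a fixed vertex of the same component, hence one that
     the signatures take into account; a link adjacent to the path would lie on it. *)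
  - move=> v f Hv Nf E; apply: Pnbr => //; rewrite mem_cat; case fT : (f \in T) => //=.
    have Hf : f \in nonterm by rewrite mem_nonterm fT (eV E).
    have Hfc : f \in comp d0.
      have [_ Hvc] := cpaths_comp Hd Hl Hv.
      by rewrite -(comp_eq Hvc) (comp_edge (lN _ Hv) Hf E) comp_refl.
    case/orP: (D_split e (nbT d0) Hfc) => // Hk.
    by move: Nf; rewrite (paths_closed e_sym Pd Hl Hv Hk E).
  - by move=> v /cT /TV.
  - by move=> y /andP[].
  move=> y yQ /andP[_ Yy]; case yl : (y \in l); last first.
    rewrite Pout ?yl //; have /orP[->//|] := YC y Yy.
    by rewrite /= mem_cat yl /= => ->; rewrite orbT.
  have [_ [j [r [j0 jQ Hr Er]]]] := Pin y yQ yl; apply/orP; left.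
  rewrite mem_cat; apply/orP; right; apply/flatten_mapP; exists d0 => //; rewrite /contribX P.
  apply/flatten_mapP; exists l => //; apply/flatten_mapP; exists j; last by rewrite -Er map_f.
  by rewrite mem_iota j0 add1n ltnS (leq_trans jQ) // (leq_trans SQ).
rewrite (map_phi_T PT cT) in H1.
have RSX' : {subset RS <= pathsX} by move=> x Hx; apply: RSX; rewrite inE Hx orbT.
have [d' Hd' Ed'] := IH _ _ RSX' (fun v Hv => Hv) H1.
have [Sd _ _] := steps_inv H Uc (fun v Hv => TV (cT v Hv)).
exists d' => // i Hi Ti; have E : nth 0 (map phi d) i = nth 0 d i by rewrite (nth_map 0) ?Sd // PT.
by rewrite Ed' ?E.
Qed.

Definition movebound := k.+1 * (size fixedX + size pathsX * k) ^ k.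

Lemma normal_form n c d : k + movebound <= q -> uniq c -> {subset c <= T} -> size c = k ->
  steps e V xpredT n c d -> exists m d', [/\ m <= n, m <= movebound,
    steps e V (fun v => v \in candidates) m c d' & forall i, i < k -> nth 0 d i \in T -> nth 0 d' i = nth 0 d i].
Proof.
move=> Hq Uc cT Sc H; have cV : {subset c <= V} by move=> v /cT /TV.
have S0 : Sim zone slotsL c c.
  split=> // i Hi; case: ifP => //; rewrite zone_T ?eqxx //; exact/cT/mem_nth.
have [m1 [d1 [L1 H1 [Sd1 Ud1 Z1]]]] := sim_steps e_sym L_zone_slot L_slots L_zone_edge L_slot_conn L_core_conn Sc Uc cV H S0.
have [Sd _ _] := steps_inv H Uc cV.
have H2 : steps e V parking m1 c d1.
  elim: H1 {S0 Z1 Sd1 L1 H Sc cT} Uc cV => [c1|j c1 c2 c3 M _ IH] Uc cV; first exact: steps0.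
  apply: stepsS (IH (uniq_mv M Uc) (sub_mv M cV)).
  case: M => i [y [Hi Ny Yy C ->]]; exists i, y; split=> //; rewrite /parking Yy.
  by have /andP[] := conn_r C.
have G : good V parking k c.
  by split=> // v Hv; rewrite /parking /parkable -topredE /= zone_T ?cT //= (cV v Hv).
have HP l : l \in pathsX -> chain e l := @pathsX_chain l.
have WV : {subset flatten pathsX <= V}.
  by move=> v /pathsX_nonterm [+ _]; rewrite mem_nonterm => /andP[].
have WY : {subset flatten pathsX <= parking}.
  by move=> v Hv; rewrite -topredE /= /parking /parkable (WV v Hv) (pathsX_nonterm Hv).2.
(* A schedule within [movebound] is kept, and a longer one is replaced. Either way the number of
   moves stays at most [n], as the budget demands. *)
have [m [Lm Lb Hm]] : exists m, [/\ m <= n, m <= movebound & steps e V parking m c d1].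
  have [m2 L2 H3] := short_steps e_sym pathsX_uniq HP WV WY parkingP G H2.
  case: (leqP m1 movebound) => L; first by exists m1.
  by exists m2; split=> //; apply: leq_trans L1; apply: ltnW; apply: leq_ltn_trans L.
have YC v : parking v -> (v \in candidates) || (v \in flatten pathsX).
  by case/parkingP/orP => H3; rewrite ?H3 ?orbT // /candidates mem_cat H3.
have Lq : size c + m <= q by rewrite Sc; apply: leq_trans Hq; rewrite leq_add2l.
have [d' H' E'] := normalize_paths (fun l Hl => Hl) YC Uc cT Lq Hm.
exists m, d'; split=> // i Hi Ti.
have E1 : nth 0 d1 i = nth 0 d i.
  by have := Z1 i; rewrite Sd Sc (zone_T Ti) eqxx; apply.
by rewrite E' ?Sc ?E1.
Qed.

End Candidates.

(** * The number of candidate positions is bounded in the number of robots *)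

Lemma size_flatten_map_le (A : Type) (S : eqType) (f : A -> seq S) (p : pred A) s N :
  (forall x, size (f x) <= if p x then N else 0) -> size (flatten [seq f x | x <- s]) <= count p s * N.
Proof.
move=> H; elim: s => //= x s IH; rewrite size_cat mulnDl; apply: leq_add IH.
by apply: leq_trans (H x) _; case: (p x); rewrite ?mul1n.
Qed.

Lemma size_flatten_map_in (A S : eqType) (f : A -> seq S) (p : pred A) s N :
  (forall x, x \in s -> size (f x) <= if p x then N else 0) -> size (flatten [seq f x | x <- s]) <= count p s * N.
Proof.
elim: s => //= x s IH H; rewrite size_cat mulnDl; apply: leq_add.
  by apply: leq_trans (H x _) _; [rewrite inE eqxx | case: (p x); rewrite ?mul1n].
by apply: IH => y Hy; apply: H; rewrite inE Hy orbT.
Qed.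

Lemma leq_exp m n d : m <= n -> m ^ d <= n ^ d.
Proof. by case: d => // d H; rewrite leq_exp2r. Qed.

Section CandidateSizes.
Variables (e : rel nat) (V T : seq nat) (k q : nat).
Hypothesis e_sym : symmetric e.
Hypothesis V_uniq : uniq V.
Local Notation reps := (reps e V T).
Local Notation twins := (twins e V T).
Local Notation nbT := (nbT e V T).
(** [N] bounds the non-cut vertices of the core of a poor component, which has fewer than [k]
    vertices outside the core; [K] bounds the knots. *)
Let N := k + size T.
Let K := N + N * (N + 4) + 1.

(** A selected representative is determined by its neighbourhood, a subset of [T], and its index
    below [k] among its twins. *)
Lemma selected_bound : count (fun d => d \in take k (twins d)) reps <= 2 ^ size T * k.
Proof.
rewrite -size_filter -size_subs -{2}(size_iota 0 k) -(size_allpairs (fun x y => (x, y))).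
pose f d := (nbT d, index d (twins d)).
have Inj : {in [seq d <- reps | d \in take k (twins d)] &, injective f}.
  move=> d d'; rewrite !mem_filter => /andP[/mem_take Hd _] /andP[/mem_take Hd' _] [E1 E2].
  have Et := @twins_eq e V T _ _ E1.
  by rewrite -(nth_index 0 Hd) E2 Et nth_index // -Et.
rewrite -(size_map f); apply: uniq_leq_size; first by rewrite (map_inj_in_uniq Inj) filter_uniq // reps_uniq.
move=> y /mapP[d]; rewrite mem_filter => /andP[Hd _] {y}->.
apply/allpairsP; exists (f d); rewrite /f /= mem_iota /= add0n; split=> //; first exact: filter_subs.
have := Hd; rewrite in_take; last exact: mem_take Hd.
by [].
Qed.

Lemma poor_sizes d : d \in reps -> poor e V T k d ->
  size (rest e V T d) <= k /\ nc e (coreof e (comp e V T d) (nbT d)) <= N.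
Proof.
move=> Hd /and3P[_ _ Ud]; have [U C Nn S] := comp_hyps e_sym V_uniq Hd.
have L : size (rest e V T d) < k by rewrite ltnNge.
split; first exact: ltnW.
apply: leq_trans (nc_core e_sym U C Nn S) _.
by rewrite -addSn leq_add // size_filter count_size.
Qed.

Lemma size_cfixed d : d \in reps -> poor e V T k d -> size (cfixed e V T d) <= k + K.
Proof.
move=> Hd Pd; have [U C Nn S] := comp_hyps e_sym V_uniq Hd; have [L1 L2] := poor_sizes Hd Pd.
by rewrite size_cat leq_add // (size_knots e_sym U C Nn S L2).
Qed.

Lemma size_cpaths d : d \in reps -> poor e V T k d -> size (cpaths e V T d) <= K * N.
Proof.
move=> Hd Pd; have [U C Nn S] := comp_hyps e_sym V_uniq Hd; have [L1 L2] := poor_sizes Hd Pd.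
have Pdeg u : u \in links e (comp e V T d) (nbT d) -> deg e (links e (comp e V T d) (nbT d)) u <= 2 by apply: links_deg.
apply: leq_trans (size_paths e_sym Pdeg) _.
apply: leq_trans (size_ends e_sym U C Nn S L2) _.
by rewrite leq_mul2r (size_knots e_sym U C Nn S L2) orbT.
Qed.

Lemma size_contrib d : d \in reps ->
  size (contrib e V T k d) <= if d \in take k (twins d) then k + K else 0.
Proof.
move=> Hd; rewrite /contrib; case: (boolP (d \in take k (twins d))) => //= Hk.
case: ifP => [_|Cd]; first by rewrite /K addnA addn1.
case: ifP => Ud; first by rewrite size_take_min (leq_trans (geq_minl _ _)) // leq_addr.
by apply: size_cfixed => //; rewrite /poor Hk Cd Ud.
Qed.

Let P := 2 ^ size T * k.
Let G := (2 ^ (size T + (k + K)) * 2 ^ (size T + (k + K))) ^ q.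

Lemma size_fixedX : size (fixedX e V T k) <= size T + P * (k + K).
Proof.
rewrite size_cat leq_add2l; apply: leq_trans (size_flatten_map_in size_contrib) _.
by rewrite leq_mul2r selected_bound orbT.
Qed.

Lemma size_pathsX : size (pathsX e V T k) <= P * (K * N).
Proof.
apply: (@leq_trans (count (fun d => d \in take k (twins d)) reps * (K * N))).
  apply: size_flatten_map_in => d Hd; case Pd : (poor e V T k d) => //.
  by case/and3P: (Pd) => -> _ _; apply: size_cpaths.
by rewrite leq_mul2r selected_bound orbT.
Qed.

Lemma size_glev_poor d m l : d \in reps -> poor e V T k d -> m <= q ->
  size (glev e (T ++ cfixed e V T d) m l) <= G.
Proof.
move=> Hd Pd Hm; apply: leq_trans (size_glev _ _ _ _) _.
have H : 2 ^ size (T ++ cfixed e V T d) <= 2 ^ (size T + (k + K)).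
  by rewrite leq_pexp2l // size_cat leq_add2l size_cfixed.
apply: leq_trans (_ : (2 ^ size (T ++ cfixed e V T d) * 2 ^ size (T ++ cfixed e V T d)) ^ q <= _).
  by rewrite leq_pexp2l // muln_gt0 expn_gt0.
by rewrite leq_exp // leq_mul.
Qed.

Lemma size_contribX d : d \in reps ->
  size (contribX e V T k q d) <= if d \in take k (twins d) then K * N * (q * G) else 0.
Proof.
move=> Hd; rewrite /contribX; case Pd : (poor e V T k d) => //; case/and3P: (Pd) => -> _ _.
apply: (@leq_trans (count xpredT (cpaths e V T d) * (q * G))); last first.
  by rewrite count_predT leq_mul2r size_cpaths ?orbT.
apply: size_flatten_map_le => l.
apply: (@leq_trans (count xpredT (iota 1 q) * G)); last by rewrite count_predT size_iota.
apply: size_flatten_map_in => m; rewrite mem_iota add1n ltnS => /andP[_ Hm].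
by rewrite size_map; apply: size_glev_poor.
Qed.

Lemma size_candidates : size (candidates e V T k q) <= size T + P * (k + K) + P * (K * N * (q * G)).
Proof.
rewrite size_cat leq_add ?size_fixedX //; apply: leq_trans (size_flatten_map_in size_contribX) _.
by rewrite leq_mul2r selected_bound orbT.
Qed.

End CandidateSizes.

(** The preceding bounds as functions of the number [t] of terminals. They grow with [t], so that
    [t] may be replaced by twice the number of robots, which leaves functions of the parameter
    alone. *)
Definition core_bound t k := let N := k + t in N + N * (N + 4) + 1.
Definition fixed_bound t k := t + 2 ^ t * k * (k + core_bound t k).
Definition paths_bound t k := 2 ^ t * k * (core_bound t k * (k + t)).
Definition move_bound t k := k.+1 * (fixed_bound t k + paths_bound t k * k) ^ k.
Definition level_bound t k q := (2 ^ (t + (k + core_bound t k)) * 2 ^ (t + (k + core_bound t k))) ^ q.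
Definition candidate_bound t k q := fixed_bound t k + paths_bound t k * (q * level_bound t k q).

Lemma core_bound_mono t t' k : t <= t' -> core_bound t k <= core_bound t' k.
Proof. by move=> H; do ?[apply: leq_add | apply: leq_mul]. Qed.

Lemma fixed_bound_mono t t' k : t <= t' -> fixed_bound t k <= fixed_bound t' k.
Proof. by move=> H; rewrite /fixed_bound !(leq_add, leq_mul) ?core_bound_mono // leq_pexp2l. Qed.

Lemma paths_bound_mono t t' k : t <= t' -> paths_bound t k <= paths_bound t' k.
Proof. by move=> H; rewrite /paths_bound !(leq_add, leq_mul) ?core_bound_mono // leq_pexp2l. Qed.

Lemma move_bound_mono t t' k : t <= t' -> move_bound t k <= move_bound t' k.
Proof.
move=> H; rewrite /move_bound leq_mul2l orFb leq_exp //.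
by apply: leq_add; [exact: fixed_bound_mono | apply: leq_mul => //; exact: paths_bound_mono].
Qed.

Lemma level_bound_mono t t' k q : t <= t' -> level_bound t k q <= level_bound t' k q.
Proof.
by move=> H; rewrite /level_bound leq_exp // leq_mul // leq_pexp2l // leq_add // leq_add2l core_bound_mono.
Qed.

Lemma candidate_bound_mono t t' k q : t <= t' -> candidate_bound t k q <= candidate_bound t' k q.
Proof.
move=> H; apply: leq_add; first exact: fixed_bound_mono.
by apply: leq_mul; [exact: paths_bound_mono | apply: leq_mul => //; exact: level_bound_mono].
Qed.

Section TowerBounds.
Variable t : nat -> nat.
Hypothesis Ht : TB t.

Lemma TB_core_bound : TB (fun k => core_bound (t k) k).
Proof.
have Hk := TB_id; have HN := TB_add Hk Ht; rewrite /core_bound.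
apply: TB_add (TB_const 1); apply: TB_add => //; apply: TB_mul => //; exact: TB_add (TB_const 4).
Qed.

Lemma TB_fixed_bound : TB (fun k => fixed_bound (t k) k).
Proof.
have Hk := TB_id; apply: TB_add => //; apply: TB_mul; last exact: TB_add Hk TB_core_bound.
by apply: TB_mul Hk; apply: TB_exp2.
Qed.

Lemma TB_paths_bound : TB (fun k => paths_bound (t k) k).
Proof.
have Hk := TB_id; apply: TB_mul; last by apply: TB_mul (TB_core_bound) _; apply: TB_add.
by apply: TB_mul Hk; apply: TB_exp2.
Qed.

Lemma TB_move_bound : TB (fun k => move_bound (t k) k).
Proof.
have Hk := TB_id; apply: TB_mul; first exact: TB_S.
by apply: TB_pow => //; apply: TB_add TB_fixed_bound _; apply: TB_mul TB_paths_bound Hk.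
Qed.

Lemma TB_level_bound q : TB q -> TB (fun k => level_bound (t k) k (q k)).
Proof.
move=> Hq; apply: TB_pow => //.
by apply: TB_mul; apply: TB_exp2; apply: TB_add => //; apply: TB_add TB_core_bound; apply: TB_id.
Qed.

Lemma TB_candidate_bound q : TB q -> TB (fun k => candidate_bound (t k) k (q k)).
Proof.
move=> Hq; apply: TB_add TB_fixed_bound _; apply: TB_mul TB_paths_bound _; apply: TB_mul => //.
exact: TB_level_bound.
Qed.

End TowerBounds.

Lemma movebound_le e V T k : symmetric e -> uniq V -> movebound e V T k <= move_bound (size T) k.
Proof.
move=> Hs Hu; rewrite /movebound /move_bound leq_mul2l orFb leq_exp // leq_add //; first exact: size_fixedX.
by rewrite leq_mul //; apply: size_pathsX.
Qed.

Lemma candidates_le e V T k q : symmetric e -> uniq V ->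
  size (candidates e V T k q) <= candidate_bound (size T) k q.
Proof.
move=> Hs Hu; apply: leq_trans (size_candidates _ _ _ Hs Hu) _.
by rewrite /candidate_bound /fixed_bound /paths_bound /level_bound mulnA.
Qed.

(** * The construction is polynomial *)

Section FoldGrowth.
Variables X B C : encType.

(** Each round adds at most the size of one object [G x] of polynomial size, so the growth is
    additive rather than multiplicative. The invariant may refer to the number of rounds
    performed. *)
Lemma FP_foldl_inv (P : X -> nat -> B -> Prop) (f : X -> B -> C -> B) (b0 : X -> B) (l : X -> seq C) (D : encType) (G : X -> D) :
  FP (fun x : X * (B * C) => f x.1 x.2.1 x.2.2) -> FP b0 -> FP l -> FP G ->
  (forall x, P x 0 (b0 x)) -> (forall x n b c, n < size (l x) -> P x n b -> P x n.+1 (f x b c)) ->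
  (forall x n b c, n < size (l x) -> P x n b -> sz (f x b c) <= sz b + sz (G x)) ->
  FP (fun x => foldl (f x) (b0 x) (l x)).
Proof.
move=> Hf H0 Hl HG P0 PS L; apply: FP_foldl => //.
have [p0 [Hp0 _ L0]] := FP_sz H0; have [pl [Hpl _ Ll]] := FP_sz Hl; have [pg [Hpg _ Lg]] := FP_sz HG.
exists (fun n => p0 n + pl n * pg n); first by apply: polyb_add => //; apply: polyb_mul.
move=> x l1 l2 E; have [HP HS] : P x (size l1) (foldl (f x) (b0 x) l1) /\
    sz (foldl (f x) (b0 x) l1) <= sz (b0 x) + size l1 * sz (G x).
  elim/last_ind: l1 l2 E => [|l1 h IH] l2 E; first by rewrite addn0.
  rewrite cat_rcons in E; have [HP HS] := IH _ E.
  have S1 : size l1 < size (l x) by rewrite E size_cat /= addnS ltnS leq_addr.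
  rewrite foldl_rcons size_rcons; split; first exact: PS.
  by apply: leq_trans (L _ _ _ _ S1 HP) _; rewrite mulSnr addnA leq_add2r.
apply: leq_trans HS _; apply: leq_add (L0 x) _; apply: leq_mul (Lg x).
by apply: leq_trans (Ll x); apply: leq_trans (ltnW (size_sz _)); rewrite E size_cat leq_addr.
Qed.

Lemma FP_foldl_growth (f : X -> B -> C -> B) (b0 : X -> B) (l : X -> seq C) (D : encType) (G : X -> D) :
  FP (fun x : X * (B * C) => f x.1 x.2.1 x.2.2) -> FP b0 -> FP l -> FP G ->
  (forall x b c, sz (f x b c) <= sz b + sz (G x)) ->
  FP (fun x => foldl (f x) (b0 x) (l x)).
Proof.
move=> Hf H0 Hl HG L.
by apply: (FP_foldl_inv (P := fun _ _ _ => True) Hf H0 Hl HG) => // x n b c _ _; apply: L.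
Qed.

End FoldGrowth.

Lemma sz_filter (A : encType) (p : pred A) l : sz (filter p l) <= sz l.
Proof. by elim: l => //= x l IH; case: (p x); rewrite !sz_cons; lia. Qed.

Lemma sz_take (A : encType) n (l : seq A) : sz (take n l) <= sz l.
Proof. by elim: l n => [|x l IH] [|n] //=; rewrite !sz_cons !ltnS leq_add2l. Qed.

Definition adjE (E : seq (nat * nat)) (u v : nat) := ((u, v) \in E) || ((v, u) \in E).

Lemma FP_last (X : encType) (l : X -> seq nat) : FP l -> FP (fun x => last 0 (l x)).
Proof.
move=> Hl; apply: FP_ext (_ : FP (fun x => nth 0 (l x) (size (l x) - 1))) _; first by fp.
by move=> x; rewrite -nth_last subn1.
Qed.

Lemma FP_behead (X : encType) (l : X -> seq nat) : FP l -> FP (fun x => behead (l x)).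
Proof.
move=> Hl; apply: FP_ext (_ : FP (fun x => drop 1 (l x))) _; first by fp.
by move=> x; rewrite drop1.
Qed.

Lemma FP_adjE (X : encType) (E : X -> seq (nat * nat)) (u v : X -> nat) : FP E -> FP u -> FP v -> FP (fun x => adjE (E x) (u x) (v x)).
Proof. by move=> *; apply: FP_orb; apply: FP_mem2. Qed.

Lemma FP_del (X : encType) (D : X -> seq nat) (u : X -> nat) : FP D -> FP u -> FP (fun x => del (D x) (u x)).
Proof. by rewrite /del => *; fp. Qed.

Ltac fp_defs ::= first [ apply: FP_last | apply: FP_behead | apply: FP_adjE | apply: FP_del ].

Lemma FP_reachset (X : encType) (E : X -> seq (nat * nat)) (D : X -> seq nat) (u : X -> nat) : FP E -> FP D -> FP u -> FP (fun x => reachset (adjE (E x)) (D x) (u x)).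
Proof.
move=> HE HD Hu; rewrite /reachset /reach_step; apply: (FP_foldl_growth (G := D)) => //; try by fp.
by move=> x b c; apply: leq_trans (sz_filter _ _) (leq_addl _ _).
Qed.

Lemma FP_deg (X : encType) (E : X -> seq (nat * nat)) (D : X -> seq nat) (u : X -> nat) : FP E -> FP D -> FP u -> FP (fun x => deg (adjE (E x)) (D x) (u x)).
Proof. by rewrite /deg => *; fp. Qed.

Lemma FP_nb (X : encType) (E : X -> seq (nat * nat)) (D S : X -> seq nat) : FP E -> FP D -> FP S -> FP (fun x => nb (adjE (E x)) (D x) (S x)).
Proof. by rewrite /nb => *; fp. Qed.

Ltac fp_defs ::= first [ apply: FP_last | apply: FP_behead | apply: FP_adjE | apply: FP_del
  | apply: FP_reachset | apply: FP_deg | apply: FP_nb ].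

Lemma FP_goodcore (X : encType) (E : X -> seq (nat * nat)) (D S : X -> seq nat) : FP E -> FP D -> FP S -> FP (fun x => goodcore (adjE (E x)) (D x) (S x)).
Proof. by rewrite /goodcore /connb => *; fp. Qed.

Lemma FP_coreof (X : encType) (E : X -> seq (nat * nat)) (D S : X -> seq nat) : FP E -> FP D -> FP S -> FP (fun x => coreof (adjE (E x)) (D x) (S x)).
Proof.
move=> HE HD HS; rewrite /coreof; apply: (FP_foldl_growth (G := D)) => //.
  by do ! first [apply: FP_goodcore | fp1].
by move=> x b c; case: ifP => _; rewrite ?leq_addr // (leq_trans (sz_filter _ _)) ?leq_addr.
Qed.

Lemma FP_walk (X : encType) (E : X -> seq (nat * nat)) (D : X -> seq nat) (u : X -> nat) : FP E -> FP D -> FP u -> FP (fun x => walk (adjE (E x)) (D x) (u x)).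
Proof.
move=> HE HD Hu; rewrite /walk /ext; apply: (FP_foldl_growth (G := D)) => //; try by fp.
move=> x b c; have := sz_cat b (take 1 [seq u0 <- D x | adjE (E x) (last 0 b) u0 && (u0 \notin b)]).
have := leq_trans (sz_take 1 _) (sz_filter (fun u0 => adjE (E x) (last 0 b) u0 && (u0 \notin b)) (D x)).
by move=> H1 H2; apply: ltnW; rewrite H2 leq_add2l.
Qed.

Lemma size_walk e D u : size (walk e D u) <= (size D).+1.
Proof.
have H l s : size (foldl (fun l _ => l ++ take 1 (ext e D l)) s l) <= size s + size l.
  elim: l s => [|h l IH] s /=; first by rewrite addn0.
  apply: leq_trans (IH _) _; by rewrite size_cat -addnA leq_add2l -[in leqRHS]add1n leq_add2r size_take_min geq_minl.
by rewrite -add1n; apply: H.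
Qed.

Lemma FP_paths (X : encType) (E : X -> seq (nat * nat)) (D : X -> seq nat) : FP E -> FP D -> FP (fun x => paths (adjE (E x)) (D x)).
Proof.
(* The two zeros pay for the start of the walk and for the cell that holds the walk. *)
move=> HE HD; rewrite /paths /ends; apply: (FP_foldl_growth (G := fun x => 0 :: 0 :: D x)) => //; try by fp.
  by do ! first [apply: FP_walk | fp1].
move=> x b c; case: ifP => _; first by rewrite leq_addr.
have := sz_cat b [:: walk (adjE (E x)) (D x) c]; rewrite !sz_cons.
rewrite !sz_natseq sz_nat (_ : sz [::] = 1) //.
by have := size_walk (adjE (E x)) (D x) c; move: (size _) (size _) (sz _) (sz _) => a a' b1 b2; lia.
Qed.

Ltac fp_defs ::= first [ apply: FP_last | apply: FP_behead | apply: FP_adjE | apply: FP_del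
  | apply: FP_reachset | apply: FP_deg | apply: FP_nb | apply: FP_coreof | apply: FP_paths ].

Lemma FP_nexts (X : encType) (E : X -> seq (nat * nat)) (F s : X -> seq nat) : FP E -> FP F -> FP s ->
  FP (fun x => nexts (adjE (E x)) (F x) (s x)).
Proof.
(* The index [i] is written as the length of a prefix, because ranges must end at the length of a
   list. *)
move=> HE HF Hs; apply: FP_ext (_ : FP (fun x => [seq drop i (s x) | i <- [seq i <- iota 0 (size (s x)) |
   all (fun j => ~~ same_sig (adjE (E x)) (F x) (s x) j i) (iota 0 (size (take i (s x))))]])) _.
  by rewrite /same_sig /typ /seen; fp.
move=> x; congr map; apply: eq_in_filter => i; rewrite mem_iota => /andP[_ Hi].
by rewrite size_takel // ltnW.
Qed.

(* [glev] and [words] with every intermediate list cut off at length [cap], which keeps them polynomial. *)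
Definition glev_cap e F cap (u l : seq nat) :=
  foldl (fun lev _ => take cap (flatten [seq nexts e F (behead s) | s <- lev])) [:: 0 :: l] u.

Definition words_cap (A : Type) cap (J : seq nat) (u : seq A) :=
  foldl (fun W _ => take cap (flatten [seq [seq x :: w | w <- W] | x <- J])) [:: [::]] u.

Lemma glev_capE e F cap u l : (forall m, m <= size u -> size (glev e F m l) <= cap) ->
  glev_cap e F cap u l = glev e F (size u) l.
Proof.
elim/last_ind: u => [//|u h IH]; rewrite size_rcons /glev_cap foldl_rcons => H.
rewrite -/(glev_cap e F cap u l) IH; last by move=> m Hm; apply: H; apply: leqW.
by rewrite take_oversize //; apply: (H _ (leqnn _)).
Qed.

Lemma words_capE (A : Type) cap J (u : seq A) : (forall m, m <= size u -> size J ^ m <= cap) ->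
  words_cap cap J u = words (size u) J.
Proof.
elim/last_ind: u => [//|u h IH]; rewrite size_rcons /words_cap foldl_rcons => H.
rewrite -/(words_cap cap J u) IH; last by move=> m Hm; apply: H; apply: leqW.
by rewrite take_oversize //; have := H _ (leqnn _); rewrite -size_words.
Qed.

Lemma sz_all (A : encType) (l : seq (seq A)) N : all (fun s => sz s <= N) l -> sz l <= size l * N.+1 + 1.
Proof.
elim: l => //= x l IH /andP[Hx /IH Hl]; rewrite sz_cons mulSn; move: Hx Hl; move: (sz x) (sz l) (_ * _) => a b c; lia.
Qed.

Lemma all_take (A : Type) (p : pred A) n s : all p s -> all p (take n s).
Proof. by rewrite -{1}(cat_take_drop n s) all_cat => /andP[]. Qed.

Lemma sz_take_all (A : encType) (l : seq (seq A)) N cap : all (fun s => sz s <= N) l ->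
  sz (take cap l) <= cap * N.+1 + 1.
Proof.
move=> Hl; apply: leq_trans (_ : size (take cap l) * N.+1 + 1 <= _).
  by apply: sz_all; apply: all_take.
by rewrite leq_add2r leq_mul2r size_take_min geq_minl.
Qed.

Lemma sz_blocks (A : eqType) (u : seq A) (l : seq nat) : sz (flatten [seq l | _ <- u]) = (size u * size l).*2.+1.
Proof.
rewrite sz_natseq; congr _.*2.+1; elim: u => //= _ u IH.
by rewrite size_cat IH mulSn.
Qed.

Lemma FP_glev_cap (X : encType) (E : X -> seq (nat * nat)) (F cap u l : X -> seq nat) : FP E -> FP F -> FP cap -> FP u -> FP l ->
  FP (fun x => glev_cap (adjE (E x)) (F x) (size (cap x)) (u x) (l x)).
Proof.
move=> HE HF Hc Hu Hl; rewrite /glev_cap.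
apply: (FP_foldl_inv (P := fun x _ lev => all (fun s => sz s <= sz (0 :: l x)) lev)
  (G := fun x => flatten [seq 0 :: 0 :: 0 :: 0 :: l x | _ <- cap x])) => //; try by fp.
- by do ! first [apply: FP_nexts | fp1].
- by move=> x; rewrite /= leqnn.
- move=> x _ lev h _ A; apply: all_take; apply/allP=> s /flatten_mapP[r /(allP A) Hr /mapP[i _ ->]].
  by apply: leq_trans Hr; rewrite !sz_natseq ltnS leq_double size_drop (leq_trans (leq_subr _ _)) // size_behead leq_pred.
move=> x _ lev h _ A; apply: leq_trans (sz_take_all (N := sz (0 :: l x)) _ _) _.
  apply/allP=> s /flatten_mapP[r /(allP A) Hr /mapP[i _ ->]].
  by apply: leq_trans Hr; rewrite !sz_natseq ltnS leq_double size_drop (leq_trans (leq_subr _ _)) // size_behead leq_pred.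
rewrite sz_blocks sz_natseq /=; have := sz_gt0 lev; move: (sz lev) (size (cap x)) (size (l x)) => a b c.
by rewrite -addnn; nia.
Qed.

Lemma FP_words_cap (X A : encType) (cap J : X -> seq nat) (u : X -> seq A) : FP cap -> FP J -> FP u ->
  FP (fun x => words_cap (size (cap x)) (J x) (u x)).
Proof.
move=> Hc HJ Hu; rewrite /words_cap.
apply: (FP_foldl_inv (P := fun x n W => all (fun s => size s == n) W)
  (G := fun x => flatten [seq 0 :: 0 :: [seq 0 | _ <- u x] | _ <- cap x])) => //; try by fp.
- move=> x n W h _ A1; apply: all_take; apply/allP=> s /flatten_mapP[y _ /mapP[w /(allP A1) /eqP Hw ->]].
  by rewrite /= Hw.
move=> x n W h Hn A1; apply: leq_trans (sz_take_all (N := (size (u x)).*2.+1) _ _) _.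
  apply/allP=> s /flatten_mapP[y _ /mapP[w /(allP A1) /eqP Hw ->]].
  by rewrite sz_natseq ltnS leq_double /= Hw.
rewrite sz_blocks /= size_map; have := sz_gt0 W; move: (sz W) (size (cap x)) (size (u x)) => a b c.
by rewrite -addnn; nia.
Qed.
Lemma FP_component (X : encType) (E : X -> seq (nat * nat)) (V T : X -> seq nat) (d : X -> nat) :
  FP E -> FP V -> FP T -> FP d -> FP (fun x => comp (adjE (E x)) (V x) (T x) (d x)).
Proof. by rewrite /comp /nonterm => *; fp. Qed.

Lemma FP_nbT (X : encType) (E : X -> seq (nat * nat)) (V T : X -> seq nat) (d : X -> nat) :
  FP E -> FP V -> FP T -> FP d -> FP (fun x => nbT (adjE (E x)) (V x) (T x) (d x)).
Proof. by move=> *; apply: FP_nb => //; apply: FP_component. Qed.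

Lemma FP_rest (X : encType) (E : X -> seq (nat * nat)) (V T : X -> seq nat) (d : X -> nat) :
  FP E -> FP V -> FP T -> FP d -> FP (fun x => rest (adjE (E x)) (V x) (T x) (d x)).
Proof.
rewrite /rest /restof => *; apply: FP_filter; last exact: FP_component.
by do ! first [apply: FP_component | apply: FP_nbT | fp1].
Qed.

Lemma FP_core (X : encType) (E : X -> seq (nat * nat)) (V T : X -> seq nat) (d : X -> nat) :
  FP E -> FP V -> FP T -> FP d ->
  FP (fun x => coreof (adjE (E x)) (comp (adjE (E x)) (V x) (T x) (d x)) (nbT (adjE (E x)) (V x) (T x) (d x))).
Proof. by move=> *; apply: FP_coreof => //; [apply: FP_component | apply: FP_nbT]. Qed.

Lemma FP_nonterm (X : encType) (V T : X -> seq nat) : FP V -> FP T -> FP (fun x => nonterm (V x) (T x)).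
Proof. by rewrite /nonterm => *; fp. Qed.

Ltac fp_graph := first [ apply: FP_last | apply: FP_behead | apply: FP_adjE | apply: FP_del
  | apply: FP_nonterm | apply: FP_component | apply: FP_nbT | apply: FP_rest | apply: FP_core
  | apply: FP_reachset | apply: FP_deg | apply: FP_nb | apply: FP_paths
  | apply: FP_glev_cap | apply: FP_words_cap ].

Ltac fp_defs ::= fp_graph.

Lemma FP_reps (X : encType) (E : X -> seq (nat * nat)) (V T : X -> seq nat) :
  FP E -> FP V -> FP T -> FP (fun x => reps (adjE (E x)) (V x) (T x)).
Proof. by rewrite /reps /repv => *; fp. Qed.

Lemma FP_cfixed (X : encType) (E : X -> seq (nat * nat)) (V T : X -> seq nat) (d : X -> nat) :
  FP E -> FP V -> FP T -> FP d -> FP (fun x => cfixed (adjE (E x)) (V x) (T x) (d x)).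
Proof.
move=> HE HV HT Hd; apply: FP_cat; first exact: FP_rest.
by rewrite /knots /knot; fp.
Qed.

Lemma FP_cpaths (X : encType) (E : X -> seq (nat * nat)) (V T : X -> seq nat) (d : X -> nat) :
  FP E -> FP V -> FP T -> FP d -> FP (fun x => cpaths (adjE (E x)) (V x) (T x) (d x)).
Proof. by move=> HE HV HT Hd; apply: FP_paths => //; rewrite /links /knot; fp. Qed.

Ltac fp_defs ::= first [ apply: FP_reps | apply: FP_cfixed | apply: FP_cpaths | fp_graph ].

Lemma FP_twins (X : encType) (E : X -> seq (nat * nat)) (V T : X -> seq nat) (d : X -> nat) :
  FP E -> FP V -> FP T -> FP d -> FP (fun x => twins (adjE (E x)) (V x) (T x) (d x)).
Proof. by rewrite /twins => *; fp. Qed.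

Ltac fp_cand := first [ apply: FP_reps | apply: FP_cfixed | apply: FP_cpaths | apply: FP_twins | fp_graph ].
Ltac fp_defs ::= fp_cand.

(** The length of [U] plays the role of [q]; its non-empty prefixes serve as the unary level
    numbers. *)
Definition greedy_cap e V T cap (U : seq nat) d l :=
  flatten [seq [seq head 0 r | r <- glev_cap e (T ++ cfixed e V T d) cap (take m.+1 U) l] | m <- iota 0 (size U)].
Definition contribX_cap e V T k cap U d :=
  if poor e V T k d then flatten [seq greedy_cap e V T cap U d l | l <- cpaths e V T d] else [::].
Definition candidates_cap e V T k cap U :=
  fixedX e V T k ++ flatten [seq contribX_cap e V T k cap U d | d <- reps e V T].

Section FPcandidates.
Variable X : encType.
Variables (E : X -> seq (nat * nat)) (V T cap U : X -> seq nat) (k : X -> nat).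
Hypotheses (HE : FP E) (HV : FP V) (HT : FP T) (Hcap : FP cap) (HU : FP U) (Hk : FP k).

Lemma FP_fixedX : FP (fun x => fixedX (adjE (E x)) (V x) (T x) (k x)).
Proof. by rewrite /fixedX /contrib /crowded /univ; fp. Qed.

Lemma FP_candidates_cap : FP (fun x => candidates_cap (adjE (E x)) (V x) (T x) (k x) (size (cap x)) (U x)).
Proof.
apply: FP_cat; first exact: FP_fixedX.
by rewrite /contribX_cap /poor /crowded /univ /greedy_cap; fp.
Qed.

End FPcandidates.

Lemma candidates_capE e V T k cap U : symmetric e -> uniq V -> level_bound (size T) k (size U) <= cap ->
  candidates_cap e V T k cap U = candidates e V T k (size U).
Proof.
move=> e_sym V_uniq Hcap; congr (_ ++ flatten _); apply/eq_in_map => d Hd.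
rewrite /contribX_cap /contribX; case: ifP => // Pd; congr flatten; apply: eq_map => l.
rewrite /greedy_cap /greedyX -[1]/(1 + 0) iotaDl -map_comp; congr flatten; apply/eq_in_map => m.
rewrite mem_iota => /andP[_ Hm] /=; rewrite glev_capE size_takel //.
move=> j Hj; apply: leq_trans Hcap; apply: (size_glev_poor (q := size U) e_sym V_uniq) => //.
exact: leq_trans Hj Hm.
Qed.

(** * Breadth-first search on the candidate configurations *)

Definition can_move e V (c c' : seq nat) := has (fun i =>
  [&& all (fun j => (j == i) || (nth 0 c' j == nth 0 c j)) (iota 0 (size c)), nth 0 c' i != nth 0 c i
    & nth 0 c' i \in reachset e [seq v <- V | v \notin others c i] (nth 0 c i)]) (iota 0 (size c)).

Definition search e V (W : seq (seq nat)) (c0 rounds : seq nat) :=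
  foldl (fun R (_ : nat) => [seq c <- W | has (fun c' => (c' == c) || can_move e V c' c) R]) [seq c <- W | c0 == c] rounds.

Section Search.
Variables (e : rel nat) (V : seq nat).
Hypothesis e_sym : symmetric e.

Lemma can_moveP (c c' : seq nat) : size c' = size c -> reflect (mv e V xpredT c c') (can_move e V c c').
Proof.
move=> S; apply: (iffP hasP) => [[i]|[i [y [Hi Ny _ C E]]]].
  rewrite mem_iota => /andP[_ Hi] /and3P[/allP A N /(reachP e_sym) C].
  exists i, (nth 0 c' i); split=> //.
    by apply: conn_mono C => v; rewrite mem_filter andbC.
  apply: (@eq_from_nth _ 0) => [|j Hj]; first by rewrite size_set_nth (maxn_idPr _).
  rewrite nth_set_nth /=; case: eqP => [->//|Nj].
  have := A j; rewrite mem_iota -S => /(_ Hj) /orP[/eqP //|/eqP //].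
have Ei : nth 0 c' i = y by rewrite E nth_set_nth /= eqxx.
exists i; first by rewrite mem_iota.
apply/and3P; split; rewrite ?Ei //.
  by apply/allP=> j _; rewrite E nth_set_nth /=; case: eqP => [->|_]; rewrite ?eqxx ?orbT.
by apply/(reachP e_sym); apply: conn_mono C => v; rewrite mem_filter andbC.
Qed.

Lemma steps_last Y m c d : steps e V Y m.+1 c d -> exists2 c1, steps e V Y m c c1 & mv e V Y c1 d.
Proof.
move: {-1}m.+1 (erefl m.+1) => n E H; elim: H m E => // {n c d} n c c1 d M H IH m [E].
case: n H IH E => [|n] H IH ->.
  by inversion H; subst; exists c => //; apply: steps0.
have [c2 H2 M2] := IH n erefl; exists c2 => //; exact: stepsS M H2.
Qed.

Lemma steps_words (X : seq nat) m c d k : c \in words k X -> steps e V (fun v => v \in X) m c d -> d \in words k X.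
Proof.
move=> Hc H; elim: H Hc => // {m d}n c1 c2 c3 [i [y [Hi Ny Yy C E]]] _ IH; rewrite mem_words => /andP[/eqP S /allP A].
apply: IH; rewrite mem_words E size_set_nth (maxn_idPr Hi) S eqxx; apply/allP => v /(nthP 0) [j].
rewrite size_set_nth nth_set_nth /= => Hj <-; case: eqP => // _; apply/A/mem_nth.
by move: Hj; rewrite (maxn_idPr Hi).
Qed.

Section Words.
Variables (W : seq (seq nat)) (k : nat) (X : seq nat) (c0 : seq nat).
Hypothesis WE : W = words k X.

Lemma search_sub rounds c : c \in search e V W c0 rounds -> c \in W.
Proof.
rewrite /search; case/lastP: rounds => [|l h]; first by rewrite mem_filter => /andP[].
by rewrite foldl_rcons mem_filter => /andP[].
Qed.

(** Every round makes genuine moves in the whole graph, so a positive answer is right whatever the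
    candidates are. *)
Lemma search_sound rounds c : c \in search e V W c0 rounds ->
  exists2 m, m <= size rounds & steps e V xpredT m c0 c.
Proof.
elim/last_ind: rounds c => [|l h IH] c.
  by rewrite mem_filter => /andP[/eqP<- _]; exists 0 => //; apply: steps0.
rewrite /search foldl_rcons mem_filter size_rcons => /andP[/hasP[c' Hc' Hm] HW].
have [m Lm Hs] := IH _ Hc'.
case/orP: Hm => [/eqP<-|Hm]; first by exists m => //; apply: leqW.
exists (m + 1); first by rewrite addn1.
apply: steps_trans Hs _; apply: stepsS (steps0 _ _ _ _); apply/can_moveP => //.
have := search_sub Hc'; move: HW; rewrite WE !mem_words => /andP[/eqP-> _] /andP[/eqP-> _] //.
Qed.

Lemma search_complete rounds m c : m <= size rounds -> c0 \in W -> steps e V (fun v => v \in X) m c0 c ->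
  c \in search e V W c0 rounds.
Proof.
move=> + Hc0; elim/last_ind: rounds m c => [|l h IH] m c.
  rewrite leqn0 => /eqP-> H; inversion H; subst; by rewrite mem_filter eqxx.
rewrite size_rcons => Lm H; have Hc : c \in W by move: Hc0; rewrite WE => /steps_words; apply; exact: H.
rewrite /search foldl_rcons mem_filter Hc andbT; apply/hasP.
case: m Lm H => [|m] Lm H.
  by inversion H; subst; exists c; rewrite ?eqxx //; apply: (IH 0) => //; apply: steps0.
have [c1 H1 M] := steps_last H; exists c1; first exact: (IH m).
apply/orP; right; apply/can_moveP; first exact: size_mv M.
by case: M => i [y [Hi Ny _ C E]]; exists i, y.
Qed.

End Words.
End Search.

(** * The decision procedure on decoded instances *)

Definition robot := (nat * (nat * nat))%type.
Definition start_of (rob : seq robot) := [seq r.1 | r <- rob].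
Definition target_of (rob : seq robot) := [seq r.2.2 | r <- [seq r <- rob | r.2.1 == 1]].
Definition terminals rob := undup (start_of rob ++ target_of rob).
(** Only terminals and ends of edges are listed: the number of vertices of the instance may be
    exponential in its size, and isolated vertices that are not terminals are never visited. *)
Definition vertices (E : seq (nat * nat)) rob :=
  undup ((start_of rob ++ target_of rob) ++ flatten [seq [:: p.1; p.2] | p <- E]).
Definition goal_test (rob : seq robot) (c : seq nat) := all (fun i =>
  ((nth (0, (0, 0)) rob i).2.1 == 1) ==> (nth 0 c i == (nth (0, (0, 0)) rob i).2.2)) (iota 0 (size rob)).

(** The search runs for the minimum of [ell] and the length of [U2], since [ell] may be exponential
    while normal forms are short. The list [rob] also serves as the unary number of robots. *)
Definition solve (E : seq (nat * nat)) (rob : seq robot) (ell : nat) (U1 U2 : seq nat) : nat :=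
  if has (goal_test rob) (search (adjE E) (vertices E rob)
    (words_cap (size U2) (candidates_cap (adjE E) (vertices E rob) (terminals rob) (size rob) (size U2) U1) rob)
    (start_of rob) [seq i <- iota 0 (size U2) | i < ell]) then 1 else 0.

Lemma FP_can_move (X : encType) (E : X -> seq (nat * nat)) (V c c' : X -> seq nat) :
  FP E -> FP V -> FP c -> FP c' -> FP (fun x => can_move (adjE (E x)) (V x) (c x) (c' x)).
Proof. by rewrite /can_move /others => HE HV Hc Hc'; fp. Qed.

Ltac fp_search := first [ apply: FP_can_move | apply: FP_candidates_cap | fp_cand ].
Ltac fp_defs ::= fp_search.

Lemma FP_search (X : encType) (E : X -> seq (nat * nat)) (V c0 l : X -> seq nat) (W : X -> seq (seq nat)) :
  FP E -> FP V -> FP W -> FP c0 -> FP l -> FP (fun x => search (adjE (E x)) (V x) (W x) (c0 x) (l x)).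
Proof.
move=> HE HV HW Hc Hl; apply: (FP_foldl_growth (G := W)) => //; try by fp.
by move=> x b c; apply: leq_trans (sz_filter _ _) (leq_addl _ _).
Qed.

Lemma FP_solve (X : encType) (E : X -> seq (nat * nat)) (rob : X -> seq robot) (ell : X -> nat) (U1 U2 : X -> seq nat) :
  FP E -> FP rob -> FP ell -> FP U1 -> FP U2 -> FP (fun x => solve (E x) (rob x) (ell x) (U1 x) (U2 x)).
Proof.
move=> HE Hr Hl H1 H2; rewrite /solve /goal_test.
have HT : FP (fun x => terminals (rob x)) by rewrite /terminals /start_of /target_of; fp.
have HV : FP (fun x => vertices (E x) (rob x)) by rewrite /vertices /start_of /target_of; fp.
have HS : FP (fun x => start_of (rob x)) by rewrite /start_of; fp.
apply: FP_if; [|exact: FP_const|exact: FP_const].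
apply: FP_has; first by fp.
by apply: FP_search => //; fp.
Qed.

Lemma adjE_sym E : symmetric (adjE E).
Proof. by move=> u v; rewrite /adjE orbC. Qed.

Lemma adjE_vertices E rob u v : adjE E u v -> v \in vertices E rob.
Proof.
move=> H; rewrite mem_undup mem_cat; apply/orP; right; apply/flatten_mapP.
by case/orP: H => H; [exists (u, v) | exists (v, u)]; rewrite // !inE eqxx ?orbT.
Qed.

Lemma size_terminals rob : size (terminals rob) <= (size rob).*2.
Proof.
apply: leq_trans (size_undup _) _; rewrite size_cat !size_map -addnn leq_add2l size_filter.
exact: count_size.
Qed.

(** [U1] provides the number of greedy levels. [U2] is at once the cap on a level, the cap on the
    list of configurations and a bound on the rounds; under the hypotheses neither cap cuts anything
    off. *)
Lemma solve_correct E rob ell U1 U2 : let k := size rob in let t := k.*2 in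
  uniq (start_of rob) -> k + move_bound t k <= size U1 -> level_bound t k (size U1) <= size U2 ->
  (candidate_bound t k (size U1)).+1 ^ k <= size U2 -> move_bound t k <= size U2 ->
  solve E rob ell U1 U2 = 1 <-> exists m c,
    [/\ m <= ell, steps (adjE E) (vertices E rob) xpredT m (start_of rob) c & goal_test rob c].
Proof.
move=> k t Us B1 B2 B3 B4; have e_sym := adjE_sym E.
set V := vertices E rob; set T := terminals rob; set c0 := start_of rob.
have V_uniq : uniq V := undup_uniq _.
have ST : size T <= t := size_terminals rob.
have CE : candidates_cap (adjE E) V T k (size U2) U1 = candidates (adjE E) V T k (size U1).
  by apply: candidates_capE => //; apply: leq_trans (level_bound_mono _ _ ST) B2.
have SX : size (candidates (adjE E) V T k (size U1)) <= candidate_bound t k (size U1).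
  by apply: leq_trans (candidates_le _ _ _ e_sym V_uniq) _; apply: candidate_bound_mono.
have WE : words_cap (size U2) (candidates_cap (adjE E) V T k (size U2) U1) rob
    = words k (candidates (adjE E) V T k (size U1)).
  rewrite CE; apply: words_capE => m Hm; apply: leq_trans B3.
  (* The successor keeps the base positive, so that the last power bounds the lists of shorter words
     as well. *)
  apply: leq_trans (_ : (candidate_bound t k (size U1)).+1 ^ m <= _); last by rewrite leq_pexp2l.
  by apply: leq_exp; apply: leqW.
have Sc0 : size c0 = k by rewrite size_map.
have c0T : {subset c0 <= T} by move=> v Hv; rewrite mem_undup mem_cat Hv.
have TV : {subset T <= V} by move=> v; rewrite !mem_undup => Hv; rewrite mem_cat Hv.
have eV u v : adjE E u v -> v \in V by apply: adjE_vertices.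
have Srounds : size [seq i <- iota 0 (size U2) | i < ell] = minn ell (size U2).
  rewrite size_filter; elim: (size U2) => [|n IH]; first by rewrite minn0.
  rewrite -addn1 iotaD count_cat IH /= addn0 add0n; case: (ltnP n ell) => H; rewrite ?addn1 ?addn0.
    by rewrite (minn_idPr H).
  by rewrite (minn_idPl (leqW H)).
rewrite /solve -/V -/T -/c0 -/k WE; split=> [|[m [c [Lm Hs Hg]]]].
  case: ifP => // /hasP[c Hc Hg] _.
  have [m] := search_sound e_sym erefl Hc; rewrite Srounds leq_min => /andP[Lm _] Hs.
  by exists m, c.
have B1' : k + movebound (adjE E) V T k <= size U1.
  apply: leq_trans B1; rewrite leq_add2l; apply: leq_trans (movebound_le _ _ e_sym V_uniq) _.
  exact: move_bound_mono.
have [m' [d [Ln Lb Hd Ed]]] := normal_form e_sym V_uniq TV eV B1' Us c0T Sc0 Hs.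
rewrite (_ : has _ _ = true) //; apply/hasP; exists d.
  apply: (search_complete e_sym erefl (m := m')) => //.
    rewrite Srounds leq_min (leq_trans Ln Lm) (leq_trans Lb) //.
    apply: leq_trans (movebound_le _ _ e_sym V_uniq) _.
    by apply: leq_trans B4; apply: move_bound_mono.
  rewrite mem_words Sc0 eqxx; apply/allP => v /c0T Hv.
  by rewrite /candidates /fixedX !mem_cat Hv.
apply/allP => i Hi; have := allP Hg i Hi; move: Hi; rewrite mem_iota => /andP[_ Hi].
case F : (_ == 1) => //= /eqP Ei; rewrite Ed // Ei //.
rewrite mem_undup mem_cat; apply/orP; right; apply/mapP; exists (nth (0, (0, 0)) rob i) => //.
by rewrite mem_filter F mem_nth.
Qed.

(** * Instances *)

Section Instances.
Variable I : csmp_instance.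

Definition robots_of : seq robot :=
  [seq (r.1, if r.2 is Some t then (1, t) else (0, 0)) | r <- inst_robots I].
Local Notation E := (inst_edges I).
Local Notation V := (vertices E robots_of).

Lemma start_robots : start_of robots_of = starts I.
Proof. by rewrite /start_of /robots_of /starts -map_comp. Qed.

Lemma goal_robots c : reflect (goal_reached I c) (goal_test robots_of c).
Proof.
have N i : i < inst_k I -> nth (0, (0, 0)) robots_of i =
    ((nth (0, None) (inst_robots I) i).1, if (nth (0, None) (inst_robots I) i).2 is Some t then (1, t) else (0, 0)).
  by move=> Hi; rewrite (nth_map (0, None)).
rewrite /goal_test size_map; apply: (iffP allP) => [H i t Hi Ei|H i].
  by have := H i; rewrite mem_iota => /(_ Hi); rewrite N // Ei => /eqP.
rewrite mem_iota => /andP[_ Hi]; rewrite N //=; have := H i.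
by case: (nth _ _ _).2 => //= t /(_ t Hi erefl) ->.
Qed.

Lemma sliding_mv pos i q pos' : {subset pos <= V} -> sliding_move I pos i q pos' ->
  mv (adjE E) V xpredT pos pos'.
Proof.
move=> posV [[Hi Nq P] [/andP[Nx _] Ho ->]]; set x := nth 0 pos i in Nx P Ho *.
have Lq : last x q \in q by case: q Nq {P Nx Ho} => //= a q _; apply: mem_last.
exists i, (last x q); split=> //; first by apply: contraNneq Nx => Ex; rewrite /x -Ex.
apply/connP; exists q; split=> //; apply/allP=> v Hv; apply/andP; split.
  move: Hv; rewrite inE => /orP[/eqP->|Hv]; first exact/posV/mem_nth.
  elim: q x P Hv {Nq Nx Ho Lq posV} => //= a q IH x /andP[Ha Hq]; rewrite inE => /orP[/eqP->|]; last exact: (IH a).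
  exact: adjE_vertices Ha.
by apply/othersP => -[j [Hj Nj Ev]]; have := Ho j Hj Nj; rewrite -Ev Hv.
Qed.

(** A move asks for a connection only; shortening the walk yields the simple path of a sliding
    move. *)
Lemma mv_sliding pos pos' : mv (adjE E) V xpredT pos pos' -> exists i q, sliding_move I pos i q pos'.
Proof.
case=> i [y [Hi Ny _ /conn_uniq [q [Hq Lq /allP A U]] ->]].
exists i, q; split; split; rewrite ?Lq //.
  by apply: contraNneq Ny => Eq; rewrite -Lq Eq.
by move=> j Hj Nj; apply/negP => /A /andP[_ /othersP]; apply; exists j.
Qed.

Lemma reach_steps m c d : {subset c <= V} -> reach I m c d <-> steps (adjE E) V xpredT m c d.
Proof.
move=> cV; split=> H; last first.
  elim: H {cV} => [c1|n c1 c2 c3 /mv_sliding [i [q M]] _ IH]; [exact: reach0 | exact: reachS M IH].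
elim: H cV => [c1 _|n c1 c2 c3 i q M _ IH cV]; first exact: steps0.
have M' := sliding_mv cV M; apply: (stepsS M'); apply: IH; exact: sub_mv M' cV.
Qed.

Lemma csmp_yes_steps : csmp_yes I <-> exists m c,
  [/\ m <= inst_ell I, steps (adjE E) V xpredT m (start_of robots_of) c & goal_test robots_of c].
Proof.
have sV : {subset starts I <= V}.
  by move=> v Hv; rewrite mem_undup !mem_cat start_robots Hv.
rewrite start_robots; split=> [[m [c [Lm [H G]]]]|[m [c [Lm H /goal_robots G]]]]; exists m, c.
  by split=> //; [apply/reach_steps | apply/goal_robots].
by split=> //; split=> //; apply/reach_steps.
Qed.

End Instances.

(** A loop cannot run up to the count stored in the word. It runs over the length of the word, which
    exceeds that count in an encoding, and keeps the indices below it. *)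
Definition word_edges (w : seq nat) :=
  [seq (nth 0 w (i + i + 2), nth 0 w (i + i + 3)) | i <- [seq i <- iota 0 (size w) | i < nth 0 w 1]].
Definition robots_at (w : seq nat) := nth 0 w 1 + nth 0 w 1 + 2.
Definition word_robots (w : seq nat) : seq robot :=
  [seq (nth 0 w (robots_at w + 1 + (i + i + i)),
        (nth 0 w (robots_at w + 2 + (i + i + i)), nth 0 w (robots_at w + 3 + (i + i + i))))
  | i <- [seq i <- iota 0 (size w) | i < nth 0 w (robots_at w)]].
Definition word_ell (w : seq nat) :=
  nth 0 w (robots_at w + 1 + (nth 0 w (robots_at w) + nth 0 w (robots_at w) + nth 0 w (robots_at w))).

Lemma filter_iota_lt m n : m <= n -> [seq i <- iota 0 n | i < m] = iota 0 m.
Proof.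
move=> H; rewrite -{1}(subnKC H) iotaD filter_cat add0n.
rewrite (_ : filter _ (iota m _) = [::]) ?cats0.
  by apply/all_filterP/allP => i; rewrite mem_iota.
by apply/eqP; rewrite -[_ == _]negbK -has_filter; apply/hasPn => i; rewrite mem_iota => /andP[H1 _]; rewrite -leqNgt.
Qed.

Lemma nth_blocks (A : Type) (x0 : A) (f : A -> seq nat) b s r i j : (forall x, size (f x) = b) -> i < size s -> j < b ->
  nth 0 (flatten (map f s) ++ r) (i * b + j) = nth 0 (f (nth x0 s i)) j.
Proof.
move=> Hf; elim: s i => //= x s IH [|i] Hi Hj.
  by rewrite mul0n add0n -catA nth_cat Hf Hj.
by rewrite -catA mulSn -addnA nth_cat Hf ltnNge leq_addr addKn IH.
Qed.

Lemma size_blocks (A : Type) (f : A -> seq nat) b s : (forall x, size (f x) = b) -> size (flatten (map f s)) = size s * b.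
Proof. by move=> Hf; elim: s => //= x s IH; rewrite size_cat IH Hf mulSn. Qed.

Section Decode.
Variable I : csmp_instance.
Let w := encode I.
Let m := size (inst_edges I).
Let k := inst_k I.
Let edge_block (e : nat * nat) := [:: e.1; e.2].
Let tail1 := [:: k] ++ flatten (map enc_robot (inst_robots I)) ++ [:: inst_ell I].
Let tail2 := [:: inst_ell I].

Lemma size_enc_robot r : size (enc_robot r) = 3.
Proof. by rewrite /enc_robot; case: r.2. Qed.

Lemma size_encode : size w = m + m + (k + k + k) + 4.
Proof.
rewrite /w /encode /= !size_cat /= size_cat (@size_blocks _ _ 2) // (@size_blocks _ _ 3); last exact: size_enc_robot.
by rewrite -/m -/(inst_k I) -/k /=; lia.
Qed.

Lemma nth_edges j : nth 0 w (j + 2) = nth 0 (flatten (map edge_block (inst_edges I)) ++ tail1) j.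
Proof. by rewrite addn2. Qed.

Lemma nth_tail j : nth 0 w (m + m + 2 + j) = nth 0 tail1 j.
Proof.
rewrite addnAC nth_edges nth_cat (@size_blocks _ _ 2) // -/m.
by rewrite ltnNge muln2 -addnn leq_addr addKn.
Qed.

Lemma word_edgesE : word_edges w = inst_edges I.
Proof.
rewrite /word_edges; have -> : nth 0 w 1 = m by [].
rewrite filter_iota_lt; last by rewrite size_encode; lia.
rewrite -[RHS](mkseq_nth (0, 0)) /mkseq; apply/eq_in_map => i; rewrite mem_iota => /andP[_ Hi].
rewrite (_ : i + i + 3 = i + i + 1 + 2) ?nth_edges; last by rewrite -!addnA.
have E j : j < 2 -> nth 0 (flatten (map edge_block (inst_edges I)) ++ tail1) (i + i + j) = nth 0 (edge_block (nth (0, 0) (inst_edges I) i)) j.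
  by move=> Hj; rewrite -(@nth_blocks _ (0, 0) edge_block 2 (inst_edges I) tail1) // muln2 addnn.
rewrite -[i + i as X in nth 0 _ X]addn0 !E //=.
by case: (nth _ _ _).
Qed.

Lemma robots_atE : robots_at w = m + m + 2. Proof. by []. Qed.

Lemma word_kE : nth 0 w (robots_at w) = k.
Proof. by rewrite robots_atE -[_ + 2]addn0 nth_tail. Qed.

Lemma word_robotsE : word_robots w = robots_of I.
Proof.
rewrite /word_robots word_kE filter_iota_lt; last by rewrite size_encode; lia.
rewrite -[RHS](mkseq_nth (0, (0, 0))) /mkseq size_map; apply/eq_in_map => i; rewrite mem_iota => /andP[_ Hi].
have E j : j < 3 -> nth 0 w (robots_at w + j.+1 + (i + i + i)) = nth 0 (enc_robot (nth (0, None) (inst_robots I) i)) j.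
  move=> Hj; rewrite robots_atE -addnA nth_tail /tail1 addSn /=.
  rewrite -(@nth_blocks _ (0, None) enc_robot 3 (inst_robots I) tail2 i j size_enc_robot) //.
  by congr nth; lia.
rewrite !E // (nth_map (0, None)) //.
by rewrite /enc_robot; case: (nth (0, None) _ _) => a [t|].
Qed.

Lemma word_ellE : word_ell w = inst_ell I.
Proof.
rewrite /word_ell word_kE robots_atE -addnA nth_tail /tail1 add1n /=.
rewrite nth_cat (@size_blocks _ _ 3); last exact: size_enc_robot.
rewrite -/(inst_k I) -/k (_ : k + k + k = k * 3) ?ltnn ?subnn //; lia.
Qed.

Lemma leq_inst_size : size w <= inst_size I.
Proof.
rewrite /inst_size -/w; elim: w => //= x s IH; rewrite -add1n leq_add // /bitlen.
Qed.

End Decode.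

Lemma solver : exists kappa (g : seq nat -> nat), FPT kappa g /\ forall I, valid_instance I ->
  kappa (encode I) = inst_k I /\ (g (encode I) = 1 <-> csmp_yes I).
Proof.
pose kappa w := size (word_robots w).
have FE : FP word_edges by rewrite /word_edges; fp.
have FR : FP word_robots by rewrite /word_robots /robots_at; fp.
have FL : FP word_ell by rewrite /word_ell /robots_at; fp.
have FK : FP (fun w => [seq r.1 | r <- word_robots w]) by fp.
have SK w : size [seq r.1 | r <- word_robots w] = kappa w by rewrite size_map.
have HD : TB (fun k => k.*2) by apply: TB_le (TB_add TB_id TB_id) _ => k; rewrite addnn.
have [c1 H1] : TB (fun k => k + move_bound k.*2 k) by apply: TB_add TB_id (TB_move_bound HD).
(* The number of greedy levels will be exactly this tower, so the second tower is chosen afterwards,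
   to bound the counts that arise with this number of levels. *)
pose q1 k := tow c1 (k + c1).
have Hq1 : TB q1 by exists c1.
have [c2 H2] : TB (fun k => level_bound k.*2 k (q1 k) + (candidate_bound k.*2 k (q1 k)).+1 ^ k + move_bound k.*2 k).
  apply: TB_add (TB_move_bound HD); apply: TB_add; first exact: (TB_level_bound HD Hq1).
  by apply: TB_pow TB_id; apply: TB_S; apply: (TB_candidate_bound HD Hq1).
have [U1 HU1 S1] := FPT_tow c1 FK SK; have [U2 HU2 S2] := FPT_tow c2 FK SK.
pose g (x : seq nat * (seq nat * seq nat)) :=
  solve (word_edges x.1) (word_robots x.1) (word_ell x.1) x.2.1 x.2.2.
exists kappa, (fun w => g (w, (U1 w, U2 w))); split.
  apply: (FPT_comp (g := g)); first by apply: FP_solve; fp.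
  by apply: FPT_pair; [apply: FPT_FP; apply: FP_id | apply: FPT_pair].
move=> I /and5P[_ _ _ Us _]; have K : kappa (encode I) = inst_k I by rewrite /kappa word_robotsE size_map.
split=> //; rewrite /g /= word_edgesE word_robotsE word_ellE.
have Sr : size (robots_of I) = inst_k I by rewrite size_map.
have L2 := H2 (inst_k I).
rewrite csmp_yes_steps; apply: solve_correct; rewrite ?Sr ?S1 ?S2 ?K ?start_robots //.
- by apply: leq_trans L2; rewrite -addnA leq_addr.
- by apply: leq_trans L2; rewrite addnAC leq_addl.
- by apply: leq_trans L2; rewrite leq_addl.
Qed.

Theorem mainTheorem1 :
  exists (A : program) (f : nat -> nat) (c : nat),
    computable f /\
    forall I : csmp_instance, valid_instance I ->
      exists out, runs_within A (encode I) (f (inst_k I) * inst_size I ^ c) out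
                  /\ (out = 1 <-> csmp_yes I).
Proof.
have [kappa [g [[code [F [d [HF Hc _]]]] Hg]]] := solver.
have [A HA] := program_of_code Hc.
(* Loading takes [21 * size w + 48] steps, which is at most 69 times the size of the instance; hence
   69. *)
have [c Hf] : TB (fun k => F k + 69) by apply: TB_add HF (TB_const _).
exists A, (fun k => tow c (k + c)), (d + d).+1; split; first exact: computable_tow.
move=> I /Hg [K Y]; exists (g (encode I)); split=> //.
have Sw := size_encode I; have Ls := leq_inst_size I.
have [|t [s [Lt Ms]]] := HA (encode I); first by rewrite Sw addn4.
exists t, s; split=> //; apply: leq_trans Lt _; rewrite K.
have S4 : 4 <= inst_size I by apply: leq_trans Ls; rewrite Sw leq_addl.
apply: leq_trans (_ : (F (inst_k I) + 69) * inst_size I ^ (d + d).+1 <= _); last by rewrite leq_mul2r Hf orbT.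
rewrite mulnDl addnC; apply: leq_add.
  rewrite leq_mul2l; apply/orP; right.
  (* The exponent is doubled because the word has tree size [2 * size w + 1], and adding two still
     leaves at most the square of the instance size, which is at least four. *)
  apply: leq_trans (_ : inst_size I ^ (d + d) <= _); last by rewrite leq_pexp2l // (leq_trans _ S4).
  rewrite addnn -mul2n expnM; apply: leq_exp; rewrite sz_natseq.
  by move: Ls S4; move: (size _) (inst_size I) => a b; nia.
apply: leq_trans (_ : 69 * inst_size I <= _).
  by move: Ls S4; move: (size _) (inst_size I) => a b; lia.
by rewrite leq_mul2l -{1}[inst_size I]expn1 leq_pexp2l // (leq_trans _ S4).
Qed.
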